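(* There is a nonempty open subset $U$ of the moduli space $M_4^{\mathrm{met}}$ of metric graphs of genus $4$ such that every metric graph $\Gamma$ in $U$ has no separating edges and $W^1_3(\Gamma)$ has positive dimension.
   Context: Metric graphs. A metric graph is a compact connected metric space obtained from a finite connected graph (loops and multiple edges allowed) by assigning a positive real length to each edge. Its genus $g$ is its first Betti number. A separating edge is an edge whose interior, when removed, disconnects the graph. Divisors. A divisor on a metric graph $\Gamma$ is a finite $\mathbb{Z}$-linear combination of points of $\Gamma$; its degree is the sum of its coefficients; it is effective if all its coefficients are nonnegative. For a continuous piecewise linear function $f$ on $\Gamma$ with integer slopes, $\mathrm{div}(f) = \sum_{v \in \Gamma} \mathrm{ord}_v(f)\, v$, where $\mathrm{ord}_v(f)$ is the sum of the incoming slopes of $f$ at $v$; such divisors are called principal. Two divisors are equivalent if their difference is principal. $\mathrm{Pic}_d(\Gamma)$ is the set of equivalence classes of divisors of degree $d$. Rank. The rank $r(D)$ of a divisor $D$ is $-1$ if $D$ is not equivalent to an effective divisor, and otherwise is the largest integer $r$ such that for every effective divisor $E$ of degree $r$ on $\Gamma$ there is a divisor $D'$ equivalent to $D$ with $D' - E$ effective. The rank depends only on the class $[D]$. Brill-Noether locus. For nonnegative integers $r,d$, $W^r_d(\Gamma) \subset \mathrm{Pic}_d(\Gamma)$ is the set of divisor classes of degree $d$ and rank at least $r$. Polyhedral structure and dimension. Let $\Omega^*(\Gamma)$ be the dual of the real vector space of harmonic 1-forms on $\Gamma$ (assignments of a real slope to each edge, relative to an orientation, such that the sum of incoming slopes is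 zero at every vertex); $H_1(\Gamma,\mathbb{Z})$ embeds in it as a lattice by integrating 1-forms along 1-cycles. Fix a basepoint $w \in \Gamma$. There is a group isomorphism $\mathrm{Pic}_0(\Gamma) \cong \Omega^*(\Gamma)/H_1(\Gamma,\mathbb{Z})$ sending $[v-w]$ to integration along any path from $w$ to $v$ and, combined with the bijection $\mathrm{Pic}_d(\Gamma) \to \mathrm{Pic}_0(\Gamma)$, $[D] \mapsto [D - dw]$, this gives a universal covering map $\Omega^*(\Gamma) \to \mathrm{Pic}_d(\Gamma)$. A subset of $\mathrm{Pic}_d(\Gamma)$ is polyhedral if it is the image of a finite union of polytopes in $\Omega^*(\Gamma)$ (this is independent of $w$); its dimension is the maximum of the dimensions of these polytopes. The set $W^r_d(\Gamma)$ is polyhedral, and $\dim W^r_d(\Gamma)$ is its dimension. Moduli space. For a finite connected graph $G$ of genus $4$ all of whose vertices have valence at least $3$ (a loop counts twice), with edges $e_1, \dots, e_n$, let $\sigma^*_G \subset \mathbb{R}_{\geq 0}^n$ be the set of $\ell = (\ell_1,\dots,\ell_n)$ such that the edges $e_i$ with $\ell_i = 0$ contain no cycle, with the subspace topology. To $\ell \in \sigma^*_G$ is associated the metric graph $\Gamma_\ell$ of genus $4$ obtained by giving $e_i$ length $\ell_i$, edges of length $0$ being contracted. The moduli space $M_4^{\mathrm{met}}$ is the set of isometry classes of all such metric graphs $\Gamma_\ell$, with the finest topology for which all the maps $\sigma^*_G \to M_4^{\mathrm{met}}$, $\ell \mapsto [\Gamma_\ell]$, are continuous (i.e. the colimit of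 the cones $\sigma^*_G$). *)

(* Defs.v *)
From HB Require Import structures.
From mathcomp Require Import all_boot all_order all_algebra.
From mathcomp Require Import generic_quotient.
From mathcomp Require Import all_classical all_reals topology normedtype.
From mathcomp Require Import freeg.

Set Implicit Arguments.
Unset Strict Implicit.
Unset Printing Implicit Defensive.

Import Order.TTheory GRing.Theory Num.Theory.
Import numFieldNormedType.Exports.

Local Open Scope classical_set_scope.
Local Open Scope ring_scope.

(* The orientation of the edges is an arbitrary choice.  Loops and multiple
   edges are allowed. *)
Record graph := Graph {
  vertex : finType;
  edge : finType;
  src : edge -> vertex;
  tgt : edge -> vertex }.

Section Graph.
Variable G : graph.

Definition adj (A : pred (edge G)) : rel (vertex G) := fun u v =>
  [exists e, A e && (((src e == u) && (tgt e == v)) ||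
                     ((src e == v) && (tgt e == u)))].

Definition joined (A : pred (edge G)) : bool :=
  [forall u, forall v, connect (adj A) u v].

Definition connected_graph : bool := (0 < #|vertex G|)%N && joined predT.

Definition separating (e : edge G) : bool := ~~ joined (predC1 e).

(* A loop contributes to both summands. *)
Definition valence (v : vertex G) : nat :=
  (#|[pred e : edge G | src e == v]| + #|[pred e : edge G | tgt e == v]|)%N.

(* Oriented edges: (e, false) goes from src e to tgt e, (e, true) is reversed. *)
Definition dart : Type := (edge G * bool)%type.
Definition dart_src (a : dart) := if a.2 then tgt a.1 else src a.1.
Definition dart_tgt (a : dart) := if a.2 then src a.1 else tgt a.1.

(* A loop is a cycle of length 1, two parallel edges form one of length 2. *)
Definition graph_cycle (s : seq dart) : bool :=
  [&& s != [::], cycle (fun a b => dart_tgt a == dart_src b) s,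
      uniq (map dart_src s) & uniq (map fst s)].

Definition boundary (M : zmodType) (z : {ffun edge G -> M}) :
    {ffun vertex G -> M} :=
  [ffun v => \sum_(e | tgt e == v) z e - \sum_(e | src e == v) z e].

Lemma boundary_is_linear (K : fieldType) :
  linear (@boundary K^o : {ffun edge G -> K^o} -> {ffun vertex G -> K^o}).
Proof.
move=> a z z'; apply/ffunP => v; rewrite !ffunE.
under eq_bigr do rewrite !ffunE.
under [X in _ - X]eq_bigr do rewrite !ffunE.
by rewrite !big_split /= -!scaler_sumr opprD addrACA scalerBr.
Qed.

HB.instance Definition _ (K : fieldType) :=
  GRing.isLinear.Build K {ffun edge G -> K^o} {ffun vertex G -> K^o} *:%R
    (@boundary K^o) (@boundary_is_linear K).

(* The first homology with coefficients in a field K.  Over the reals, this is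
   also the space of harmonic 1-forms: z e is the slope on the edge e, from
   src e to tgt e, and the incoming slopes at each vertex sum up to zero. *)
Definition cycle_space (K : fieldType) : {vspace {ffun edge G -> K^o}} :=
  lker (linfun (@boundary K^o)).

Definition genus : nat := \dim (cycle_space rat).

End Graph.

Section MetricGraph.
Variable R : realType.

Record metric_graph := MetricGraph {
  mgraph :> graph;
  len : edge mgraph -> R;
  len_gt0 : forall e, 0 < len e;
  mgraph_connected : connected_graph mgraph }.

Section Geometry.
Variable Gam : metric_graph.
Local Notation V := (vertex Gam).
Local Notation E := (edge Gam).

(* A point is a vertex or a pair (e, t), the point of the interior of e at
   distance t from src e along e. *)
Definition point_of : Type := (V + {x : E * R | 0 < x.2 < len x.1})%type.
HB.instance Definition _ := Choice.on point_of.

Definition edge_pt (e : E) (t : R) : point_of :=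
  if insub (e, t) is Some p then inr p
  else inl (if t <= 0 then src e else tgt e).

(* The segment (e, a, b) runs along e from edge_pt e a to edge_pt e b. *)
Definition segment : Type := (E * R * R)%type.

Fixpoint is_path (x : point_of) (s : seq segment) (y : point_of) : Prop :=
  if s is (e, a, b) :: s' then
    [/\ 0 <= a <= len e, 0 <= b <= len e, edge_pt e a = x
      & is_path (edge_pt e b) s' y]
  else x = y.

Definition path_length (s : seq segment) : R := \sum_(x <- s) `|x.2 - x.1.2|.

Definition dist (x y : point_of) : R :=
  inf [set path_length s | s in [set s | is_path x s y]].

Definition divisor : Type := {freeg point_of}.
HB.instance Definition _ := GRing.Zmodule.on divisor.

Definition effective (D : divisor) : Prop := forall x, 0 <= coeff x D.

Definition on_edge (f : point_of -> R) (e : E) (t : R) : R := f (edge_pt e t).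

(* Continuity holds as the pieces are closed and vertices are shared. *)
Definition piecewise_linear (f : point_of -> R) : Prop :=
  forall e, exists s : seq R,
    [/\ path <=%R 0 s, last 0 s = len e &
        forall i, (i < size s)%N -> exists (m : int) (b : R),
          forall t, (0 :: s)`_i <= t <= s`_i ->
            on_edge f e t = m%:~R * t + b].

Definition slope_left (f : point_of -> R) (e : E) (t : R) : R :=
  lim ((on_edge f e t - on_edge f e (t - h)) / h @[h --> 0^'+]).

Definition slope_right (f : point_of -> R) (e : E) (t : R) : R :=
  lim ((on_edge f e (t + h) - on_edge f e t) / h @[h --> 0^'+]).

(* Sum of incoming slopes. *)
Definition ord_at (f : point_of -> R) (x : point_of) : R :=
  match x with
  | inl v => \sum_(e | tgt e == v) slope_left f e (len e)
             - \sum_(e | src e == v) slope_right f e 0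
  | inr p => slope_left f (val p).1 (val p).2
             - slope_right f (val p).1 (val p).2
  end.

Definition principal (D : divisor) : Prop :=
  exists2 f, piecewise_linear f & forall x, (coeff x D)%:~R = ord_at f x.

Definition equivalent (D D' : divisor) : Prop := principal (D - D').

Definition div_class (D : divisor) : set divisor :=
  [set D' | equivalent D D'].

Definition Pic (d : int) : set (set divisor) :=
  [set div_class D | D in [set D | deg D = d]].

Definition removable (D : divisor) (r : nat) : Prop :=
  forall E : divisor, effective E -> deg E = r%:Z ->
    exists2 D', equivalent D' D & effective (D' - E).

(* xget picks the largest r; its default value 0 is never used, since
   a removable r is at most deg D. *)
Definition rank (D : divisor) : int :=
  if `[< exists2 D', equivalent D' D & effective D' >] then
    (xget 0%N [set r | removable D r /\
                       forall r', removable D r' -> (r' <= r)%N])%:Z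
  else -1.

Definition brill_noether (r d : nat) : set (set divisor) :=
  [set C | Pic d%:Z C /\ exists2 D, C = div_class D & r%:Z <= rank D].

Definition harmonic : {vspace {ffun E -> R^o}} := cycle_space Gam R.

Definition harmonic_dual : vectType R := 'Hom(subvs_of harmonic, R^o).

Definition path_integral (s : seq segment) : harmonic_dual :=
  linfun (fun om : subvs_of harmonic =>
    \sum_(x <- s) vsval om x.1.1 * (x.2 - x.1.2) : R^o).

Definition cycle_integral (z : {ffun E -> int}) : harmonic_dual :=
  linfun (fun om : subvs_of harmonic =>
    \sum_e vsval om e * (len e *~ z e) : R^o).

(* H_1(Gam, Z) in the dual of harmonic 1-forms *)
Definition cycle_lattice : set harmonic_dual :=
  [set cycle_integral z | z in [set z | boundary z = 0]].

(* phi lies in the coset of the lattice H_1 associated with a divisor D of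
   degree 0 by the homomorphism sending v - w to the integral along any
   path from w to v. *)
Definition abel_jacobi (w : point_of) (D : divisor) (phi : harmonic_dual) :
    Prop :=
  exists2 gam : point_of -> seq segment, forall v, is_path w (gam v) v &
    cycle_lattice (phi - \sum_(v <- dom D) path_integral (gam v) *~ coeff v D).

(* Graph of the universal covering map from the dual of harmonic 1-forms
   to Pic_d. *)
Definition covering (w : point_of) (d : nat) (phi : harmonic_dual)
    (C : set divisor) : Prop :=
  exists D, [/\ deg D = d%:Z, C = div_class D
              & abel_jacobi w (D - << w >> *+ d) phi].

End Geometry.

Arguments brill_noether : clear implicits.

Definition isometric (Gam Gam' : metric_graph) : Prop :=
  exists2 f : point_of Gam -> point_of Gam', bijective f &
    forall x y, dist (f x) (f y) = dist x y.

Lemma isometric_refl Gam : isometric Gam Gam.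
Proof. by exists id => //; exists id. Qed.

Lemma isometric_sym Gam Gam' : isometric Gam Gam' -> isometric Gam' Gam.
Proof.
move=> [f [g fK gK] fd]; exists g; first by exists f.
by move=> x y; rewrite -fd !gK.
Qed.

Lemma isometric_trans Gam Gam' Gam'' :
  isometric Gam Gam' -> isometric Gam' Gam'' -> isometric Gam Gam''.
Proof.
move=> [f bf fd] [g bg gd]; exists (g \o f); first exact: bij_comp.
by move=> x y /=; rewrite gd fd.
Qed.

(* Polytopes are given by finite lists of points spanning them. *)
Definition hull (W : lmodType R) (p : seq W) : set W :=
  [set \sum_(i < size p) a i *: p`_i | a in
    [set a : 'I_(size p) -> R | (forall i, 0 <= a i) /\ \sum_i a i = 1]].

Definition polytope_dim (W : vectType R) (p : seq W) : nat :=
  \dim (span [seq x - head 0 p | x <- p]%R).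

(* The subset S of Pic_d is polyhedral, of dimension n; w is a basepoint. *)
Definition polyhedral_of_dim (Gam : metric_graph) (w : point_of Gam) (d : nat)
    (S : set (set (divisor Gam))) (n : nat) : Prop :=
  exists ps : seq (seq (harmonic_dual Gam)),
    [/\ [::] \notin ps,
        S = [set C | exists p phi, [/\ p \in ps, hull p phi
                                     & covering w d phi C]]
      & n = (\max_(p <- ps) polytope_dim p)%N].

End MetricGraph.

Arguments brill_noether {R} Gam r d _.

Section Contraction.
Variables (R : realType) (G : graph) (l : edge G -> R).
Hypothesis l_ge0 : forall e, 0 <= l e.
Hypothesis Gconn : connected_graph G.

Definition zero_adj : rel (vertex G) := adj [pred e | l e == 0].

Lemma zero_adj_sym : connect_sym zero_adj.
Proof.
by apply: sym_connect_sym => u v; apply: eq_existsb => e; rewrite orbC.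
Qed.

(* Contracting the edges of length 0: the new vertices are the canonical
   representatives of the connected components of the subgraph they form. *)
Definition contract_vertex : finType := {v : vertex G | roots zero_adj v}.

Definition contract_proj (v : vertex G) : contract_vertex :=
  Sub (fingraph.root zero_adj v) (roots_root zero_adj_sym v).

Definition contract_edge : finType := {e : edge G | 0 < l e}.

Definition contract_graph : graph :=
  @Graph contract_vertex contract_edge
    (fun e => contract_proj (src (val e)))
    (fun e => contract_proj (tgt (val e))).

Lemma contract_connected : connected_graph contract_graph.
Proof.
case/andP: Gconn => /card_gt0P[v0 _] /forallP Gjoined; apply/andP; split.
  by apply/card_gt0P; exists (contract_proj v0).
have projK (v : contract_vertex) : contract_proj (val v) = v.
  by apply: val_inj; rewrite /=; apply/eqP; exact: (valP v).
apply/forallP => u; apply/forallP => v; rewrite -[u]projK -[v]projK.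
have /connectP[p + ->] := forallP (Gjoined (val u)) (val v).
elim: p (val u) => [|y p IHp] x //= /andP[/existsP[e /andP[_ exy]] pyp].
apply: connect_trans (IHp _ pyp).
have [le0|le0] := eqVneq (l e) 0.
  suff -> : contract_proj x = contract_proj y by [].
  apply: val_inj; apply/eqP; rewrite /= (root_connect zero_adj_sym).
  by apply: connect1; apply/existsP; exists e; rewrite inE le0 eqxx.
have lep : 0 < l e by rewrite lt_def le0 l_ge0.
apply: connect1; apply/existsP; exists (Sub e lep : contract_edge) => /=.
by case/orP: exy => /andP[/eqP -> /eqP ->]; rewrite !eqxx ?orbT.
Qed.

Definition contract : metric_graph R :=
  @MetricGraph R contract_graph (fun e => l (val e)) (fun e => valP e)
    contract_connected.

End Contraction.

(* Up to isomorphism, all connected graphs of genus g whose vertices have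
   valence at least 3. *)
Record stable_graph (g : nat) := StableGraph {
  nb_vertex : nat;
  nb_edge : nat;
  ends : 'I_nb_edge -> 'I_nb_vertex * 'I_nb_vertex;
  sgraph :> graph := @Graph 'I_nb_vertex 'I_nb_edge
    (fun e => (ends e).1) (fun e => (ends e).2);
  stable_connected : connected_graph sgraph;
  stable_genus : genus sgraph = g;
  stable_valence : forall v : vertex sgraph, (3 <= valence v)%N }.

HB.instance Definition _ g := gen_eqMixin (stable_graph g).
HB.instance Definition _ g := gen_choiceMixin (stable_graph g).

Section Moduli.
Variables (R : realType) (g : nat).

Definition cone (G : stable_graph g) : set 'rV[R]_(nb_edge G) :=
  [set l | (forall e, 0 <= l 0 e) /\
     ~ exists2 s : seq (dart G), graph_cycle s &
         forall a : dart G, a \in s -> l 0 a.1 = 0].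
Arguments cone G : clear implicits.

Definition cone_sum : Type := {G : stable_graph g & cone G}.
HB.instance Definition _ := Topological.on cone_sum.

Lemma cone_ge0 (G : stable_graph g) (l : cone G) (e : edge G) :
  0 <= (val l : 'rV[R]_(nb_edge G)) 0 e.
Proof. by case: l => l /= /set_mem[]. Qed.

Definition metric_graph_of (x : cone_sum) : metric_graph R :=
  contract (@cone_ge0 _ (projT2 x)) (stable_connected (projT1 x)).

Definition same_class (x y : cone_sum) : bool :=
  `[< isometric (metric_graph_of x) (metric_graph_of y) >].

Lemma same_class_equiv : equiv_class_of same_class.
Proof.
split.
- by move=> x; apply/asboolP; exact: isometric_refl.
- by move=> x y; apply/asboolP/asboolP; exact: isometric_sym.
- by move=> y x z /asboolP xy /asboolP yz; apply/asboolP; exact: isometric_trans yz.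
Qed.

Canonical same_class_rel := EquivRelPack same_class_equiv.

(* Isometry classes, with the quotient topology of the disjoint union of the
   cones. *)
Definition moduli : Type := quotient_topology {eq_quot same_class_rel}%qT.
HB.instance Definition _ := Topological.on moduli.
HB.instance Definition _ := Quotient.on moduli.

Definition isometry_class (x : cone_sum) : moduli := (\pi_moduli x)%qT.

End Moduli.

(* Main.v *)
(* The loop of loops consists of three double edges, between u_i and v_i, joined
   into a ring by three edges c_i between v_i and u_(i+1).  A harmonic 1-form takes
   the same value on the three edges c_i, so by Abel's theorem the class of a sum of
   chips at positions p_i on the c_i depends only on the sum of the p_i.  When this
   sum is at least the length of each c_i and at most that of any two of them
   together, the chips can be moved to any point of any c_i, and also to u_i and v_i
   for any i, from where they sweep the two edges between u_i and v_i by moving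
   towards each other.  These classes form a segment in W^1_3.  Lengths between 9
   and 11 leave room for such sums, and are recognized by isometries.

   W^1_3 is polyhedral for any metric graph: it is the set of the classes phi such
   that for each edge e and each s, phi lies in one of finitely many polytopes
   depending linearly on s (the effective classes with a chip at s on e).  For fixed
   e, these polytopes form polytopes Q_j in the space of pairs (phi, s), and
   { phi | forall s, exists j, (phi, s) in Q_j } is a finite union of polytopes, as
   closed intervals cover [0, len e] if and only if some chain of them does. *)
Require Import Defs.
From HB Require Import structures.
From mathcomp Require Import all_boot all_order all_algebra.
From mathcomp Require Import generic_quotient.
From mathcomp Require Import all_classical all_reals topology normedtype.
From mathcomp Require Import freeg ring lra zify.

Set Implicit Arguments.
Unset Strict Implicit.
Unset Printing Implicit Defensive.

Import Order.TTheory GRing.Theory Num.Theory.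
Import numFieldNormedType.Exports.

Local Open Scope classical_set_scope.
Local Open Scope ring_scope.

(** * Polytopes *)

(** [polyhedral_of_dim] leaves the choice of polytopes free, so the dimension is shown to be
    positive without computing W^1_3: a finite list of points cannot contain the lifts of a whole
    segment of classes. Divisors of functions, paths and integral cycles are all encoded as one kind
    of 1-chain, a list of [kink]s, whose boundary is a divisor and whose integral is a functional on
    harmonic 1-forms. Abel's theorem then says that a divisor is principal exactly when it bounds a
    chain of integral 0, and lifting a class means integrating a chain that it bounds. The moduli
    space has a quotient topology, and a metric graph may a priori occur in other cones, even after
    contractions. The open set has to be saturated, so the graph and the bounds on its lengths must
    be recovered from the distance alone. Being trivalent, the loop of loops has the largest numbers
    of vertices and edges possible in genus 4, so the injections given by an isometry are
    bijections. *)

Section Convexity.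
Variable R : realType.

Definition convex_set (W : lmodType R) (A : set W) :=
  forall (x y : W) (t : R), A x -> A y -> 0 <= t <= 1 -> A (t *: x + (1 - t) *: y).

Definition affine_map (W W' : lmodType R) (f : W -> W') :=
  forall (x y : W) (t : R), f (t *: x + (1 - t) *: y) = t *: f x + (1 - t) *: f y.

Lemma scale_reg (a x : R) : a *: (x : R^o) = a * x. Proof. by []. Qed.

(** The weights of a tail of the list do not sum to 1, so the induction is on barycentres of
    arbitrary positive total weight. Membership in [A] is only asked where the weight is nonzero: in
    [hull_cut], vertices above the hyperplane may carry weight 0. *)
Lemma convex_sum (W : lmodType R) (A : set W) (I : eqType) (r : seq I)
    (P : pred I) (a : I -> R) (x : I -> W) :
  convex_set A -> (forall i, P i -> 0 <= a i) ->
  (forall i, P i -> a i != 0 -> A (x i)) ->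
  \sum_(i <- r | P i) a i = 1 -> A (\sum_(i <- r | P i) a i *: x i).
Proof.
move=> cA a0 xA a1.
suff H : forall c, \sum_(i <- r | P i) a i = c -> 0 < c ->
    A (c^-1 *: \sum_(i <- r | P i) a i *: x i).
  by have := H _ a1 ltr01; rewrite invr1 scale1r.
elim: r {a1} => [|i r IHr] c; first by rewrite big_nil => <-; rewrite ltxx.
rewrite !big_cons; case: ifP => Pi; last exact: IHr.
move=> <- {c}; set s := \sum_(j <- r | P j) a j; set y := \sum_(j <- r | _) _.
have s0 : 0 <= s by apply: sumr_ge0.
have [si|ai] := eqVneq (a i) 0.
  by rewrite si scale0r !add0r => sp; apply: IHr.
have aip : 0 < a i by rewrite lt_def ai a0.
move=> sp; have [se|sn] := eqVneq s 0.
  suff -> : y = 0 by rewrite se !addr0 scalerA mulVf // scale1r; exact: xA.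
  rewrite /y; move: se; rewrite /s => /eqP; rewrite psumr_eq0 // => /allP.
  elim: r {IHr s s0 y sp} => [|j r IHr] h; first by rewrite big_nil.
  rewrite big_cons IHr => [|k kr]; last by apply: h; rewrite inE kr orbT.
  case: ifP => Pj //; have := h j; rewrite inE eqxx Pj => /(_ isT)/eqP ->.
  by rewrite scale0r addr0.
have spos : 0 < s by rewrite lt_def sn.
have := cA _ _ (a i / (a i + s)) (xA i Pi ai) (IHr s erefl spos).
have -> : 1 - a i / (a i + s) = s / (a i + s).
  by apply/eqP; rewrite subr_eq -mulrDl (addrC s) divff // gt_eqF.
rewrite scalerA mulrAC divff // mul1r (mulrC (a i)) -scalerA -scalerDr; apply.
by rewrite mulrC divr_ge0 ?(ltW aip) ?(ltW sp) //= ler_pdivrMr // mul1r lerDl.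
Qed.

Section Hull.
Variable W : lmodType R.
Implicit Types p q : seq W.

Lemma hullP p x : hull p x <-> exists a : 'I_(size p) -> R,
  [/\ forall i, 0 <= a i, \sum_i a i = 1 & x = \sum_i a i *: p`_i].
Proof.
by split=> [[a [a0 a1] <-]|[a [a0 a1 ->]]]; exists a.
Qed.

Lemma hull_convex p : convex_set (hull p).
Proof.
move=> x y t /hullP[a [a0 a1 ->]] /hullP[b [b0 b1 ->]] /andP[t0 t1].
apply/hullP; exists (fun i => t * a i + (1 - t) * b i); split.
- by move=> i; rewrite addr_ge0 // mulr_ge0 // subr_ge0.
- by rewrite big_split /= -!mulr_sumr a1 b1; ring.
- rewrite !scaler_sumr -big_split /=; apply: eq_bigr => i _.
  by rewrite [RHS]scalerDl !scalerA.
Qed.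

Lemma hull_mem p x : x \in p -> hull p x.
Proof.
move=> xp; have h : (index x p < size p)%N by rewrite index_mem.
apply/hullP; exists (fun i => (i == Ordinal h)%:R); split=> [i||].
- exact: ler0n.
- rewrite (bigD1 (Ordinal h)) //= eqxx big1 ?addr0 // => i /negPf -> //.
- rewrite (bigD1 (Ordinal h)) //= eqxx big1 ?addr0 ?scale1r ?nth_index //.
  by move=> i /negPf ->; rewrite scale0r.
Qed.

Lemma hull_min p (A : set W) : convex_set A -> {in p, forall x, A x} ->
  hull p `<=` A.
Proof.
move=> cA pA x /hullP[a [a0 a1 ->]]; apply: convex_sum => // i _ _.
by apply: pA; rewrite mem_nth ?ltn_ord.
Qed.

Lemma hull_nil : hull (Nil W) = set0.
Proof.
apply/seteqP; split=> // x /hullP[a [_ + _]].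
by rewrite big_ord0 => /esym/eqP; rewrite oner_eq0.
Qed.

End Hull.

Lemma convex_preimage (W W' : lmodType R) (f : W -> W') A :
  affine_map f -> convex_set A -> convex_set (f @^-1` A).
Proof. by move=> af cA x y t /= Ax Ay tI; rewrite af; apply: cA. Qed.

Lemma hull_image (W W' : lmodType R) (f : W -> W') p : affine_map f ->
  f @` hull p = hull (map f p).
Proof.
move=> af; apply/seteqP; split.
  move=> _ [x xp <-]; apply: (hull_min (A := f @^-1` hull (map f p))) xp.
    by apply: convex_preimage => //; exact: hull_convex.
  by move=> z zp; apply: hull_mem; rewrite map_f.
apply: hull_min.
  move=> _ _ t [x xp <-] [y yp <-] tI; exists (t *: x + (1 - t) *: y) => //.
  exact: hull_convex.
by move=> _ /mapP[x xp ->]; exists x => //; exact: hull_mem.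
Qed.

(** Convexity is used in one factor at a time: [x] varies while the second component is a vertex of
    [q], then [y] varies with [x] fixed. *)
Lemma hull_prod (W W' : lmodType R) (p : seq W) (q : seq W') :
  hull [seq (x, y) | x <- p, y <- q] = [set z | hull p z.1 /\ hull q z.2].
Proof.
apply/seteqP; split.
  apply: hull_min.
    by move=> x y t [? ?] [? ?] tI; split; apply: hull_convex.
  by move=> _ /allpairsP[[x y] [xp yq ->]]; split; apply: hull_mem.
set H := hull (allpairs _ _ _) => -[x y] /= [xp yq].
have cH : convex_set H by exact: hull_convex.
have pairl (y' : W') : affine_map (fun x : W => (x, y')).
  by move=> a b t; congr pair => //=; rewrite -scalerDl subrKC scale1r.
have pairr (x' : W) : affine_map (fun y : W' => (x', y)).
  by move=> a b t; congr pair => //=; rewrite -scalerDl subrKC scale1r.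
have h1 : {in q, forall y', H (x, y')}.
  move=> y' y'q.
  apply: (hull_min (A := [set x | H (x, y')]) (convex_preimage (pairl y') cH)) xp.
  by move=> a ap; apply: hull_mem; apply/allpairsP; exists (a, y').
exact: (hull_min (A := [set y | H (x, y)]) (convex_preimage (pairr x) cH)) yq.
Qed.

(* The vertices of the part of a polytope where f <= 0 are vertices of the
   polytope or lie on segments between two vertices that are separated by
   the hyperplane f = 0. *)
Definition cut_points (W : lmodType R) (f : W -> R) (p : seq W) : seq W :=
  [seq x <- p | f x <= 0] ++
  [seq (f x - f y)^-1 *: (f x *: y - f y *: x) |
     x <- [seq x <- p | 0 < f x], y <- [seq x <- p | f x <= 0]].

(* Each vertex i above the hyperplane F = 0 is paired with each vertex j below it,
   in proportion to - a j * F j; each pair contributes a point of the hyperplane. *)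
Lemma balance_sum (V : lmodType R) n (a F : 'I_n -> R) (g : 'I_n -> V)
    (b : R) :
  b != 0 -> \sum_(j | F j <= 0) a j * - F j = b ->
  \sum_(j | F j <= 0) (a j * (1 - (\sum_(i | 0 < F i) a i * F i) / b)) *: g j +
  \sum_(i | 0 < F i) \sum_(j | F j <= 0)
    (a i * a j / b) *: (F i *: g j - F j *: g i) = \sum_i a i *: g i.
Proof.
move=> b0 bE; rewrite [RHS](bigID (fun j => F j <= 0)) /=.
rewrite (eq_bigl (fun i => 0 < F i) _ (fun i => esym (ltNge _ _))).
under [X in _ + X = _]eq_bigr => i _.
  under eq_bigr do rewrite scalerBr !scalerA.
  rewrite sumrB -scaler_suml.
  have -> : \sum_(j | F j <= 0) a i * a j / b * F j = - a i.
    rewrite (eq_bigr (fun j => (- a i / b) * (a j * - F j))).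
      by rewrite -mulr_sumr bE mulfVK.
    by move=> j _; field.
  rewrite scaleNr opprK.
  over.
rewrite big_split /= addrA exchange_big /=; congr (_ + _).
rewrite -big_split /=; apply: eq_bigr => j _.
rewrite -scaler_suml -scalerDl; congr (_ *: _).
rewrite [X in _ + X = _](_ : _ = a j * ((\sum_(i | 0 < F i) a i * F i) / b));
  first by rewrite mulrBr mulr1 subrK.
by rewrite mulr_suml mulr_sumr; apply: eq_bigr => i _; field.
Qed.

(** The graph of [f] is convex, so [convex_sum] passes from binary to finite combinations. *)
Lemma affine_sum (W W' : lmodType R) (f : W -> W') (I : eqType) (r : seq I)
    (P : pred I) (a : I -> R) (x : I -> W) :
  affine_map f -> (forall i, P i -> 0 <= a i) -> \sum_(i <- r | P i) a i = 1 ->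
  f (\sum_(i <- r | P i) a i *: x i) = \sum_(i <- r | P i) a i *: f (x i).
Proof.
move=> af a0 a1.
pose A : set (W * W') := [set z | f z.1 = z.2].
have cA : convex_set A by move=> x1 x2 t; rewrite /A /= af => -> ->.
have := @convex_sum _ A I r P a (fun i => (x i, f (x i))) cA a0 (fun _ _ _ => erefl) a1.
by rewrite /A /= !raddf_sum.
Qed.

Lemma hull_cut (W : lmodType R) (f : W -> R^o) (p : seq W) : affine_map f ->
  hull p `&` [set x | f x <= 0] = hull (cut_points f p).
Proof.
move=> af; apply/seteqP; split; last first.
  have cN : convex_set [set x | f x <= 0].
    move=> x y t /= fx fy /andP[t0 t1]; rewrite af !scale_reg.
    by rewrite -oppr_ge0 opprD -!mulrN addr_ge0 // mulr_ge0 // ?oppr_ge0 // subr_ge0.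
  apply: hull_min.
    by move=> x y t [px fx] [py fy] tI; split; [apply: hull_convex|apply: cN].
  move=> x; rewrite mem_cat => /orP[|/allpairsP[[y z]]].
    by rewrite mem_filter => /andP[fx xp]; split => //; apply: hull_mem.
  rewrite /= !mem_filter => -[/andP[fy yp] /andP[fz zp] ->].
  have d0 : 0 < f y - f z by rewrite subr_gt0; exact: le_lt_trans fy.
  have -> : (f y - f z)^-1 *: (f y *: z - f z *: y) =
     (f y / (f y - f z)) *: z + (1 - f y / (f y - f z)) *: y.
    rewrite scalerBr !scalerA mulrC -scaleNr; congr (_ + _ *: _).
    by field; rewrite gt_eqF.
  split.
    apply: hull_convex; try exact: hull_mem.
    by rewrite divr_ge0 ?(ltW fy) ?(ltW d0) //= ler_pdivrMr // mul1r lerDl oppr_ge0.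
  rewrite /= af !scale_reg.
  rewrite (_ : _ + _ = 0) //; apply/eqP/eqP; field; by rewrite gt_eqF.
move=> x [/hullP[a [a0 a1 xE]] fx0].
have fxE : f x = \sum_i a i * f p`_i by rewrite xE affine_sum.
pose F (i : 'I_(size p)) := f p`_i.
pose b := \sum_(j | F j <= 0) a j * - F j.
(* As [f x <= 0], the part above the hyperplane weighs at most the part [b] below it, so the
   vertices below keep nonnegative weights after the pairing. *)
have bge : \sum_(i | 0 < F i) a i * F i <= b.
  rewrite -subr_ge0 /b; under eq_bigr do rewrite mulrN; rewrite sumrN -opprD oppr_ge0.
  apply: le_trans fx0; rewrite fxE [leRHS](bigID (fun j => F j <= 0)) /=.
  by rewrite lerD2l (eq_bigl _ _ (fun i => esym (ltNge _ _))).
have pos_ge0 i : 0 < F i -> 0 <= a i * F i by move=> Fi; rewrite mulr_ge0 ?(ltW Fi).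
have mem_neg (j : 'I_(size p)) : F j <= 0 -> p`_j \in cut_points f p.
  by move=> Fj; rewrite mem_cat mem_filter [f _ <= 0]Fj mem_nth ?ltn_ord.
(* If no weight lies strictly below the hyperplane, none lies strictly above it, and the given
   combination already uses only vertices with [f <= 0]. *)
have [b0|bn] := eqVneq b 0.
  have a_pos0 i : 0 < F i -> a i = 0.
    move=> Fi; apply/eqP; have := bge; rewrite b0 => s0.
    have : \sum_(i | 0 < F i) a i * F i == 0.
      by rewrite eq_le s0 sumr_ge0 // => k Fk; exact: pos_ge0.
    rewrite psumr_eq0 // => /allP/(_ i (mem_index_enum _)).
    by rewrite Fi mulf_eq0 (gt_eqF Fi) orbF.
  rewrite xE; apply: convex_sum => //; first exact: hull_convex.
  move=> i _ ai; apply/hull_mem/mem_neg; rewrite leNgt; apply: contraNN ai => Fi.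
  by rewrite a_pos0.
have b_ge0 : 0 <= b by apply: le_trans bge; apply: sumr_ge0.
have bp : 0 < b by rewrite lt_def bn.
(* The combination is indexed by vertices below and by pairs of a vertex above and one below. The
   factor [F i - F j] in [w] compensates the normalization in [cut_points]. *)
pose r : seq ('I_(size p) + 'I_(size p) * 'I_(size p)) :=
  map inl (index_enum _) ++ map inr [seq (i, j) | i <- index_enum _, j <- index_enum _].
pose Q (k : 'I_(size p) + 'I_(size p) * 'I_(size p)) := match k with
  | inl j => F j <= 0 | inr ij => (0 < F ij.1) && (F ij.2 <= 0) end.
pose w (k : 'I_(size p) + 'I_(size p) * 'I_(size p)) := match k with
  | inl j => a j * (1 - (\sum_(i | 0 < F i) a i * F i) / b)
  | inr (i, j) => (a i * a j / b) * (F i - F j) end.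
pose y (k : 'I_(size p) + 'I_(size p) * 'I_(size p)) := match k with
  | inl j => p`_j
  | inr (i, j) => (F i - F j)^-1 *: (F i *: p`_j - F j *: p`_i) end.
(* Used with [g] constant equal to 1 for the total weight, and with [g] the vertices for the point
   itself. *)
have wE (V : lmodType R) (g : 'I_(size p) -> V) (G : _ -> V) :
    (forall j, G (inl j) = g j) ->
    (forall i j, 0 < F i -> F j <= 0 -> (F i - F j) *: G (inr (i, j)) = F i *: g j - F j *: g i) ->
    \sum_(k <- r | Q k) w k *: G k = \sum_i a i *: g i.
  move=> Gl Gr; rewrite -(balance_sum g bn erefl) /r big_cat !big_map /=.
  congr (_ + _); first by apply: eq_bigr => j _; rewrite Gl.
  rewrite big_mkcond big_allpairs /= [RHS]big_mkcond; apply: eq_bigr => i _ /=.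
  have [Fi|Fi] := ltP 0 (F i); last by rewrite big1.
  rewrite /= -big_mkcond; apply: eq_bigr => j Fj.
  by rewrite -Gr // !scalerA.
have w1 : \sum_(k <- r | Q k) (w k : R^o) = 1.
  transitivity (\sum_(k <- r | Q k) w k *: (1 : R^o)).
    by apply: eq_bigr => k _; rewrite scale_reg mulr1.
  rewrite (@wE R^o (fun _ => 1) (fun _ => 1)) //; last first.
    by move=> i j _ _; rewrite -scalerBl.
  transitivity (\sum_i (a i : R^o)); last exact: a1.
  by apply: eq_bigr => k _; rewrite scale_reg mulr1.
have xE' : x = \sum_(k <- r | Q k) w k *: y k.
  rewrite xE; apply/esym/wE => // i j Fi Fj.
  by rewrite /= scalerA mulfV ?scale1r // gt_eqF // subr_gt0; exact: le_lt_trans Fi.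
rewrite xE'; apply: convex_sum => //; first exact: hull_convex.
  move=> [j Fj|[i j] /andP[/= Fi Fj]] /=.
    by rewrite mulr_ge0 // subr_ge0 ler_pdivrMr // mul1r.
  have d : 0 < F i - F j by rewrite subr_gt0; exact: le_lt_trans Fi.
  by rewrite mulr_ge0 ?(ltW d) // divr_ge0 // mulr_ge0.
move=> [j Fj|[i j] /andP[/= Fi Fj]] _ /=; first exact/hull_mem/mem_neg.
apply: hull_mem; rewrite mem_cat; apply/orP; right; apply/allpairsP.
by exists (p`_i, p`_j); rewrite /= !mem_filter [0 < f _]Fi [f _ <= 0]Fj !mem_nth ?ltn_ord.
Qed.

Lemma affineB (W W' : lmodType R) (f g : W -> W') :
  affine_map f -> affine_map g -> affine_map (fun x => f x - g x).
Proof.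
by move=> af ag x y t; rewrite af ag !scalerBr opprD addrACA.
Qed.

Lemma affineN (W W' : lmodType R) (f : W -> W') :
  affine_map f -> affine_map (fun x => - f x).
Proof. by move=> af x y t; rewrite af !scalerN opprD. Qed.

Lemma affine_cst (W W' : lmodType R) (c : W') : affine_map (fun _ : W => c).
Proof. by move=> x y t; rewrite -scalerDl subrKC scale1r. Qed.

Lemma affineD (W W' : lmodType R) (f g : W -> W') :
  affine_map f -> affine_map g -> affine_map (fun x => f x + g x).
Proof. by move=> af ag x y t; rewrite af ag !scalerDr addrACA. Qed.

Lemma affine_pair (W W1 W2 : lmodType R) (f : W -> W1) (g : W -> W2) :
  affine_map f -> affine_map g -> affine_map (fun x => (f x, g x)).
Proof. by move=> af ag x y t; rewrite af ag. Qed.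

Lemma affine_fst (W W' : lmodType R) : affine_map (@fst W W').
Proof. by []. Qed.

Lemma affine_snd (W W' : lmodType R) : affine_map (@snd W W').
Proof. by []. Qed.

Lemma hull_cut_all (W : lmodType R) (I : Type) (f : I -> W -> R^o) (r : seq I)
    (p : seq W) : (forall i, affine_map (f i)) ->
  exists q, hull p `&` [set x | all (fun i => f i x <= 0) r] = hull q.
Proof.
move=> af; elim: r => [|i r [q qE]] /=; first by exists p; apply/seteqP; split=> [x []|].
exists (cut_points (f i) q); rewrite -hull_cut // -qE -setIA; congr (_ `&` _).
by apply/seteqP; split=> x /=; [move=> /andP[]|move=> [? ?]; apply/andP].
Qed.

Lemma hull_cut_eq (W : lmodType R) (V : vectType R) (g : W -> V) (p : seq W) :
  affine_map g -> exists q, hull p `&` [set x | g x = 0] = hull q.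
Proof.
move=> ag; pose c i x : R^o := coord (vbasis {:V}) i (g x).
pose f (i : bool * 'I_(\dim {:V})) x : R^o := if i.1 then c i.2 x else - c i.2 x.
have acoord i : affine_map (c i) by move=> x y t; rewrite /c ag linearP linearZ.
have af i : affine_map (f i) by case: i => [[] i]; [exact: acoord|exact/affineN/acoord].
have [q qE] := hull_cut_all (index_enum _) p af.
exists q; rewrite -qE; congr (_ `&` _); apply/seteqP; split=> x /=.
  by move=> gx; apply/allP => -[[] i] _; rewrite /f /= /c gx linear0 ?oppr0.
move=> /allP h; rewrite (coord_vbasis (memvf (g x))) big1 // => i _.
rewrite [coord _ _ _](_ : _ = 0) ?scale0r //.
apply/eqP; rewrite eq_le (h (true, i) (mem_index_enum _)).
by have := h (false, i) (mem_index_enum _); rewrite /f /= oppr_le0.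
Qed.

Definition polyhedral (W : lmodType R) (A : set W) :=
  exists ps : seq (seq W), A = [set x | exists2 p, p \in ps & hull p x].

Lemma polyhedral_hull (W : lmodType R) (p : seq W) : polyhedral (hull p).
Proof.
exists [:: p]; apply/seteqP; split=> x /=; first by exists p; rewrite ?inE.
by case=> q; rewrite inE => /eqP ->.
Qed.

Lemma polyhedral_bigU (W : lmodType R) (I : eqType) (r : seq I) (A : I -> set W) :
  (forall i, i \in r -> polyhedral (A i)) ->
  polyhedral [set x | exists2 i, i \in r & A i x].
Proof.
elim: r => [|i r IHr] h.
  by exists [::]; apply/seteqP; split => x [].
have [|ps psE] := IHr; first by move=> j jr; apply: h; rewrite inE jr orbT.
have [|qs qsE] := h i; first by rewrite inE eqxx.
exists (qs ++ ps); apply/seteqP; split=> x /=.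
  move=> [j]; rewrite inE => /orP[/eqP ->|jr Aj].
    by rewrite qsE => -[p pq px]; exists p; rewrite ?mem_cat ?pq.
  have : exists2 i, i \in r & A i x by exists j.
  rewrite -[exists2 i, _ & _]/([set x | exists2 i, i \in r & A i x] x) psE.
  by move=> -[p pq px]; exists p; rewrite ?mem_cat ?pq ?orbT.
move=> [p]; rewrite mem_cat => /orP[pq px|pp px].
  by exists i; rewrite ?inE ?eqxx // qsE; exists p.
have : [set x | exists2 i, i \in r & A i x] x by rewrite psE; exists p.
by move=> [j jr Aj]; exists j; rewrite ?inE ?jr ?orbT.
Qed.

(* Contains intersections and compositions of relations as special cases. *)
Lemma polyhedral_fiber (W W' W'' : lmodType R) (V : vectType R)
    (A : set W) (B : set W') (f : W -> V) (g : W' -> V) (h : W * W' -> W'') :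
  polyhedral A -> polyhedral B -> affine_map f -> affine_map g -> affine_map h ->
  polyhedral (h @` [set z | [/\ A z.1, B z.2 & f z.1 = g z.2]]).
Proof.
move=> [ps ->] [qs ->] af ag ah.
rewrite (_ : _ @` _ = [set w | exists2 pq, pq \in [seq (p, q) | p <- ps, q <- qs] &
   (h @` [set z | [/\ hull pq.1 z.1, hull pq.2 z.2 & f z.1 = g z.2]]) w]).
  apply: polyhedral_bigU => -[p q] _ /=.
  have afg : affine_map (fun z : W * W' => f z.1 - g z.2).
    by apply: affineB => x y t /=; [rewrite af|rewrite ag].
  have [l lE] := hull_cut_eq [seq (x, y) | x <- p, y <- q] afg.
  have sE : [set z | [/\ hull p z.1, hull q z.2 & f z.1 = g z.2]] = hull l.
    rewrite -lE hull_prod; apply/seteqP; split=> z /=.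
      by move=> [? ? /eqP]; rewrite -subr_eq0 => /eqP.
    by move=> [[? ?] /eqP]; rewrite subr_eq0 => /eqP.
  by have := polyhedral_hull (map h l); rewrite -hull_image // -sE.
apply/seteqP; split=> w /=.
  move=> [z [[p pp pz] [q qq qz] fg] <-]; exists (p, q); last by exists z.
  by apply/allpairsP; exists (p, q).
move=> [pq /allpairsP[[p q] [/= pp qq ->]]] [z [/= pz qz fg] <-].
by exists z => //; split=> //; [exists p|exists q].
Qed.

Lemma polyhedral_image (W W' : lmodType R) (A : set W) (h : W -> W') :
  polyhedral A -> affine_map h -> polyhedral (h @` A).
Proof.
move=> [ps ->] ah.
rewrite (_ : _ @` _ = [set w | exists2 p, p \in ps & (h @` hull p) w]).
  by apply: polyhedral_bigU => p _; rewrite hull_image //; exact: polyhedral_hull.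
apply/seteqP; split=> w /=.
  by move=> [z [p pp pz] <-]; exists p => //; exists z.
by move=> [p pp [z pz <-]]; exists z => //; exists p.
Qed.

Lemma polyhedralI (W : vectType R) (A B : set W) :
  polyhedral A -> polyhedral B -> polyhedral (A `&` B).
Proof.
move=> pA pB.
have := @polyhedral_fiber _ _ _ _ _ _ idfun idfun fst pA pB.
rewrite (_ : _ @` _ = A `&` B); first by apply.
apply/seteqP; split=> x /=; first by move=> [[y z] /= [Ay Bz yz] <-]; rewrite {2}yz.
by move=> [Ax Bx]; exists (x, x).
Qed.

Lemma polyhedral_cut_eq (W : lmodType R) (V : vectType R) (A : set W) (g : W -> V) :
  polyhedral A -> affine_map g -> polyhedral (A `&` [set x | g x = 0]).
Proof.
move=> [ps ->] ag.
rewrite (_ : _ `&` _ =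
    [set x | exists2 p, p \in ps & (hull p `&` [set x | g x = 0]) x]).
  apply: polyhedral_bigU => p _; have [q ->] := hull_cut_eq p ag.
  exact: polyhedral_hull.
apply/seteqP; split=> x /=; first by move=> [[p pp px] gx]; exists p.
by move=> [p pp [px gx]]; split=> //; exists p.
Qed.

Lemma polyhedral_bigI (W : vectType R) (I : eqType) (r : seq I) (A : set W)
    (B : I -> set W) : polyhedral A -> (forall i, polyhedral (B i)) ->
  polyhedral (A `&` [set x | {in r, forall i, B i x}]).
Proof.
move=> pA pB; elim: r => [|i r IHr].
  by rewrite [X in _ `&` X](_ : _ = setT) ?setIT //; apply/seteqP; split.
have := polyhedralI IHr (pB i); congr polyhedral.
apply/seteqP; split=> x /=.
  by move=> [[Ax h] Bx]; split=> // j; rewrite inE => /orP[/eqP ->|/h].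
move=> [Ax h]; split; last by apply: h; rewrite inE eqxx.
by split=> // j jr; apply: h; rewrite inE jr orbT.
Qed.

Lemma hull_interval (l : seq R^o) :
  exists ab : R * R, forall s, hull l s <-> ab.1 <= s <= ab.2.
Proof.
case: l => [|x l].
  exists (1, 0) => s; rewrite hull_nil; split=> // /andP[h1 h2] /=.
  by have := le_trans h1 h2; rewrite ler10.
have [a [b [al bl abl]]] : exists a b, [/\ a \in x :: l, b \in x :: l &
    {in x :: l, forall y, a <= y <= b}].
  elim: l => [|z l [a [b [al bl abl]]]].
    by exists x, x; split; rewrite ?mem_head // => y; rewrite inE => /eqP ->; rewrite lexx.
  exists (Order.min a z), (Order.max b z); split.
  - rewrite minEle; case: ifP => _; rewrite !inE ?eqxx ?orbT //.
    by move: al; rewrite inE => /orP[] ->; rewrite ?orbT.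
  - rewrite maxEle; case: ifP => _; rewrite !inE ?eqxx ?orbT //.
    by move: bl; rewrite inE => /orP[] ->; rewrite ?orbT.
  - move=> y; rewrite !inE orbCA => /orP[/eqP ->|yl].
      by rewrite ge_min le_max lexx !orbT.
    have /andP[ay yb] : a <= y <= b by apply: abl; rewrite inE.
    by rewrite ge_min le_max ay yb.
exists (a, b) => s; split=> [|/andP[/= as_ sb]].
  have cI : convex_set [set s : R^o | a <= s <= b].
    move=> y z t /= /andP[? ?] /andP[? ?] /andP[? ?]; rewrite !scale_reg.
    by apply/andP; split; nra.
  exact: (hull_min cI).
have [ab|ab] := eqVneq a b.
  have -> : s = a by apply/eqP; rewrite eq_le as_ ab sb.
  exact: hull_mem.
have abp : 0 < b - a by rewrite subr_gt0 lt_def eq_sym ab (le_trans as_ sb).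
have := @hull_convex _ (x :: l) a b ((b - s) / (b - a)) (hull_mem al) (hull_mem bl).
rewrite !scale_reg (_ : _ * a + _ = s); last by field; rewrite gt_eqF.
by apply; rewrite divr_ge0 ?subr_ge0 // ?(ltW abp) ?ler_pdivrMr //=
  ?mul1r ?lerD2l ?lerN2 // -subr_ge0 ltW.
Qed.

(** * Eliminating a universal quantifier over an interval *)

Section Chain.
Variables (W : vectType R) (Qs : seq (seq (W * R^o))) (L : R).

Lemma hull_slice (q : seq (W * R^o)) (x : W) :
  exists ab : R * R, forall s, hull q (x, s) <-> ab.1 <= s <= ab.2.
Proof.
have ag : affine_map (fun z : W * R^o => z.1 - x).
  by apply: affineB; [exact: affine_fst|exact: affine_cst].
have [l lE] := hull_cut_eq q ag.
have [ab abE] := hull_interval (map snd l); exists ab => s; rewrite -abE.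
rewrite -(hull_image _ (@affine_snd W R^o)) -lE; split.
  by move=> qxs; exists (x, s) => //; split=> //=; rewrite subrr.
by move=> [[y t] [qy /= /eqP]]; rewrite subr_eq0 => /eqP yx <-; rewrite -yx.
Qed.

(* reach n (x, s): one can go from 0 to s in n steps, each inside the slice over x
   of one polytope.  The slices are closed intervals, so that they cover [0, L] if
   and only if L can be reached. *)
Fixpoint reach n : set (W * R^o) :=
  if n is n'.+1 then
    [set z | exists2 q, q \in Qs & exists s,
       [/\ reach n' (z.1, s), hull q (z.1, s) & hull q z]]
  else [set z | (exists2 q, q \in Qs & hull q z) /\ z.2 = 0].

Lemma polyhedral_reach n : polyhedral (reach n).
Proof.
elim: n => [|n IHn].
  have pQ : polyhedral [set z : W * R^o | exists2 q, q \in Qs & hull q z].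
    by exists Qs.
  exact: polyhedral_cut_eq pQ (@affine_snd _ _).
apply: polyhedral_bigU => q _.
have pq := polyhedral_hull q.
have := polyhedral_fiber (polyhedralI IHn pq) pq (@affine_fst _ _)
  (@affine_fst _ _) (@affine_snd _ _).
rewrite (_ : _ @` _ =
  [set z | exists s, [/\ reach n (z.1, s), hull q (z.1, s) & hull q z]]) //.
apply/seteqP; split=> -[x s] /=.
  by move=> [[[x1 s1] [x2 s2]] /= [[r1 q1] q2 x12] [<- <-]]; exists s1; rewrite -x12 in q2 *.
by move=> [s' [r1 q1 q2]]; exists ((x, s'), (x, s)).
Qed.

Lemma reachS n z : reach n z -> reach n.+1 z.
Proof.
case: z => x s; case: n => [|n] /=.
  by move=> [[q qQ qz] /= s0]; exists q => //; exists s; split=> //; split=> //; exists q.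
by move=> [q qQ [s' [r1 q1 q2]]]; exists q => //; exists s; split=> //; exists q => //; exists s'.
Qed.

Lemma reach_le n m z : (n <= m)%N -> reach n z -> reach m z.
Proof.
move=> /subnK <-; elim: (m - n)%N => [|k IHk] //; rewrite addSn.
by move=> /IHk/reachS.
Qed.

Lemma reach_cover n x s t : reach n (x, s) -> 0 <= t <= s ->
  exists2 q, q \in Qs & hull q (x, t).
Proof.
elim: n s t => [|n IHn] s t /=.
  by move=> [h s0]; rewrite s0 -eq_le => /eqP <-; rewrite -s0.
move=> [q qQ [s' [r1 q1 q2]]] /andP[t0 ts].
have [ts'|s't] := leP t s'; first by apply: IHn r1 _; rewrite t0.
exists q => //; have [ab abE] := hull_slice q x; apply/abE.
move/abE: q1 => /andP[h1 _]; move/abE: q2 => /andP[_ h2].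
by rewrite (le_trans h1 (ltW s't)) (le_trans ts).
Qed.

Lemma cover_reach x : 0 <= L ->
  (forall s, 0 <= s <= L -> exists2 q, q \in Qs & hull q (x, s)) ->
  reach (size Qs).+1 (x, L).
Proof.
move=> L0 cov; have [ab abE] := choice (fun q => hull_slice q x).
have next a : 0 <= a -> a < L ->
    exists2 q, q \in Qs & (ab q).1 <= a < (ab q).2.
  (* [s0] is the first left end beyond [a], or [L]. A slice containing the midpoint of [a] and [s0]
     starts before [s0], hence at [a] or earlier, and ends beyond [a]. *)
  move=> a0 aL; pose s0 := \big[Order.min/L]_(q <- Qs | a < (ab q).1) (ab q).1.
  have s0a : a < s0 by apply: lt_bigmin.
  have s0L : s0 <= L by exact: bigmin_le_id.
  have [|q qQ /abE/andP[q1 q2]] := cov ((a + s0) / 2); first by apply/andP; split; lra.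
  exists q => //; have q1a : (ab q).1 <= a; last by apply/andP; split; lra.
  rewrite leNgt; apply/negP => aq.
  have : s0 <= (ab q).1 by apply: bigmin_inf_seq qQ aq _.
  lra.
(* The number of polytopes whose slice ends beyond the point reached decreases at each step, which
   bounds the number of steps. *)
have step m n a : reach n (x, a) -> 0 <= a <= L ->
    (count (fun q => a < (ab q).2)%R Qs <= m)%N -> reach (n + m).+1 (x, L).
  elim: m n a => [|m IHm] n a ra /andP[a0 aL] cm; have [aL'|aLn] := eqVneq a L;
    rewrite ?aL' in ra; try by apply: reach_le ra; rewrite leqW // leq_addr.
    have [|q qQ /andP[_ qa]] := next a a0; first by rewrite lt_def eq_sym aLn.
    move: cm; rewrite leqNgt -has_count => /hasPn/(_ _ qQ).
    by rewrite qa.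
  have [|q qQ /andP[q1 q2]] := next a a0; first by rewrite lt_def eq_sym aLn.
  have qa : hull q (x, a) by apply/abE; rewrite q1 ltW.
  have [qL|Lq] := leP L (ab q).2.
    apply: (@reach_le n.+1); first by rewrite ltnS leq_addr.
    by exists q => //; exists a; split=> //; apply/abE; rewrite qL (le_trans q1).
  rewrite addnS -addSn; apply: (IHm _ (ab q).2).
  - exists q => //; exists a; split=> //; apply/abE.
    by rewrite lexx (le_trans q1 (ltW q2)).
  - by rewrite (ltW Lq) (le_trans a0 (ltW q2)).
  - rewrite -ltnS; apply: leq_trans cm.
    elim: Qs qQ {cov next IHm} => //= r Rs IH; rewrite inE => /orP[/eqP <-|qR].
      rewrite q2 ltxx add0n add1n ltnS; apply: sub_count => r' /=.
      exact: lt_trans.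
    rewrite -addnS leq_add ?IH //.
    by case: ltP => // qr; rewrite (lt_trans q2 qr).
have [|q qQ q0] := cov 0; first by rewrite lexx.
have := step (size Qs) 0%N 0; rewrite add0n; apply; rewrite ?lexx //.
  by split=> //; exists q.
exact: count_size.
Qed.

(** [reach] replaces the quantifier over all [s] by existential quantifiers of bounded number, that
    is, by projections of polytopes. *)
Lemma polyhedral_forall : 0 <= L ->
  polyhedral [set x | forall s, 0 <= s <= L ->
                        exists2 q, q \in Qs & hull q (x, s)].
Proof.
move=> L0.
have aL : affine_map (fun z : W * R^o => z.2 - L).
  by apply: affineB; [exact: affine_snd|exact: affine_cst].
have := polyhedral_image (polyhedral_cut_eq (polyhedral_reach (size Qs).+1) aL)
  (@affine_fst _ _).
congr polyhedral; apply/seteqP; split=> x.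
  move=> [[y t] [ry /= /eqP]]; rewrite subr_eq0 => /eqP tL <- s s0.
  by apply: reach_cover ry _; rewrite tL.
move=> cov; exists (x, L) => //; split; first exact: cover_reach.
by rewrite /= subrr.
Qed.

End Chain.

End Convexity.

(** * Abel's theorem *)

Section Abel.
Variables (R : realType) (Gam : metric_graph R).
Local Notation V := (vertex Gam).
Local Notation E := (edge Gam).
Local Notation point := (point_of Gam).
Implicit Types (e : E) (v : V) (x y : point).

Lemma edge_pt0 e : edge_pt e 0 = inl (src e) :> point.
Proof. by rewrite /edge_pt insubF ?lexx //= ltxx. Qed.

Lemma edge_pt_len e : edge_pt e (len e) = inl (tgt e) :> point.
Proof.
by rewrite /edge_pt insubF /= ?ltxx ?andbF // leNgt len_gt0.
Qed.

Lemma edge_ptE (p : {x : E * R | 0 < x.2 < len x.1}) :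
  edge_pt (val p).1 (val p).2 = inr p :> point.
Proof.
rewrite /edge_pt; case: insubP => [q _ qp|]; last by rewrite -surjective_pairing (valP p).
by congr inr; apply: val_inj; rewrite qp -surjective_pairing.
Qed.

Lemma edge_pt_inr e t (h : 0 < t < len e) :
  edge_pt e t = inr (exist _ (e, t) h) :> point.
Proof. exact: (edge_ptE (exist _ (e, t) h)). Qed.

Lemma edge_pt_eq_inr e t (p : {x : E * R | 0 < x.2 < len x.1}) :
  (edge_pt e t == inr p :> point) = (val p == (e, t)).
Proof.
apply/eqP/eqP => [|pe]; last by rewrite -edge_ptE pe.
by rewrite /edge_pt; case: insubP => //= q _ <- [->].
Qed.

Definition kink : Type := (E * R * int)%type.
HB.instance Definition _ := Equality.on kink.
Implicit Types ks : seq kink.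

Definition valid_kinks ks := all (fun k => 0 <= k.1.2 <= len k.1.1) ks.

(** A kink [(e, b, m)] also stands for [m] times the segment of [e] from its source to [b]. The
    boundary of this chain is the divisor of the function that the kink adds. *)
Definition kinks_boundary ks : divisor Gam :=
  \sum_(k <- ks) (<< edge_pt k.1.1 k.1.2 >> - << inl (src k.1.1) >>) *~ k.2.

Definition kink_sum e (t : R) ks : R :=
  \sum_(k <- ks | k.1.1 == e) k.2%:~R * Order.min t k.1.2.

(* A kink (e, b, m) adds m min(t, b) to the function t |-> f (edge_pt e t).  The
   divisor of t |-> min(t, b) is edge_pt e b - src e, also for b = 0 and for
   b = len e, so that vertices need no special treatment. *)
Definition kinked (f : point -> R) ks := forall e (t : R), 0 <= t <= len e ->
  on_edge f e t = f (inl (src e)) + kink_sum e t ks.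

Lemma lim_near_cst_right (g : R -> R) (c : R) :
  (\forall h \near 0^'+, g h = c) -> lim (g h @[h --> 0^'+]) = c.
Proof. move=> gc; apply: lim_near_cst => //; exact: Rhausdorff. Qed.

(** The function [min(t, b)] has left slope 1 at [t] when [t <= b], but right slope 1 only when
    [t < b]: the difference is the unit mass at [b]. *)
Lemma slope_leftE f ks e (t : R) : kinked f ks -> 0 < t <= len e ->
  slope_left f e t = \sum_(k <- ks | k.1.1 == e) k.2%:~R * (t <= k.1.2)%R%:R.
Proof.
move=> fk /andP[t0 tl]; apply: lim_near_cst_right.
have H : \forall h \near (0 : R)^'+, kink_sum e (t - h) ks = kink_sum e t ks -
    h * \sum_(k <- ks | k.1.1 == e) k.2%:~R * (t <= k.1.2)%R%:R.
  elim: ks {fk} => [|k ks IH].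
    by near=> h; rewrite /kink_sum !big_nil; ring.
  have Hk : \forall h \near (0 : R)^'+,
      Order.min (t - h) k.1.2 = Order.min t k.1.2 - h * (t <= k.1.2)%R%:R.
    have [tk|kt] := leP t k.1.2; near=> h.
      by rewrite min_l; [rewrite /=; ring|rewrite lerBlDr ler_wpDr // ltW].
    rewrite min_r; first by rewrite /=; ring.
    rewrite lerBrDr -lerBrDl ltW //; near: h; apply: nbhs_right_lt.
    by rewrite subr_gt0.
  near=> h; rewrite /kink_sum !big_cons; case: ifP => ke; last first.
    by rewrite -!/(kink_sum _ _ _); near: h.
  rewrite -!/(kink_sum _ _ _) (near IH h) // (near Hk h) //; ring.
near=> h.
have h0 : 0 < h by [].
have ht : h <= t by rewrite ltW //; near: h; apply: nbhs_right_lt.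
rewrite !fk ?t0 ?(ltW t0) //; last first.
  by rewrite subr_ge0 ht lerBlDr ler_wpDr // ltW.
by rewrite (near H h) //; field; rewrite gt_eqF.
Unshelve. all: by end_near. Qed.

Lemma slope_rightE f ks e (t : R) : kinked f ks -> 0 <= t < len e ->
  slope_right f e t = \sum_(k <- ks | k.1.1 == e) k.2%:~R * (t < k.1.2)%R%:R.
Proof.
move=> fk /andP[t0 tl]; apply: lim_near_cst_right.
have H : \forall h \near (0 : R)^'+, kink_sum e (t + h) ks = kink_sum e t ks +
    h * \sum_(k <- ks | k.1.1 == e) k.2%:~R * (t < k.1.2)%R%:R.
  elim: ks {fk} => [|k ks IH].
    by near=> h; rewrite /kink_sum !big_nil; ring.
  have Hk : \forall h \near (0 : R)^'+,
      Order.min (t + h) k.1.2 = Order.min t k.1.2 + h * (t < k.1.2)%R%:R.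
    have [tk|kt] := ltP t k.1.2; near=> h.
      rewrite min_l; first by rewrite /=; ring.
      rewrite -lerBrDl ltW //; near: h; apply: nbhs_right_lt.
      by rewrite subr_gt0.
    by rewrite min_r; [rewrite /=; ring|rewrite ler_wpDr // ltW].
  near=> h; rewrite /kink_sum !big_cons; case: ifP => ke; last first.
    by rewrite -!/(kink_sum _ _ _); near: h.
  rewrite -!/(kink_sum _ _ _) (near IH h) // (near Hk h) //; ring.
near=> h.
have h0 : 0 < h by [].
have ht : h <= len e - t by rewrite ltW //; near: h; apply: nbhs_right_lt; rewrite subr_gt0.
rewrite !fk ?t0 ?(ltW tl) //; last first.
  by rewrite addr_ge0 ?(ltW h0) // addrC -lerBrDr.
by rewrite (near H h) //; field; rewrite gt_eqF.
Unshelve. all: by end_near. Qed.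

Lemma coeff_kinks_boundary ks x : (coeff x (kinks_boundary ks))%:~R =
  \sum_(k <- ks) k.2%:~R *
    ((edge_pt k.1.1 k.1.2 == x)%:R - (inl (src k.1.1) == x)%:R) :> R.
Proof.
rewrite /kinks_boundary raddf_sum rmorph_sum; apply: eq_bigr => k _ /=.
rewrite raddfMz raddfB /= !(coeffU 1) !mul1r mulrzz intrM intrB mulrC.
by do 2 case: eqP.
Qed.

Lemma sum_kinks_on_edges (P : pred E) (F : E -> kink -> R) ks :
  \sum_(e | P e) \sum_(k <- ks | k.1.1 == e) F e k =
  \sum_(k <- ks | P k.1.1) F k.1.1 k.
Proof.
rewrite (partition_big (fun k : kink => k.1.1) P) //=; apply: eq_bigr => e Pe.
apply: eq_big => [k|k /eqP ->] //.
by case: eqP => [->|]; rewrite ?Pe ?andbF.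
Qed.

Lemma ord_at_kinked f ks x : valid_kinks ks -> kinked f ks ->
  ord_at f x = (coeff x (kinks_boundary ks))%:~R.
Proof.
move=> /allP vk fk; rewrite coeff_kinks_boundary; case: x => [v|p].
  rewrite /ord_at.
  under eq_bigr => e _ do rewrite (slope_leftE fk) ?lexx ?len_gt0 //.
  under [X in _ - X]eq_bigr => e _ do rewrite (slope_rightE fk) ?lexx ?len_gt0 //.
  rewrite !sum_kinks_on_edges.
  rewrite [X in X - _]big_mkcond [X in _ - X]big_mkcond -sumrB.
  apply: eq_big_seq => -[[e b] m] /vk /= /andP[b0 bl].
  have [b_eq0|bn0] := eqVneq b 0.
    rewrite b_eq0 edge_pt0 ltxx leNgt len_gt0 subrr !mulr0 /=.
    by rewrite !if_same subrr.
  have bp : 0 < b by rewrite lt_def bn0.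
  have -> : (inl (src e) == inl v :> point) = (src e == v) by [].
  rewrite bp; have [b_eql|bnl] := eqVneq b (len e).
    rewrite b_eql edge_pt_len lexx.
    have -> : (inl (tgt e) == inl v :> point) = (tgt e == v) by [].
    by do 2 case: eqP => _ /=; ring.
  have bltl : b < len e by rewrite lt_def eq_sym bnl.
  rewrite leNgt bltl (edge_pt_inr (e := e) (t := b)) ?bp // => h.
  have -> : (inr (exist _ (e, b) h) == inl v :> point) = false by [].
  by case: eqP => _; case: eqP => _ /=; ring.
have /andP[t0 tl] := valP p.
rewrite /ord_at (slope_leftE fk) ?(slope_rightE fk) ?t0 ?tl ?(ltW tl) ?(ltW t0) //.
rewrite -sumrB big_mkcond; apply: eq_big_seq => k _.
rewrite edge_pt_eq_inr [inl _ == _](_ : _ = false) // subr0.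
case: p t0 tl => -[e t] /= _ t0 tl; case: k => [[e' b] m] /=.
rewrite -mulrBr [(e, t) == _]xpair_eqE eq_sym; case: eqP => _ /=; last by rewrite mulr0.
have [tb|bt|tb] := ltgtP t b; rewrite /=; ring.
Qed.

Lemma kink_sum0 e ks : valid_kinks ks -> kink_sum e 0 ks = 0.
Proof.
move=> /allP vk; rewrite /kink_sum big_mkcond big1_seq // => k /= /vk /andP[k0 _].
by rewrite min_l // mulr0 if_same.
Qed.

Lemma kink_sum_len e ks : valid_kinks ks ->
  kink_sum e (len e) ks = \sum_(k <- ks | k.1.1 == e) k.2%:~R * k.1.2.
Proof.
move=> /allP vk; rewrite /kink_sum big_mkcond [RHS]big_mkcond.
apply: eq_big_seq => k /vk /andP[_ kl]; case: eqP => // ke.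
by rewrite min_r // -ke.
Qed.

Definition kinked_fun (F : V -> R) ks (x : point) : R :=
  match x with
  | inl v => F v
  | inr p => F (src (val p).1) + kink_sum (val p).1 (val p).2 ks
  end.

Lemma kinked_kinked_fun F ks : valid_kinks ks ->
  (forall e, F (tgt e) = F (src e) + \sum_(k <- ks | k.1.1 == e) k.2%:~R * k.1.2) ->
  kinked (kinked_fun F ks) ks.
Proof.
move=> vk FE e t /andP[t0 tl]; rewrite /on_edge.
have [->|tn0] := eqVneq t 0; first by rewrite edge_pt0 kink_sum0 // addr0.
have [->|tnl] := eqVneq t (len e).
  by rewrite edge_pt_len kink_sum_len //= FE.
have h : 0 < t < len e by rewrite !lt_def tn0 t0 eq_sym tnl.
by rewrite (edge_pt_inr h).
Qed.

Lemma kinked_piecewise_linear f ks : valid_kinks ks -> kinked f ks ->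
  piecewise_linear f.
Proof.
move=> /allP vk fk e.
pose s := rcons (sort <=%R [seq k.1.2 | k <- ks & k.1.1 == e]) (len e).
have s_ge0 : all (fun b => 0 <= b <= len e) s.
  rewrite all_rcons lexx ltW ?len_gt0 //= all_sort all_map.
  by apply/allP => k; rewrite mem_filter => /andP[/eqP <- /vk].
have s_sorted : sorted <=%R s.
  rewrite (sorted_pairwise le_trans) pairwise_rcons -(sorted_pairwise le_trans)
    sort_sorted ?andbT; last exact: le_total.
  - apply/allP => b; have := allP s_ge0 b; rewrite mem_rcons inE => h bs.
    by have := h; rewrite bs orbT => /(_ isT)/andP[].
exists s; split; last 1 first.
(* On the [i]-th piece, a kink located at its right end or further contributes its slope, and an
   earlier one contributes a constant. *)
- move=> i ilt; exists (\sum_(k <- ks | k.1.1 == e) k.2 * (s`_i <= k.1.2)%R%:R).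
  exists (f (inl (src e)) + \sum_(k <- ks | k.1.1 == e)
            k.2%:~R * k.1.2 * (~~ (s`_i <= k.1.2))%R%:R) => t /andP[ti ts].
  have nth_s j : (j < size s)%N -> 0 <= s`_j <= len e.
    by move=> js; apply: (allP s_ge0); rewrite mem_nth.
  have t0 : 0 <= t.
    apply: le_trans ti; case: i ilt {ts} => //= i ilt.
    by case/andP: (nth_s i (ltnW ilt)).
  have tl : t <= len e by apply: le_trans ts _; case/andP: (nth_s i ilt).
  rewrite fk ?t0 // addrCA; congr (_ + _).
  rewrite /kink_sum rmorph_sum mulr_suml -big_split /=.
  rewrite big_mkcond [RHS]big_mkcond; apply: eq_big_seq => k kks /=.
  case: eqP => // ke; rewrite intrM.
  have [sk|ks_] := leP s`_i k.1.2; first by rewrite min_l ?(le_trans ts) //=; ring.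
  rewrite min_r /=; first by ring.
  apply: le_trans ti.
  have ks' : k.1.2 \in s.
    rewrite mem_rcons inE mem_sort; apply/orP; right; apply: map_f.
    by rewrite mem_filter ke eqxx.
  have [j jlt jE] : exists2 j, (j < size s)%N & s`_j = k.1.2.
    by exists (index k.1.2 s); rewrite ?index_mem ?nth_index.
  have ji : (j < i)%N.
    rewrite ltnNge; apply/negP => ij.
    have := sorted_leq_nth le_trans le_refl 0 s_sorted _ _ ilt jlt ij.
    by rewrite jE leNgt ks_.
  case: i ji ilt {ts ks_} => //= i ji ilt; rewrite -jE.
  by apply: (sorted_leq_nth le_trans le_refl 0 s_sorted) => //; exact: ltnW.
- have := s_sorted; rewrite path_min_sorted //.
  by apply: sub_all s_ge0 => b /andP[].
- by rewrite /s last_rcons.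
Qed.

(** A cochain vanishing on all cycles is a coboundary. The columns of the cokernel of the incidence
    matrix [A] are harmonic forms, so [beta] is killed by the cokernel and is a combination of the
    rows of [A]; the coefficients form the potential [F]. *)
Lemma orth_cycle_space (b : E -> R) :
  (forall om : {ffun E -> R^o}, om \in harmonic Gam -> \sum_e om e * b e = 0) ->
  exists F : V -> R, forall e, F (tgt e) = F (src e) + b e.
Proof.
move=> ob.
pose A : 'M[R]_(#|V|, #|E|) := \matrix_(i, j)
  ((tgt (enum_val j) == enum_val i)%:R - (src (enum_val j) == enum_val i)%:R).
pose beta : 'rV[R]_#|E| := \row_j b (enum_val j).
have : (beta <= A)%MS.
  rewrite submxE; apply/eqP/rowP => j; rewrite mxE mxE.
  pose om : {ffun E -> R^o} := [ffun e => cokermx A (enum_rank e) j].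
  have omH : om \in harmonic Gam.
    rewrite memv_ker lfunE /=; apply/eqP/ffunP => v; rewrite !ffunE.
    have := congr1 (fun M : 'M[R]_(_, _) => M (enum_rank v) j) (mulmx_coker A).
    rewrite !mxE => h; rewrite -[RHS]h big_mkcond [X in _ - X]big_mkcond -sumrB.
    rewrite (reindex _ (onW_bij _ (enum_val_bij E))) /=; apply: eq_bigr => i _.
    by rewrite !ffunE enum_valK [A _ _]mxE enum_rankK; do 2 case: eqP => _; rewrite /=; ring.
  rewrite -[RHS](ob om omH) (reindex _ (onW_bij _ (enum_val_bij E))) /=.
  by apply: eq_bigr => i _; rewrite [beta _ _]mxE !ffunE enum_valK mulrC.
case/submxP => D DE; exists (fun v => D 0 (enum_rank v)) => e.
have := congr1 (fun M : 'rV[R]_#|E| => M 0 (enum_rank e)) DE.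
rewrite !mxE enum_rankK => ->; apply/eqP; rewrite addrC -subr_eq; apply/eqP.
under [RHS]eq_bigr do rewrite mxE enum_rankK mulrBr.
rewrite sumrB; congr (_ - _).
  rewrite (bigD1 (enum_rank (tgt e))) //= enum_rankK eqxx mulr1 big1 ?addr0 // => i ne.
  by case: eqP => [te|_]; rewrite ?mulr0 //; rewrite te enum_valK eqxx in ne.
rewrite (bigD1 (enum_rank (src e))) //= enum_rankK eqxx mulr1 big1 ?addr0 // => i ne.
by case: eqP => [te|_]; rewrite ?mulr0 //; rewrite te enum_valK eqxx in ne.
Qed.

(** A piece of slope [m] on [[x0, y]] is [m * (min(t, y) - min(t, x0))], which vanishes before the
    piece and is constant after it. The conclusion for [t <= x0] ensures that later pieces do not
    disturb earlier ones. *)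
Lemma kinks_of_pieces (g : R -> R) (s : seq R) (x0 L : R) :
  path <=%R x0 s -> last x0 s = L ->
  (forall i, (i < size s)%N -> exists (m : int) (b : R),
     forall t, (x0 :: s)`_i <= t <= s`_i -> g t = m%:~R * t + b) ->
  exists l : seq (R * int), [/\ all (fun k => x0 <= k.1 <= L) l,
    forall t, t <= x0 -> \sum_(k <- l) k.2%:~R * Order.min t k.1 = 0 &
    forall t, x0 <= t <= L -> g t = g x0 + \sum_(k <- l) k.2%:~R * Order.min t k.1].
Proof.
elim: s x0 => [|y s IHs] x0 /=.
  move=> _ <- _; exists [::]; split=> // t; first by rewrite big_nil.
  by rewrite -eq_le => /eqP <-; rewrite big_nil addr0.
move=> /andP[xy ys] lE pieces.
have [i ilt|l [lin l0 gl]] := IHs y ys lE; first by apply: (pieces i.+1).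
have yL : y <= L.
  rewrite -lE; elim: s y {IHs lE pieces xy lin l0 gl} ys => //= z s IHs y /andP[yz zs].
  exact: le_trans yz (IHs z zs).
have [m [b gb]] := pieces 0%N isT; rewrite /= in gb.
exists [:: (y, m), (x0, - m) & l]; split.
- rewrite /= xy yL lexx (le_trans xy yL) /=; apply: sub_all lin => k /andP[yk ->].
  by rewrite (le_trans xy yk).
- move=> t tx; rewrite !big_cons /= l0 ?(le_trans tx) // !min_l ?(le_trans tx) //.
  by rewrite mulrNz; ring.
- move=> t /andP[xt tL]; rewrite !big_cons /= (min_r xt) mulrNz.
  have gy : g y = m%:~R * y + b by apply: gb; rewrite xy lexx.
  have gx : g x0 = m%:~R * x0 + b by apply: gb; rewrite xy lexx.
  have [ty|yt] := leP t y.
    by rewrite l0 // gb ?xt // gx; ring.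
  rewrite gl ?(ltW yt) // gy gx; ring.
Qed.

Lemma piecewise_linear_kinked f : piecewise_linear f ->
  exists2 ks, valid_kinks ks & kinked f ks.
Proof.
move=> plf.
have H e : exists l : seq (R * int), all (fun k => 0 <= k.1 <= len e) l /\
    forall t, 0 <= t <= len e ->
      on_edge f e t = f (inl (src e)) + \sum_(k <- l) k.2%:~R * Order.min t k.1.
  have [s [ps ls pieces]] := plf e.
  have [l [lin _ fl]] := kinks_of_pieces ps ls pieces.
  by exists l; split=> // t /fl ->; rewrite /on_edge edge_pt0.
have {H}[l lP] := choice H.
exists (flatten [seq [seq (e, k.1, k.2) : kink | k <- l e] | e <- enum E]).
  apply/allP => _ /flattenP[_ /mapP[e _ ->] /mapP[k kl ->]] /=.
  by have [/allP/(_ _ kl)] := lP e.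
move=> e t tI; have [_ ->//] := lP e; congr (_ + _).
rewrite /kink_sum big_flatten /= big_map big_enum /= (bigD1 e) //=.
rewrite [X in _ = _ + X]big1 ?addr0 => [|e' /negPf ne].
  by rewrite big_map; apply: eq_big => k //=; rewrite eqxx.
by rewrite big_map big_pred0 // => k /=; rewrite ne.
Qed.

Definition form_at e (om : subvs_of (harmonic Gam)) : R^o := vsval om e.

Lemma form_at_is_linear e : linear (form_at e).
Proof. by move=> a u v; rewrite /form_at linearP !ffunE. Qed.
HB.instance Definition _ e := GRing.isLinear.Build R _ _ _ _ (form_at_is_linear e).

Definition edge_form e : harmonic_dual Gam := linfun (form_at e).

Lemma edge_formE e om : edge_form e om = vsval om e.
Proof. by rewrite lfunE. Qed.

Definition kinks_integral ks : harmonic_dual Gam :=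
  \sum_(k <- ks) (k.2%:~R * k.1.2) *: edge_form k.1.1.

Lemma kinks_integralE ks om :
  kinks_integral ks om = \sum_e vsval om e * \sum_(k <- ks | k.1.1 == e) k.2%:~R * k.1.2.
Proof.
rewrite sum_lfunE; under [RHS]eq_bigr do rewrite mulr_sumr.
rewrite (sum_kinks_on_edges predT (fun e k => vsval om e * (k.2%:~R * k.1.2))).
by apply: eq_bigr => k _; rewrite scale_lfunE edge_formE scale_reg [RHS]mulrC.
Qed.

(** [path_integral] and [cycle_integral] apply [linfun] to bare functions, so their values are known
    only once linearity is proved. *)
Lemma linear_linfunE (h : subvs_of (harmonic Gam) -> R^o) om :
  linear h -> (linfun h : harmonic_dual Gam) om = h om.
Proof.
move=> lh; pose h' : {linear subvs_of (harmonic Gam) -> R^o} :=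
  HB.pack h (GRing.isLinear.Build R _ _ _ h lh).
exact: (lfunE h').
Qed.

Lemma path_integralE (s : seq (segment Gam)) om :
  path_integral s om = \sum_(x <- s) vsval om x.1.1 * (x.2 - x.1.2).
Proof.
apply: linear_linfunE => a u v; rewrite linearP /= scaler_sumr -big_split /=.
by apply: eq_bigr => x _; rewrite !ffunE /= scale_reg -[a *: _]/(a * _); ring.
Qed.

Lemma cycle_integralE (z : {ffun E -> int}) om :
  cycle_integral z om = \sum_e vsval om e * (len e *~ z e).
Proof.
apply: linear_linfunE => a u v; rewrite linearP /= scaler_sumr -big_split /=.
by apply: eq_bigr => x _; rewrite !ffunE /= scale_reg -[a *: _]/(a * _); ring.
Qed.

Lemma kinks_boundary_cat ks ks' :
  kinks_boundary (ks ++ ks') = kinks_boundary ks + kinks_boundary ks'.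
Proof. by rewrite /kinks_boundary big_cat. Qed.

Lemma kinks_integral_cat ks ks' :
  kinks_integral (ks ++ ks') = kinks_integral ks + kinks_integral ks'.
Proof. by rewrite /kinks_integral big_cat. Qed.

Definition scale_kinks (m : int) ks : seq kink := [seq (k.1, m * k.2) | k <- ks].

Lemma valid_scale_kinks m ks : valid_kinks (scale_kinks m ks) = valid_kinks ks.
Proof. by rewrite /valid_kinks all_map. Qed.

Lemma kinks_boundary_scale m ks :
  kinks_boundary (scale_kinks m ks) = kinks_boundary ks *~ m.
Proof.
rewrite /kinks_boundary big_map mulrz_suml; apply: eq_bigr => k _ /=.
by rewrite mulrC mulrzA.
Qed.

Lemma kinks_integral_scale m ks :
  kinks_integral (scale_kinks m ks) = kinks_integral ks *~ m.
Proof.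
rewrite /kinks_integral big_map mulrz_suml; apply: eq_bigr => k _ /=.
by rewrite intrM -mulrA -scalerA scaler_int.
Qed.

(** The kinks of [f] form a chain bounded by its divisor. The integral of [om] along it is the sum
    of [om e * (f (tgt e) - f (src e))], which regroups at the vertices and vanishes by harmonicity.
    Conversely, if the integral is 0, the increments along the edges come from a potential on the
    vertices, which the kinks extend to the interiors of the edges. *)
Theorem principalP D : principal D <-> exists ks,
  [/\ valid_kinks ks, kinks_boundary ks = D & kinks_integral ks = 0].
Proof.
split=> [[f plf fD]|[ks [vk <- ik]]].
  have [ks vk fk] := piecewise_linear_kinked plf.
  exists ks; split=> //.
    apply/eqP/freeg_eqP => x; apply/eqP; rewrite -(eqr_int R) fD.
    by rewrite -(ord_at_kinked x vk fk).
  apply/lfunP => om; rewrite kinks_integralE lfunE /=.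
  have : boundary (vsval om) = 0.
    by have := subvsP om; rewrite memv_ker lfunE => /eqP.
  move=> /ffunP bom.
  have -> : \sum_e vsval om e * \sum_(k <- ks | k.1.1 == e) k.2%:~R * k.1.2 =
      \sum_e vsval om e * (f (inl (tgt e)) - f (inl (src e))).
    apply: eq_bigr => e _; congr (_ * _); rewrite -kink_sum_len //.
    have := fk e (len e); rewrite lexx ltW ?len_gt0 // /on_edge edge_pt_len => -> //.
    by rewrite addrC addKr.
  under eq_bigr do rewrite mulrBr.
  rewrite sumrB [X in X - _](partition_big (@tgt Gam) predT) //=.
  rewrite [X in _ - X](partition_big (@src Gam) predT) //= -sumrB big1 // => v _.
  have := bom v; rewrite !ffunE => bv.
  transitivity ((0 : R) * f (inl v)); last by rewrite mul0r.
  rewrite -[X in _ = X * _]bv mulrBl !mulr_suml.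
  by congr (_ - _); apply: eq_bigr => e /eqP ->.
have [om omH|F FE] := @orth_cycle_space (fun e => \sum_(k <- ks | k.1.1 == e) k.2%:~R * k.1.2).
  by have := kinks_integralE ks (Subvs omH); rewrite ik lfunE => <-.
have fk := kinked_kinked_fun vk FE.
exists (kinked_fun F ks); first exact: kinked_piecewise_linear fk.
by move=> x; rewrite (ord_at_kinked x vk fk).
Qed.

End Abel.

(** * Closed chains, paths and the Abel-Jacobi map *)

Section Chains.
Variables (R : realType) (Gam : metric_graph R).
Local Notation V := (vertex Gam).
Local Notation E := (edge Gam).
Local Notation point := (point_of Gam).
Implicit Types (e : E) (v : V) (x y : point) (ks : seq (kink Gam)).

(* fglift takes values in a module over int, whence zmodule. *)
Definition divisor_sum (g : point -> R) (D : divisor Gam) : R :=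
  fglift (g : point -> zmodule R) D.

Lemma divisor_sum_is_additive g : {morph divisor_sum g : D D' / D - D'}.
Proof. exact: (@lift_is_additive _ _ (zmodule R)). Qed.
HB.instance Definition _ g :=
  GRing.isZmodMorphism.Build (divisor Gam) R _ (divisor_sum_is_additive g).

Lemma divisor_sumU g x : divisor_sum g << x >> = g x.
Proof. by rewrite /divisor_sum liftU scale1r. Qed.

Lemma divisor_sum_kinks g ks : divisor_sum g (kinks_boundary ks) =
  \sum_(k <- ks) k.2%:~R * (g (edge_pt k.1.1 k.1.2) - g (inl (src k.1.1))).
Proof.
rewrite raddf_sum; apply: eq_bigr => k _.
by rewrite raddfMz raddfB /= !divisor_sumU mulrzl.
Qed.

Lemma deg_kinks_boundary ks : deg (kinks_boundary ks) = 0.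
Proof.
rewrite /kinks_boundary raddf_sum big1 // => k _.
by rewrite raddfMz raddfB /= !degU subrr mul0rz.
Qed.

(** At an interior point, a zero boundary means that the multiplicities of the kinks ending there
    cancel. Only kinks covering a whole edge remain, and their multiplicities form an integral
    cycle. *)
Lemma closed_kinks_lattice ks : valid_kinks ks -> kinks_boundary ks = 0 ->
  cycle_lattice (kinks_integral ks).
Proof.
move=> /allP vk bk.
have sum0 (g : point -> R) :
    \sum_(k <- ks) k.2%:~R * (g (edge_pt k.1.1 k.1.2) - g (inl (src k.1.1))) = 0.
  by have := divisor_sum_kinks g ks; rewrite bk raddf0 => <-.
pose z : {ffun E -> int} :=
  [ffun e => \sum_(k <- ks | (k.1.1 == e) && (k.1.2 == len e)) k.2].
(* The zero boundary is paired with a function supported in the interior of [e]. *)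
have interior (h : E -> R -> R) e :
    \sum_(k <- ks | (k.1.1 == e) && (0 < k.1.2 < len e)) k.2%:~R * h e k.1.2 = 0.
  pose g (x : point) : R := match x with
    | inl _ => 0 | inr p => if (val p).1 == e then h e (val p).2 else 0 end.
  rewrite -[RHS](sum0 g) big_mkcond; apply: eq_big_seq => k /vk /andP[b0 bl] /=.
  case: k b0 bl => [[e' b] m] /= b0 bl; rewrite subr0 /edge_pt.
  case: insubP => /= [p /= bI -> /=|/negPf hn].
    by case: eqP => [<-|_] /=; rewrite ?bI ?mulr0.
  case: eqP => [<-|_] /=; first by rewrite hn mulr0.
  by rewrite mulr0.
exists z.
  apply/ffunP => v; rewrite !ffunE; apply/eqP; rewrite -(eqr_int R) intrB mulr0z !rmorph_sum /=.
  have zE e : (z e)%:~R =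
      \sum_(k <- ks | k.1.1 == e) (if k.1.2 == len e then k.2%:~R else 0) :> R.
    by rewrite ffunE rmorph_sum /= big_mkcondr.
  under eq_bigr do rewrite zE.
  under [X in _ - X]eq_bigr do rewrite zE.
  rewrite !(sum_kinks_on_edges _ (fun e k => if k.1.2 == len e then k.2%:~R else 0)).
  (* Kinks ending inside an edge also contribute at its source; by [interior] these contributions
     cancel. *)
  have s1 : \sum_(k <- ks) (if (src k.1.1 == v) && (0 < k.1.2 < len k.1.1)
                            then k.2%:~R * 1 else 0) = 0 :> R.
    rewrite -big_mkcond big_mkcondr -(sum_kinks_on_edges (fun e => src e == v)
      (fun e k => if 0 < k.1.2 < len k.1.1 then k.2%:~R * 1 else 0)) big1 // => e _.
    rewrite -big_mkcondr -[RHS](interior (fun _ _ => 1) e).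
    by apply: eq_bigl => k; case: eqP => [->|].
  have := sum0 (fun x => (x == inl v)%:R) => s0.
  apply/eqP; transitivity ((0 + 0) : R); last by rewrite addr0.
  rewrite -[X in _ = X + _]s0 -[X in _ = _ + X]s1.
  rewrite [X in X - _ = _]big_mkcond [X in _ - X = _]big_mkcond -sumrB -big_split /=.
  apply/eq_big_seq => k /vk /andP[b0 bl].
  have -> : (inl (src k.1.1) == inl v :> point) = (src k.1.1 == v) by [].
  have [be|bn] := eqVneq k.1.2 (len k.1.1).
    rewrite be edge_pt_len ltxx !andbF.
    have -> : (inl (tgt k.1.1) == inl v :> point) = (tgt k.1.1 == v) by [].
    by do 2 case: eqP => _ /=; ring.
  rewrite !if_same subrr; have [->|bn0] := eqVneq k.1.2 0.
    by rewrite edge_pt0 ltxx andbF subrr mulr0 addr0.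
  have h : 0 < k.1.2 < len k.1.1 by rewrite !lt_def bn0 b0 eq_sym bn bl.
  rewrite (edge_pt_inr h) h andbT [inr _ == _](_ : _ = false) //.
  by case: eqP => _ /=; ring.
apply/lfunP => om; rewrite cycle_integralE kinks_integralE.
apply: eq_bigr => e _; congr (_ * _).
rewrite ffunE [RHS](bigID (fun k => k.1.2 == len e)) /=.
rewrite [X in _ = _ + X](_ : _ = 0) ?addr0.
  rewrite -mulrzr rmorph_sum /= mulr_sumr; apply: eq_bigr => k /andP[_ /eqP ->].
  by rewrite mulrC.
rewrite -[RHS](interior (fun _ b => b) e) big_mkcond [RHS]big_mkcond.
apply: eq_big_seq => k /vk /andP[b0 bl]; case: eqP => //= ke.
rewrite -ke; have [->|bl'] := eqVneq k.1.2 (len k.1.1); first by rewrite ltxx andbF.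
have [->|b0'] := eqVneq k.1.2 0; first by rewrite mulr0 ltxx.
by rewrite !lt_def b0' b0 eq_sym bl' bl.
Qed.

Definition path_kinks (s : seq (segment Gam)) : seq (kink Gam) :=
  flatten [seq [:: (c.1.1, c.2, 1); (c.1.1, c.1.2, -1)] | c <- s].

Lemma path_kinks_path x s y : is_path x s y ->
  valid_kinks (path_kinks s) /\ kinks_boundary (path_kinks s) = << y >> - << x >>.
Proof.
elim: s x => [|[[e a] b] s IHs] x /=.
  by move=> ->; split; rewrite // /kinks_boundary big_nil subrr.
move=> [a0 b0 <- /IHs[vs bs]]; split; first by rewrite /= a0 b0.
rewrite /kinks_boundary !big_cons -/(kinks_boundary _) bs /= mulr1z mulrN1z.
by rewrite opprB !addrA subrK -(addrA << edge_pt e b >>) [LHS]addrAC subrr add0r addrC.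
Qed.

Lemma path_kinks_integral s : kinks_integral (path_kinks s) = path_integral s.
Proof.
apply/lfunP => om; rewrite path_integralE sum_lfunE big_flatten big_map.
apply: eq_bigr => x _; rewrite big_cons big_seq1 /= !scale_lfunE edge_formE.
by rewrite !scale_reg mulrNz mulr1z; ring.
Qed.

Lemma is_path_cat x s y s' z : is_path x s y -> is_path y s' z -> is_path x (s ++ s') z.
Proof.
elim: s x => [|[[e a] b] s IHs] x /=; first by move=> ->.
by move=> [a0 b0 ax ps] ps'; split=> //; exact: IHs.
Qed.

Lemma exists_path x y : exists s, is_path x s y.
Proof.
have len0 e : 0 <= 0 <= len e by rewrite lexx ltW // len_gt0.
have lenl e : 0 <= len e <= len e by rewrite lexx ltW // len_gt0.
have vpath u v : exists s, is_path (inl u : point) s (inl v).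
  have /andP[_ /forallP/(_ u)/forallP/(_ v)/connectP[p]] := mgraph_connected Gam.
  elim: p u => [|v' p IHp] u /=; first by move=> _ ->; exists [::].
  move=> /andP[/existsP[e /andP[_ ev]] pp] vE; have [s ps] := IHp _ pp vE.
  case/orP: ev => /andP[/eqP s1 /eqP s2].
    by exists ((e, 0, len e) :: s) => /=; rewrite edge_pt0 edge_pt_len s1 s2.
  by exists ((e, len e, 0) :: s) => /=; rewrite edge_pt0 edge_pt_len s1 s2.
have [u [s su]] : exists u s, is_path x s (inl u).
  case: x => [u|p]; first by exists u, [::].
  exists (src (val p).1), [:: ((val p).1, (val p).2, 0)] => /=.
  by have /andP[p0 pl] := valP p; rewrite edge_pt0 edge_ptE (ltW p0) (ltW pl) len0.
have [v [s' sv]] : exists v s, is_path (inl v) s y.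
  case: y => [v|p]; first by exists v, [::].
  exists (src (val p).1), [:: ((val p).1, 0, (val p).2)] => /=.
  by have /andP[p0 pl] := valP p; rewrite edge_pt0 edge_ptE (ltW p0) (ltW pl) len0.
have [s'' suv] := vpath u v.
by exists (s ++ (s'' ++ s')); apply: is_path_cat su (is_path_cat suv sv).
Qed.

Definition cycle_kinks (z : {ffun E -> int}) : seq (kink Gam) :=
  [seq (e, len e, z e) | e <- enum E].

Lemma valid_cycle_kinks z : valid_kinks (cycle_kinks z).
Proof. by rewrite /valid_kinks all_map; apply/allP => e _ /=; rewrite lexx ltW ?len_gt0. Qed.

Lemma cycle_kinks_integral z : kinks_integral (cycle_kinks z) = cycle_integral z.
Proof.
apply/lfunP => om; rewrite cycle_integralE sum_lfunE big_map big_enum /=.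
apply: eq_bigr => e _; rewrite scale_lfunE edge_formE scale_reg -mulrzr; ring.
Qed.

Lemma cycle_kinks_boundary z : boundary z = 0 -> kinks_boundary (cycle_kinks z) = 0.
Proof.
move=> /ffunP bz; rewrite /kinks_boundary big_map big_enum /=.
under eq_bigr do rewrite edge_pt_len mulrzBl.
rewrite sumrB [X in X - _](partition_big (@tgt Gam) predT) //=.
rewrite [X in _ - X](partition_big (@src Gam) predT) //= -sumrB big1 // => v _.
transitivity ((<< inl v >> : divisor Gam) *~ boundary z v); last by rewrite bz ffunE mulr0z.
rewrite ffunE mulrzBr !mulrz_sumr; congr (_ - _); apply: eq_bigr => e /eqP -> //.
Qed.

(** The paths [gam x] add up to a chain bounded by [D], the multiples of [w] disappearing because
    [D] has degree 0. Two chains bounded by [D] differ by a closed chain, whose integral lies in the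
    lattice, so the choice of paths does not matter. *)
Lemma abel_jacobiP w (D : divisor Gam) phi : deg D = 0 ->
  (abel_jacobi w D phi <-> exists ks,
    [/\ valid_kinks ks, kinks_boundary ks = D & kinks_integral ks = phi]).
Proof.
move=> D0.
have gamks (gam : point -> seq (segment Gam)) : (forall x, is_path w (gam x) x) ->
    exists ks, [/\ valid_kinks ks, kinks_boundary ks = D &
      kinks_integral ks = \sum_(x <- dom D) path_integral (gam x) *~ coeff x D].
  move=> gamP.
  have [ks [vk bk ik]] : exists ks, [/\ valid_kinks ks,
      kinks_boundary ks = \sum_(x <- dom D) ((<< x >> : divisor Gam) - << w >>) *~ coeff x D &
      kinks_integral ks = \sum_(x <- dom D) path_integral (gam x) *~ coeff x D].
    elim: (dom D) => [|v l [ks [vk bk ik]]].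
      by exists [::]; rewrite !big_nil; split; rewrite // /kinks_boundary /kinks_integral big_nil.
    have [vg bg] := path_kinks_path (gamP v).
    exists (scale_kinks (coeff v D) (path_kinks (gam v)) ++ ks).
    rewrite kinks_boundary_cat kinks_integral_cat kinks_boundary_scale kinks_integral_scale.
    rewrite bg bk ik path_kinks_integral !big_cons; split=> //.
    by rewrite /valid_kinks all_cat [all _ ks]vk [all _ _]valid_scale_kinks vg.
  exists ks; split=> //; rewrite bk -[RHS]freeg_sumE.
  have s0 : \sum_(x <- dom D) coeff x D = 0.
    rewrite -[RHS]D0 -[in RHS](freeg_sumE D) raddf_sum; apply: eq_bigr => v _.
    by rewrite /= degU.
  transitivity (\sum_(x <- dom D) ((<< x >> : divisor Gam) *~ coeff x D
      - (<< w >> : divisor Gam) *~ coeff x D)).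
    by apply: eq_bigr => x _; exact: mulrzBl.
  rewrite sumrB -mulrz_sumr s0 mulr0z subr0; apply: eq_bigr => v _.
  by rewrite freegU_mulz intz.
split=> [[gam gamP [z z0 zE]]|[ks [vk bk ik]]].
  have [ks [vk bk ik]] := gamks gam gamP.
  exists (cycle_kinks z ++ ks); rewrite kinks_boundary_cat kinks_integral_cat.
  rewrite bk ik cycle_kinks_boundary // cycle_kinks_integral zE subrK add0r; split=> //.
  by rewrite /valid_kinks all_cat [all _ ks]vk [all _ _]valid_cycle_kinks.
have [gam gamP] := choice (exists_path w); exists gam => //.
have [ks' [vk' bk' ik']] := gamks gam gamP.
rewrite -ik' -ik -mulrN1z -kinks_integral_scale -kinks_integral_cat.
apply: closed_kinks_lattice.
  by rewrite /valid_kinks all_cat [all _ ks]vk [all _ _]valid_scale_kinks.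
by rewrite kinks_boundary_cat kinks_boundary_scale bk bk' mulrN1z subrr.
Qed.

End Chains.

(** * Polyhedrality of the Brill-Noether locus *)

Section Equivalence.
Variables (R : realType) (Gam : metric_graph R).
Local Notation V := (vertex Gam).
Local Notation E := (edge Gam).
Local Notation point := (point_of Gam).
Implicit Types (e : E) (v : V) (x y : point) (ks : seq (kink Gam)).
Implicit Types (D : divisor Gam).

Lemma principal_deg D : principal D -> deg D = 0.
Proof. by move=> /principalP[ks [_ <- _]]; exact: deg_kinks_boundary. Qed.

Lemma equivalent_deg D D' : equivalent D D' -> deg D = deg D'.
Proof.
move=> /principal_deg/eqP; rewrite (degB (D : {freeg point})) subr_eq0.
by move=> /eqP.
Qed.

Lemma equivalent_refl D : equivalent D D.
Proof.
apply/principalP; exists [::]; rewrite subrr.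
by rewrite /kinks_boundary /kinks_integral !big_nil.
Qed.

Lemma equivalent_sym D D' : equivalent D D' -> equivalent D' D.
Proof.
move=> /principalP[ks [vk bk ik]]; apply/principalP.
exists (scale_kinks (-1) ks); rewrite valid_scale_kinks kinks_boundary_scale.
by rewrite kinks_integral_scale bk ik mul0rz mulrN1z opprB.
Qed.

Lemma equivalent_trans D D' D'' :
  equivalent D D' -> equivalent D' D'' -> equivalent D D''.
Proof.
move=> /principalP[ks [vk bk ik]] /principalP[ks' [vk' bk' ik']].
apply/principalP; exists (ks ++ ks').
rewrite kinks_boundary_cat kinks_integral_cat bk bk' ik ik' addr0 addrA subrK.
by rewrite /valid_kinks all_cat [all _ ks]vk [all _ ks']vk'.
Qed.

Lemma div_class_eq D D' : equivalent D D' -> div_class D = div_class D'.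
Proof.
move=> DD'; apply/seteqP; split=> D'' h; last exact: equivalent_trans h.
exact: equivalent_trans (equivalent_sym DD') h.
Qed.

Lemma effective_deg D : effective D -> 0 <= deg D.
Proof.
move=> D0; rewrite -(freeg_sumE D) raddf_sum /= sumr_ge0 // => x _.
by rewrite degU; exact: D0.
Qed.

Lemma effectiveU x : effective (<< x >> : divisor Gam).
Proof. by move=> y; rewrite coeffU mul1r ler0n. Qed.

Lemma effectiveD D D' : effective D -> effective D' -> effective (D + D').
Proof. by move=> h h' x; rewrite (coeffD x (D : {freeg point})) addr_ge0. Qed.

Lemma effectiveMn D n : effective D -> effective (D *+ n).
Proof. by move=> h x; rewrite (coeffMn x n (D : {freeg point})) mulrn_wge0. Qed.

Lemma effective_split D (n : nat) : effective D -> deg D = n.+1%:Z ->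
  exists x, effective (D - << x >>).
Proof.
move=> D0 dD; have /eqP : D != 0.
  by apply/eqP => D_eq0; move: dD; rewrite D_eq0 raddf0.
case E : (dom D) => [|x l]; first by move: (dom_eq0 D); rewrite E eqxx => /esym/eqP.
move=> _; exists x => y; rewrite (coeffB y (D : {freeg point})) coeffU mul1r.
have [<-|_] := eqVneq x y; last by rewrite subr0.
have : x \in dom D by rewrite E inE eqxx.
rewrite mem_dom subr_ge0 => h.
by have := D0 x; rewrite le_eqVlt eq_sym (negPf h) /= gtz0_ge1.
Qed.

Lemma effective_deg0 D : effective D -> deg D = 0 -> D = 0.
Proof.
move=> D0 dD; apply: fgpos_eq0P dD; apply/fgposP => x; exact: D0.
Qed.

Lemma effective_deg2 D : effective D -> deg D = 2 ->
  exists x y, D = << x >> + << y >>.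
Proof.
move=> D0 dD; have [x Dx] := effective_split D0 dD.
have dx : deg (D - << x >>) = 1 by rewrite (degB (D : {freeg point})) degU dD.
have [y Dxy] := effective_split Dx dx.
exists x, y; apply/eqP; rewrite -subr_eq0 opprD addrA; apply/eqP.
apply: effective_deg0 Dxy _.
by rewrite (degB (D - << x >> : {freeg point})) degU dx.
Qed.

Lemma rank_ge1P D (n : nat) (x0 : point) : deg D = n%:Z ->
  (1 <= rank D <-> forall x, exists2 D', equivalent D' D & effective (D' - << x >>)).
Proof.
(* Degrees bound the removable integers by [n], so a largest one exists as soon as 1 is removable,
   and [xget] finds it. *)
move=> dD; have rb r : removable D r -> (r <= n)%N.
  move=> /(_ ((<< x0 >> : divisor Gam) *+ r)) [||D' DD' De].
  - exact/effectiveMn/effectiveU.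
  - by rewrite (degMn r (<< x0 >> : {freeg point})) degU natz.
  have := effective_deg De; rewrite (degB (D' : {freeg point})) (equivalent_deg DD') dD.
  by rewrite (degMn r (<< x0 >> : {freeg point})) degU natz subr_ge0 lez_nat.
have r1P : removable D 1 <-> forall x, exists2 D', equivalent D' D & effective (D' - << x >>).
  split=> [h x|h E0 E0e dE].
    by apply: h; [exact: effectiveU|exact: degU].
  have [x Ex] := effective_split E0e dE.
  have -> : E0 = << x >>; last exact: h.
  apply/eqP; rewrite -subr_eq0; apply/eqP/effective_deg0 => //.
  by rewrite (degB (E0 : {freeg point})) degU dE.
rewrite -r1P /rank; case: asboolP => [Deff|nDeff]; last first.
  split=> // /r1P/(_ x0)[D' DD' De]; case: nDeff; exists D' => //.
  by rewrite -(subrK << x0 >> D'); apply/effectiveD/effectiveU.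
case: xgetP => [r _|no].
  move=> [rr rmax]; rewrite lez_nat; split=> [r1|/rmax//].
  (* A divisor of degree 1 is padded with copies of [x0] up to degree [r]. *)
  move=> E0 E0e dE; have [||D' DD' De] := rr (E0 + (<< x0 >> : divisor Gam) *+ r.-1).
  - by apply: effectiveD => //; exact/effectiveMn/effectiveU.
  - rewrite (degD (E0 : {freeg point})) (degMn r.-1 (<< x0 >> : {freeg point})) degU natz dE.
    by case: r r1 {rr rmax} => // r _; rewrite -PoszD.
  exists D' => //; rewrite -[D' - E0](subrK ((<< x0 >> : divisor Gam) *+ r.-1))
    -[_ - _ - _]addrA -opprD.
  by apply: effectiveD => //; exact/effectiveMn/effectiveU.
split=> // r1; exfalso.
pose P := fun r => `[< removable D r >].
have [|r Pr|r /asboolP rr rmax] := @ex_maxnP P n; [|by apply: rb; apply/asboolP|].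
  by exists 1%N; apply/asboolP.
by apply: (no r); split=> // r' r'r; apply: rmax; apply/asboolP.
Qed.

End Equivalence.

(** * Lifts of effective divisors of degree 3 *)

Section AbelJacobi.
Variables (R : realType) (Gam : metric_graph R) (w : point_of Gam).
Local Notation V := (vertex Gam).
Local Notation E := (edge Gam).
Local Notation point := (point_of Gam).
Implicit Types (e : E) (v : V) (x y : point) (ks : seq (kink Gam)).
Implicit Types (D : divisor Gam) (phi : harmonic_dual Gam).

Definition abel_image D phi := exists ks,
  [/\ valid_kinks ks, kinks_boundary ks = D - (<< w >> : divisor Gam) *+ 3
    & kinks_integral ks = phi].

Lemma coveringP phi C : covering w 3 phi C <->
  exists D, [/\ deg D = 3, C = div_class D & abel_image D phi].
Proof.
split=> -[D [dD CD aD]]; exists D; split=> //; move: aD; apply abel_jacobiP;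
  by rewrite (degB (D : {freeg point})) dD (degMn 3 (<< w >> : {freeg point})) degU.
Qed.

Lemma abel_image_inj D D' phi :
  abel_image D phi -> abel_image D' phi -> equivalent D D'.
Proof.
move=> [ks [vk bk ik]] [ks' [vk' bk' ik']]; apply/principalP.
exists (ks ++ scale_kinks (-1) ks').
rewrite kinks_boundary_cat kinks_integral_cat kinks_boundary_scale kinks_integral_scale.
rewrite bk bk' ik ik' !mulrN1z subrr opprB addrA subrK; split=> //.
by rewrite /valid_kinks all_cat [all _ ks]vk [all _ _]valid_scale_kinks vk'.
Qed.

Lemma abel_image_equivalent D D' phi :
  equivalent D D' -> abel_image D' phi -> abel_image D phi.
Proof.
move=> /principalP[ks [vk bk ik]] [ks' [vk' bk' ik']].
exists (ks ++ ks'); rewrite kinks_boundary_cat kinks_integral_cat bk bk' ik ik'.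
by rewrite add0r addrA subrK /valid_kinks all_cat [all _ ks]vk [all _ ks']vk'.
Qed.

Lemma abel_image_lattice D phi phi' :
  abel_image D phi -> abel_image D phi' -> cycle_lattice (phi - phi').
Proof.
move=> [ks [vk bk ik]] [ks' [vk' bk' ik']].
rewrite -ik -ik' -mulrN1z -kinks_integral_scale -kinks_integral_cat.
apply: closed_kinks_lattice.
  by rewrite /valid_kinks all_cat [all _ ks]vk [all _ _]valid_scale_kinks vk'.
by rewrite kinks_boundary_cat kinks_boundary_scale bk bk' mulrN1z subrr.
Qed.

Lemma abel_image_shift D phi lam :
  abel_image D phi -> cycle_lattice lam -> abel_image D (phi + lam).
Proof.
move=> [ks [vk bk ik]] [z z0 <-].
exists (ks ++ cycle_kinks z); rewrite kinks_boundary_cat kinks_integral_cat bk ik.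
rewrite cycle_kinks_boundary // cycle_kinks_integral addr0; split=> //.
by rewrite /valid_kinks all_cat [all _ ks]vk [all _ _]valid_cycle_kinks.
Qed.

Lemma vertex_kinks_exists v : exists ks, valid_kinks ks /\
  kinks_boundary ks = << inl v >> - << w >>.
Proof.
have [s /path_kinks_path[vs bs]] := exists_path w (inl v).
by exists (path_kinks s).
Qed.

Definition vertex_kinks v : seq (kink Gam) := projT1 (cid (vertex_kinks_exists v)).

(* Image of the point at distance s along e under a lift of the Abel-Jacobi
   map with base point w. *)
Definition edge_image e (s : R) : harmonic_dual Gam :=
  kinks_integral (vertex_kinks (src e)) + s *: edge_form e.

(** The effective divisors with one chip on each of three given edges are parametrized by a box, on
    which the lifted Abel-Jacobi map [cell_image] is affine. *)
Definition cell : Type := (E * E * E)%type.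
HB.instance Definition _ := Finite.on cell.

Implicit Types (c : cell) (t : R^o * R^o * R^o).

Definition cell_box c : seq (R^o * R^o * R^o) :=
  let ends (l : R) : seq R^o := [:: 0; l] in
  [seq (s, s3) | s <- [seq (s1, s2) | s1 <- ends (len c.1.1), s2 <- ends (len c.1.2)],
                 s3 <- ends (len c.2)].

Definition in_box c t := [/\ 0 <= t.1.1 <= len c.1.1, 0 <= t.1.2 <= len c.1.2
  & 0 <= t.2 <= len c.2].

Lemma hull_segment (l : R) (s : R^o) : 0 <= l -> hull [:: (0 : R^o); l : R^o] s <-> 0 <= s <= l.
Proof.
move=> l0; split=> [|/andP[s0 sl]].
  have cI : convex_set [set s : R^o | 0 <= s <= l].
    move=> y z t /= /andP[? ?] /andP[? ?] /andP[? ?]; rewrite !scale_reg.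
    by apply/andP; split; nra.
  apply: (hull_min cI) => x; rewrite !inE => /orP[] /eqP -> /=; first by rewrite lexx.
  by rewrite lexx andbT.
have [l_eq0|ln0] := eqVneq l 0.
  by apply: hull_mem; rewrite !inE -(@le_anti _ R s 0) ?eqxx // s0 -l_eq0 sl.
have lp : 0 < l by rewrite lt_def ln0.
have := @hull_convex _ _ [:: (0 : R^o); l : R^o] l 0 (s / l).
rewrite !scale_reg mulfVK // mulr0 addr0; apply.
- by apply: hull_mem; rewrite !inE eqxx orbT.
- by apply: hull_mem; rewrite !inE eqxx.
- by rewrite divr_ge0 // ler_pdivrMr // mul1r.
Qed.

Lemma hull_box c t : hull (cell_box c) t <-> in_box c t.
Proof.
have l0 e : 0 <= len e by rewrite ltW ?len_gt0.
rewrite /cell_box hull_prod -[X in X <-> _]/(hull _ t.1 /\ hull _ t.2) hull_prod.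
rewrite -[X in X /\ _]/(hull _ t.1.1 /\ hull _ t.1.2) /in_box.
by split=> [[[/hull_segment h1 /hull_segment h2] /hull_segment h3]|[h1 h2 h3]];
  [split; [exact: h1|exact: h2|exact: h3]|repeat split; apply/hull_segment].
Qed.

Definition cell_divisor c t : divisor Gam :=
  << edge_pt c.1.1 t.1.1 >> + << edge_pt c.1.2 t.1.2 >> + << edge_pt c.2 t.2 >>.

Definition cell_image c t : harmonic_dual Gam :=
  edge_image c.1.1 t.1.1 + edge_image c.1.2 t.1.2 + edge_image c.2 t.2.

Lemma edge_image_affine e : affine_map (edge_image e : R^o -> harmonic_dual Gam).
Proof.
apply: affineD; first exact: affine_cst.
by move=> x y t; rewrite !scale_reg [LHS]scalerDl !scalerA.
Qed.

Lemma cell_image_affine c : affine_map (cell_image c).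
Proof.
have a e (p : R^o * R^o * R^o -> R^o) : affine_map p ->
    affine_map (fun t => edge_image e (p t)).
  by move=> ap x y t; rewrite ap edge_image_affine.
by apply: affineD; [apply: affineD|]; apply: a.
Qed.

Lemma deg_cell_divisor c t : deg (cell_divisor c t) = 3.
Proof.
rewrite /cell_divisor (degD (_ : {freeg point})) (degD (_ : {freeg point})).
by rewrite !degU.
Qed.

Lemma abel_image_cell c t : in_box c t -> abel_image (cell_divisor c t) (cell_image c t).
Proof.
have edge_kinks e s : 0 <= s <= len e -> exists ks, [/\ valid_kinks ks,
    kinks_boundary ks = << edge_pt e s >> - << w >> & kinks_integral ks = edge_image e s].
  move=> sI; rewrite /edge_image /vertex_kinks; case: (cid _) => ks [vk bk] /=.
  exists (ks ++ [:: (e, s, 1)]).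
  rewrite kinks_boundary_cat kinks_integral_cat bk /kinks_boundary /kinks_integral.
  rewrite !big_seq1 /= mul1r mulr1z addrC addrA subrK; split=> //.
  by rewrite /valid_kinks all_cat [all _ ks]vk /= sI.
move=> [/edge_kinks[k1 [v1 b1 i1]] /edge_kinks[k2 [v2 b2 i2]] /edge_kinks[k3 [v3 b3 i3]]].
exists (k1 ++ k2 ++ k3); rewrite !kinks_boundary_cat !kinks_integral_cat.
rewrite b1 b2 b3 i1 i2 i3 /valid_kinks !all_cat [all _ k1]v1 [all _ k2]v2 [all _ k3]v3.
split=> //; rewrite /cell_image ?addrA //.
rewrite /cell_divisor !mulrS mulr0n addr0 !opprD !addrA.
rewrite -!addrA; congr (_ + _); rewrite addrCA; congr (_ + _).
by rewrite [RHS]addrCA addrCA; congr (_ + _); rewrite addrCA.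
Qed.

Lemma edge_image_bounded : exists C : R,
  forall e s (om : subvs_of (harmonic Gam)) (m : R), 0 <= s <= len e ->
  (forall e', `|vsval om e'| <= m) -> `|edge_image e s om| <= C * m.
Proof.
exists (\sum_v \sum_(k <- vertex_kinks v) `|k.2%:~R * k.1.2| + \sum_(e : E) len e).
move=> e s om m /andP[s0 sl] omm.
have m0 : 0 <= m := le_trans (normr_ge0 _) (omm e).
rewrite /edge_image add_lfunE scale_lfunE edge_formE mulrDl.
apply: le_trans (ler_normD _ _) _; apply: lerD; last first.
  rewrite normrM ler_pM // ger0_norm // (le_trans sl) //.
  rewrite (bigD1 e) //= lerDl sumr_ge0 // => e' _; exact/ltW/len_gt0.
rewrite (bigD1 (src e)) //= mulrDl ler_wpDr //.
  by rewrite mulr_ge0 // sumr_ge0 // => v _; rewrite sumr_ge0.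
rewrite sum_lfunE mulr_suml; apply: le_trans (ler_norm_sum _ _ _) _.
apply: ler_sum => k _; rewrite scale_lfunE edge_formE normrM ler_wpM2l //.
Qed.

(* Evaluating both sides at the 1-form z bounds \sum_e len e * z e ^ 2 linearly in
   the largest |z e|. *)
Lemma lattice_bounded : exists n : nat, forall c t c' t' z,
  in_box c t -> in_box c' t' -> boundary z = 0 ->
  cell_image c t - cell_image c' t' = cycle_integral z ->
  forall e, `|z e| <= n%:Z.
Proof.
have [C Cb] := edge_image_bounded.
have Cim c t (om : subvs_of (harmonic Gam)) m : in_box c t -> (forall e', `|vsval om e'| <= m) ->
    `|cell_image c t om| <= 3 * C * m.
  move=> [t1 t2 t3] omm; rewrite /cell_image 2!add_lfunE.
  have h1 := Cb _ _ _ _ t1 omm; have h2 := Cb _ _ _ _ t2 omm; have h3 := Cb _ _ _ _ t3 omm.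
  apply: le_trans (ler_normD _ _) _; apply: le_trans (lerD (ler_normD _ _) (lexx _)) _.
  lra.
(* Two cell images of three edge images each give the factor 6. If [m] is the absolute value of [z]
   at an edge [e] where it is largest, then [len e * m ^ 2 <= 6 * C * m]; summing over the edges
   dominates the quotient for whichever edge this is. *)
exists (\sum_(e : E) (Num.truncn (6 * C / len e)).+1)%N => c t c' t' z bt bt' z0 cz e0.
have [e ze] : exists e, forall e', `|z e'| <= `|z e|.
  have [e _ emax] := @arg_maxnP _ e0 predT (fun e => absz (z e)) isT.
  by exists e => e'; rewrite -!abszE lez_nat; exact: emax.
apply: le_trans (ze e0) _.
have zrH : [ffun e => (z e)%:~R] \in harmonic Gam.
  rewrite memv_ker lfunE /=; apply/eqP/ffunP => v; rewrite !ffunE.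
  have /ffunP/(_ v) := z0; rewrite !ffunE => zv.
  under eq_bigr do rewrite ffunE; under [X in _ - X]eq_bigr do rewrite ffunE.
  transitivity ((\sum_(e' | tgt e' == v) z e' - \sum_(e' | src e' == v) z e')%:~R : R).
    by rewrite intrB !rmorph_sum.
  by rewrite zv.
pose om := Subvs zrH; pose m : R := `|z e|%:~R.
have omm e' : `|vsval om e'| <= m by rewrite /= ffunE -intr_norm ler_int ze.
have lez : len e * m ^+ 2 <= cycle_integral z om.
  rewrite cycle_integralE (bigD1 e) //= ffunE -[leLHS]addr0 lerD //.
    by rewrite -mulrzr /m intr_norm real_normK ?num_real //; lra.
  rewrite sumr_ge0 // => e' _; rewrite ffunE -[len e' *~ _]mulrzr.
  have := len_gt0 e'; set a : R := (z e')%:~R => l0.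
  by rewrite mulrCA mulr_ge0 ?(ltW l0) // -expr2 sqr_ge0.
have iz : cycle_integral z om <= 6 * C * m.
  rewrite -cz add_lfunE opp_lfunE; apply: le_trans (ler_norm _) _.
  apply: le_trans (ler_normB _ _) _.
  have := Cim _ _ _ _ bt omm; have := Cim _ _ _ _ bt' omm; lra.
have m0 : 0 <= m by rewrite ler0z.
have [->//|mn0] := eqVneq `|z e| 0.
have mp : 0 < m by rewrite ltr0z lt_def mn0 normr_ge0.
have le0 := len_gt0 e.
have : m < (\sum_(e : E) (Num.truncn (6 * C / len e)).+1)%N%:R.
  have me : m <= 6 * C / len e.
    rewrite ler_pdivlMr // -(ler_pM2r mp) (le_trans _ (le_trans lez iz)) //.
    by rewrite expr2; lra.
  apply: le_lt_trans me _; apply: lt_le_trans (real_truncnS_gt (num_real _)) _.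
  by rewrite ler_nat (bigD1 e) //= leq_addr.
by rewrite /m pmulrn ltr_int => /ltW.
Qed.

Definition lattice_elements (n : nat) : seq (harmonic_dual Gam) :=
  [seq cycle_integral z | z <- [seq z <-
    [seq [ffun e => (nat_of_ord (f e))%:Z - n%:Z]
       | f : {ffun E -> 'I_(n + n).+1} <- enum {: {ffun E -> 'I_(n + n).+1}}] |
    boundary z == 0]].

Lemma lattice_elementsP n lam : lam \in lattice_elements n -> cycle_lattice lam.
Proof. by case/mapP => z; rewrite mem_filter => /andP[/eqP z0 _] ->; exists z. Qed.

Lemma mem_lattice_elements n (z : {ffun E -> int}) : boundary z = 0 ->
  (forall e, `|z e| <= n%:Z) -> cycle_integral z \in lattice_elements n.
Proof.
move=> z0 zn; have shift (m : int) : `|m| <= n%:Z ->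
  m = (absz (m + n%:Z)%R)%:Z - n%:Z /\ (absz (m + n%:Z)%R < (n + n).+1)%N by lia.
apply: map_f; rewrite mem_filter z0 eqxx /=.
apply/mapP; exists [ffun e => inord (absz (z e + n%:Z)%R)]; first by rewrite mem_enum.
by apply/ffunP => e; rewrite !ffunE; have [zE zlt] := shift _ (zn e); rewrite inordK.
Qed.

Definition cover_polytopes n e : seq (seq (harmonic_dual Gam * R^o)) :=
  [seq [seq (cell_image (e, ee.1, ee.2) t + lam, t.1.1) | t <- cell_box (e, ee.1, ee.2)] |
     ee <- enum {: E * E}, lam <- lattice_elements n].

Lemma cover_polytopesP n e phi (s : R^o) :
  (exists2 q, q \in cover_polytopes n e & hull q (phi, s)) <->
  exists e2 e3 s2 s3 lam, [/\ in_box (e, e2, e3) (s, s2, s3),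
    lam \in lattice_elements n & phi = cell_image (e, e2, e3) (s, s2, s3) + lam].
Proof.
pose F e2 e3 lam (t : R^o * R^o * R^o) : harmonic_dual Gam * R^o :=
  (cell_image (e, e2, e3) t + lam, t.1.1).
have aff e2 e3 lam : affine_map (F e2 e3 lam).
  by apply: affine_pair => //; apply: affineD; [exact: cell_image_affine|exact: affine_cst].
split=> [[q /allpairsP[[[e2 e3] lam] [_ lamn qE]] qs]|].
  have : (F e2 e3 lam @` hull (cell_box (e, e2, e3))) (phi, s).
    by rewrite (hull_image _ (aff e2 e3 lam)) -[map _ _]qE.
  by move=> [[[s1 s2] s3] /hull_box b [<- <-]]; exists e2, e3, s2, s3, lam.
move=> [e2 [e3 [s2 [s3 [lam [b lamn ->]]]]]].
exists (map (F e2 e3 lam) (cell_box (e, e2, e3))).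
  by apply/allpairsP; exists ((e2, e3), lam); rewrite mem_enum.
by rewrite -(hull_image _ (aff e2 e3 lam)); exists (s, s2, s3) => //; exact/hull_box.
Qed.

(* The bounded set of lifts of effective classes, intersected with the lifts of
   the classes that have a representative through each point.  Only finitely many
   lattice elements matter because the first set is bounded. *)
Definition rank1_lift n : set (harmonic_dual Gam) :=
  [set phi | exists2 c, c \in enum {: cell} & (cell_image c @` hull (cell_box c)) phi]
  `&` [set phi | {in enum E, forall e, forall s, 0 <= s <= len e ->
                   exists2 q, q \in cover_polytopes n e & hull q (phi, s)}].

Lemma polyhedral_rank1_lift n : polyhedral (rank1_lift n).
Proof.
apply: polyhedral_bigI => [|e].
  apply: polyhedral_bigU => c _; apply: polyhedral_image (@cell_image_affine c).
  exact: polyhedral_hull.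
by apply: polyhedral_forall; rewrite ltW ?len_gt0.
Qed.

(** This excludes the one-point graph, whose vertex lies on no edge. *)
Hypothesis edge_pt_surj : forall x : point, exists e s,
  0 <= s <= len e /\ edge_pt e s = x.

(** An effective divisor through a prescribed point lies in a cell, and its lift differs from [phi]
    by a lattice vector. As [phi] itself is the lift of a divisor in a cell, [lattice_bounded]
    leaves finitely many such vectors. *)
Lemma rank1_liftP : exists n, forall phi, rank1_lift n phi <->
  exists c t, [/\ in_box c t, phi = cell_image c t & 1 <= rank (cell_divisor c t)].
Proof.
have [n nP] := lattice_bounded; exists n => phi; split.
  move=> [[c _ [t /hull_box ct cE]] cov]; exists c, t; split=> //.
  apply/(rank_ge1P w (deg_cell_divisor c t)) => x.
  have [e [s [sI <-]]] := edge_pt_surj x.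
  have /cover_polytopesP[e2 [e3 [s2 [s3 [lam [b lamn pE]]]]]] := cov e (mem_enum _ _) s sI.
  exists (cell_divisor (e, e2, e3) (s, s2, s3)); last first.
    rewrite /cell_divisor /= addrAC (addrAC << edge_pt e s >>) subrr add0r.
    by apply: effectiveD; exact: effectiveU.
  have := abel_image_cell ct; rewrite cE pE; apply: abel_image_inj.
  exact: abel_image_shift (abel_image_cell b) (lattice_elementsP lamn).
move=> [c [t [ct -> /(rank_ge1P w (deg_cell_divisor c t)) rk]]]; split.
  by exists c; rewrite ?mem_enum //; exists t => //; apply/hull_box.
move=> e _ s sI; have [D' DD' De] := rk (edge_pt e s).
have dD : deg (D' - << edge_pt e s >>) = 2.
  by rewrite (degB (D' : {freeg point})) degU (equivalent_deg DD') deg_cell_divisor.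
have [x2 [x3 xE]] := effective_deg2 De dD.
have [e2 [s2 [s2I x2E]]] := edge_pt_surj x2.
have [e3 [s3 [s3I x3E]]] := edge_pt_surj x3.
have b : in_box (e, e2, e3) (s, s2, s3) by [].
have D'E : D' = cell_divisor (e, e2, e3) (s, s2, s3).
  by rewrite /cell_divisor /= x2E x3E -addrA -xE addrC subrK.
have [z z0 zE] := abel_image_lattice
  (abel_image_equivalent DD' (abel_image_cell ct))
  (eq_ind_r (fun D => abel_image D _) (abel_image_cell b) D'E).
apply/cover_polytopesP; exists e2, e3, s2, s3, (cycle_integral z); split=> //.
  by apply: mem_lattice_elements => //; apply: (nP _ _ _ _ _ ct b z0); rewrite zE.
by rewrite zE addrC subrK.
Qed.

Lemma rank_ge1_equivalent D D' : deg D = 3 -> equivalent D D' ->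
  1 <= rank D -> 1 <= rank D'.
Proof.
move=> dD DD' /(rank_ge1P w dD) h.
have dD' : deg D' = 3 by rewrite -(equivalent_deg DD').
apply/(rank_ge1P w dD') => x; have [D'' DD'' De] := h x.
by exists D'' => //; exact: equivalent_trans DD''  DD'.
Qed.

(** A class of rank at least 1 has an effective representative, so one of its lifts is the image of
    a point of a cell: the bounded set [rank1_lift n] meets the fibre over every such class. *)
Lemma brill_noetherE : exists n, (forall phi, rank1_lift n phi <->
    exists c t, [/\ in_box c t, phi = cell_image c t & 1 <= rank (cell_divisor c t)]) /\
  brill_noether Gam 1 3 = [set C | exists phi, rank1_lift n phi /\ covering w 3 phi C].
Proof.
have [n nP] := rank1_liftP; exists n; split=> //; apply/seteqP; split=> C.
  move=> [[D0 dD0 D0C] [D CD rD]].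
  have dD : deg D = 3.
    rewrite -(equivalent_deg (D := D0)) //.
    have : div_class D D by exact: equivalent_refl.
    by rewrite -CD -D0C.
  have [D' DD' De] := (rank_ge1P w dD).1 rD w.
  have D'D : deg D' = 3 by rewrite (equivalent_deg DD').
  have dDw : deg (D' - << w >>) = 2 by rewrite (degB (D' : {freeg point})) degU D'D.
  have [x2 [x3 xE]] := effective_deg2 De dDw.
  have [e1 [s1 [s1I x1E]]] := edge_pt_surj w.
  have [e2 [s2 [s2I x2E]]] := edge_pt_surj x2.
  have [e3 [s3 [s3I x3E]]] := edge_pt_surj x3.
  pose c : cell := (e1, e2, e3); pose t : R^o * R^o * R^o := (s1, s2, s3).
  have D'E : D' = cell_divisor c t.
    by rewrite /cell_divisor /= x1E x2E x3E -addrA -xE addrC subrK.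
  have ct : in_box c t by [].
  exists (cell_image c t); split.
    apply/nP; exists c, t; split=> //; rewrite -D'E.
    exact: rank_ge1_equivalent dD (equivalent_sym DD') rD.
  apply/coveringP; exists D'; split=> //; last by rewrite D'E; exact: abel_image_cell.
  by rewrite CD (div_class_eq DD').
move=> [phi [/nP[c [t [ct -> rk]]] /coveringP[D [dD CD aD]]]]; split.
  by exists D.
exists D => //; apply: rank_ge1_equivalent rk; first exact: deg_cell_divisor.
exact: abel_image_inj (abel_image_cell ct) aD.
Qed.

(** Polytopes of dimension 0 are points, and finitely many of them cannot contain the lifts of the
    given segment. These are distinct because moving the first chip adds a multiple of the nonzero
    form [edge_form c.1.1]. *)
Theorem brill_noether_polyhedral_pos c (t2 t3 a b : R) : a < b ->
  (forall s, a <= s <= b -> in_box c (s, t2, t3) /\ 1 <= rank (cell_divisor c (s, t2, t3))) ->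
  edge_form c.1.1 != 0 ->
  exists2 n, polyhedral_of_dim w 3 (brill_noether Gam 1 3) n & (0 < n)%N.
Proof.
move=> ab fam ef0; have [n [nP WE]] := brill_noetherE.
have [ps psE] := polyhedral_rank1_lift n.
pose ps' := [seq p <- ps | p != [::]].
have ps'E phi : rank1_lift n phi <-> exists2 p, p \in ps' & hull p phi.
  rewrite psE; split=> [[p pps pphi]|[p]].
    exists p => //; rewrite mem_filter pps andbT; apply/eqP => p0.
    by move: pphi; rewrite p0 hull_nil.
  by rewrite mem_filter => /andP[_ pps] pphi; exists p.
exists (\max_(p <- ps') polytope_dim p)%N.
  exists ps'; split=> //; first by rewrite mem_filter eqxx.
  rewrite WE; apply/seteqP; split=> C /=.
    by move=> [phi [/ps'E[p pps pphi] cC]]; exists p, phi.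
  by move=> [p [phi [pps pphi cC]]]; exists phi; split=> //; apply/ps'E; exists p.
rewrite lt0n; apply/negP => /eqP max0.
have dim0 p phi : p \in ps' -> hull p phi -> phi = head 0 p.
  move=> pps; have : (polytope_dim p <= 0)%N.
    by rewrite -max0; apply: leq_bigmax_seq.
  rewrite leqn0 /polytope_dim dimv_eq0 => /eqP sp0.
  have cS : convex_set [set head 0 p].
    by move=> x y r -> -> _; rewrite -scalerDl subrKC scale1r.
  apply: (hull_min cS) => x xp; apply/eqP; rewrite -subr_eq0 -memv0 -sp0.
  by apply: memv_span; apply: map_f.
(* Pigeonhole: [N + 1] sample points against [N] polytopes. *)
pose N := size ps'.
pose s (i : nat) : R := a + (b - a) * (i%:R / N.+1%:R).
pose phis := [seq cell_image c (s i, t2, t3) | i <- iota 0 N.+1].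
have sI i : (i < N.+1)%N -> a <= s i <= b.
  move=> iN; have i0 : 0 <= i%:R / N.+1%:R :> R by rewrite divr_ge0.
  have i1 : i%:R / N.+1%:R <= 1 :> R by rewrite ler_pdivrMr // mul1r ler_nat ltnW.
  have ba : 0 <= b - a by rewrite subr_ge0 ltW.
  by rewrite /s lerDl mulr_ge0 //= -lerBrDl ler_piMr.
have s_inj : injective s.
  have ba : b - a != 0 by rewrite subr_eq0 gt_eqF.
  move=> i j /addrI/(mulfI ba)/(mulIf (invr_neq0 _)) h.
  by apply/eqP; rewrite -(eqr_nat R); apply/eqP/h; rewrite pnatr_eq0.
have : (size phis <= size (map (head (0%R : harmonic_dual Gam)) ps'))%N.
  apply: uniq_leq_size.
    rewrite map_inj_uniq ?iota_uniq // => i j.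
    rewrite /cell_image /edge_image /= => /addIr/addIr/addrI/eqP.
    by rewrite -subr_eq0 -scalerBl scaler_eq0 (negPf ef0) orbF subr_eq0 => /eqP/s_inj.
  move=> _ /mapP[i + ->]; rewrite mem_iota add0n => /andP[_ iN].
  have [ct rk] := fam _ (sI i iN).
  have /ps'E[p pps pphi] : rank1_lift n (cell_image c (s i, t2, t3)).
    by apply/nP; exists c, (s i, t2, t3).
  by rewrite (dim0 _ _ pps pphi) map_f.
by rewrite !size_map size_iota ltnn.
Qed.

End AbelJacobi.

(** * Isometries *)

Section Distance.
Variables (R : realType) (Gam : metric_graph R).
Local Notation V := (vertex Gam).
Local Notation E := (edge Gam).
Local Notation point := (point_of Gam).
Implicit Types (e : E) (v z : V) (x y q : point).

(** Upper bounds on [dist] come from single segments, lower bounds from functions that are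
    1-Lipschitz along each edge; no shortest path is ever constructed. *)
Definition lipschitz (g : point -> R) := forall e (a b : R),
  0 <= a <= len e -> 0 <= b <= len e ->
  `|g (edge_pt e a) - g (edge_pt e b)| <= `|b - a|.

Lemma lipschitz_dist g x y : lipschitz g -> `|g x - g y| <= dist x y.
Proof.
move=> gl; apply: lb_le_inf.
  by have [s ps] := exists_path x y; exists (path_length s); exists s.
move=> _ [s ps <-]; elim: s x ps => [|[[e a] b] s IHs] x /=.
  by move=> ->; rewrite subrr normr0 /path_length big_nil.
move=> [aI bI <- ps]; rewrite /path_length big_cons /= -/(path_length s).
apply: le_trans (ler_distD (g (edge_pt e b)) _ _) _.
by apply: lerD; [exact: gl|exact: IHs].
Qed.

Lemma dist_edge e (a b : R) : 0 <= a <= len e -> 0 <= b <= len e ->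
  dist (edge_pt e a) (edge_pt e b) <= `|b - a|.
Proof.
move=> aI bI; apply: ge_inf.
  by exists 0 => _ [s _ <-]; rewrite /path_length sumr_ge0.
by exists [:: (e, a, b)]; rewrite /path_length ?big_seq1.
Qed.

(** The distance to [z] truncated at [r], provided that non-loop edges are at least [r] long:
    truncation makes the value on an edge depend only on the ends of that edge. Loops are exempt
    from the bound because nothing is known in advance about loops in the target of the isometry. *)
Definition vertex_cone z (r : R) x : R :=
  match x with
  | inl v => if v == z then 0 else r
  | inr p => Order.min r (Order.min (if src (val p).1 == z then (val p).2 else r)
       (if tgt (val p).1 == z then len (val p).1 - (val p).2 else r))
  end.

Lemma vertex_cone_edge z r e (t : R) : 0 < r ->
  (forall e, src e != tgt e -> r <= len e) -> 0 <= t <= len e ->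
  vertex_cone z r (edge_pt e t) =
  Order.min r (Order.min (if src e == z then t else r) (if tgt e == z then len e - t else r)).
Proof.
move=> r0 lr /andP[t0 tl]; have le0 := len_gt0 e.
have [->|tn0] := eqVneq t 0.
  rewrite edge_pt0 /=; case: eqP => [_|/eqP sz]; case: eqP => [tz|_]; rewrite ?subr0.
  - by rewrite (min_l (ltW le0)) min_r // ltW.
  - by rewrite (min_l (ltW r0)) min_r // ltW.
  - by rewrite min_l // le_min lexx lr // tz.
  - by rewrite !minxx.
have [->|tnl] := eqVneq t (len e).
  rewrite edge_pt_len /= subrr; case: eqP => [_|/eqP sz]; case: eqP => [tz|_].
  - by rewrite (min_r (ltW le0)) min_r // ltW.
  - by rewrite (min_r (ltW r0)) min_r // ltW.
  - by rewrite min_l // le_min lexx andbT lr // tz eq_sym.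
  - by rewrite !minxx.
have h : 0 < t < len e by rewrite !lt_def tn0 t0 eq_sym tnl.
by rewrite (edge_pt_inr h).
Qed.

Lemma min_lipschitz (a b a' b' d : R) : `|a - a'| <= d -> `|b - b'| <= d ->
  `|Order.min a b - Order.min a' b'| <= d.
Proof.
rewrite !ler_norml => /andP[? ?] /andP[? ?].
by case: (leP a b) => ?; case: (leP a' b') => ?; apply/andP; split; lra.
Qed.

Lemma vertex_cone_lipschitz z r : 0 < r ->
  (forall e, src e != tgt e -> r <= len e) -> lipschitz (vertex_cone z r).
Proof.
move=> r0 lr e a b aI bI; rewrite !vertex_cone_edge //.
apply: min_lipschitz; first by rewrite subrr normr0.
apply: min_lipschitz; case: ifP => _; rewrite ?subrr ?normr0 //.
  by rewrite distrC.
by rewrite opprB addrC addrA subrK.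
Qed.

Section NearVertex.
Variables (z : V) (r : R).
Hypotheses (r0 : 0 < r) (lr : forall e, src e != tgt e -> r <= len e).

Lemma dist_vertex v : v != z -> r <= dist (inl z) (inl v).
Proof.
move=> vz; have := lipschitz_dist (inl z) (inl v) (vertex_cone_lipschitz z r0 lr).
by rewrite /= eqxx (negPf vz) sub0r normrN gtr0_norm.
Qed.

Lemma dist_vertex_interior p : dist (inl z) (inr p) < r ->
  (src (val p).1 = z /\ (val p).2 <= dist (inl z) (inr p)) \/
  (tgt (val p).1 = z /\ len (val p).1 - (val p).2 <= dist (inl z) (inr p)).
Proof.
move=> dr; have := lipschitz_dist (inl z) (inr p) (vertex_cone_lipschitz z r0 lr).
rewrite /= eqxx sub0r normrN => h.
have {h} := le_trans (ler_norm _) h.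
by rewrite !ge_min leNgt dr /= => /orP[]; case: eqP => [sz|_] h;
  [left|rewrite leNgt dr in h|right|rewrite leNgt dr in h].
Qed.

End NearVertex.

(** The distance to [p] truncated at [r], for [r] at most the distance from [p] to either end of its
    edge. *)
Definition tent (p : {x : E * R | 0 < x.2 < len x.1}) (r : R) x : R :=
  match x with
  | inl _ => r
  | inr p' => if (val p').1 == (val p).1 then Order.min r `|(val p').2 - (val p).2| else r
  end.

Lemma tent_lipschitz p r : r <= (val p).2 -> r <= len (val p).1 - (val p).2 ->
  lipschitz (tent p r).
Proof.
move=> rs rl e a b aI bI.
have tE (t : R) : 0 <= t <= len e -> tent p r (edge_pt e t) =
    if e == (val p).1 then Order.min r `|t - (val p).2| else r.
  move=> /andP[t0 tl]; have [->|tn0] := eqVneq t 0.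
    rewrite edge_pt0 /= sub0r normrN; case: ifP => // _.
    by rewrite min_l // (le_trans rs) // ler_norm.
  have [->|tnl] := eqVneq t (len e).
    rewrite edge_pt_len /=; case: eqP => // ->.
    by rewrite min_l // (le_trans rl) // ler_norm.
  have h : 0 < t < len e by rewrite !lt_def tn0 t0 eq_sym tnl.
  by rewrite (edge_pt_inr h).
rewrite !tE //; case: ifP => _; last by rewrite subrr normr0.
apply: min_lipschitz; first by rewrite subrr normr0.
apply: le_trans (ler_dist_dist _ _) _.
by rewrite opprB addrA subrK distrC.
Qed.

Lemma dist_interior p r q : 0 < r -> r <= (val p).2 -> r <= len (val p).1 - (val p).2 ->
  dist (inr p) q < r ->
  exists2 p', q = inr p' & (val p').1 = (val p).1 /\ `|(val p').2 - (val p).2| <= dist (inr p) q.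
Proof.
move=> r0 rs rl dr; have := lipschitz_dist (inr p) q (tent_lipschitz rs rl).
rewrite /= eqxx subrr normr0 min_r ?(ltW r0) // sub0r normrN => h.
have {h} := le_trans (ler_norm _) h; case: q dr => [v|p'] /= dr.
  by rewrite leNgt dr.
case: eqP => [ee|_]; last by rewrite leNgt dr.
by rewrite ge_min leNgt dr /= => h; exists p'.
Qed.

Lemma sphere_interior p r q : 0 < r -> r < (val p).2 -> r < len (val p).1 - (val p).2 ->
  dist (inr p) q = r ->
  q = edge_pt (val p).1 ((val p).2 + r) \/ q = edge_pt (val p).1 ((val p).2 - r).
Proof.
move=> r0 rs rl dr.
pose r' := Order.min (val p).2 (len (val p).1 - (val p).2).
have r'r : r < r' by rewrite lt_min rs rl.
have h1 : r' <= (val p).2 by rewrite ge_min lexx.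
have h2 : r' <= len (val p).1 - (val p).2 by rewrite ge_min lexx orbT.
have d' : dist (inr p) q < r' by rewrite dr.
have [p' qE [ee tt]] := dist_interior (lt_trans r0 r'r) h1 h2 d'.
have : dist (inr p) q <= `|(val p').2 - (val p).2|.
  rewrite qE -!edge_ptE ee; have /andP[{}h1 {}h2] := valP p; have /andP[h3 h4] := valP p'.
  rewrite ee in h4.
  by apply: dist_edge; rewrite ?(ltW h1) ?(ltW h2) ?(ltW h3) ?(ltW h4).
rewrite dr in tt * => tt'; have {tt tt'} : `|(val p').2 - (val p).2| = r.
  by apply/eqP; rewrite eq_le tt tt'.
rewrite qE -edge_ptE ee => <-; case: (ler0P ((val p').2 - (val p).2)) => _.
  by right; rewrite opprK addrC subrK.
by left; rewrite addrC subrK.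
Qed.

End Distance.

Definition joins (G : graph) (e : edge G) (u v : vertex G) : Prop :=
  (src e = u /\ tgt e = v) \/ (src e = v /\ tgt e = u).

Definition graph_iso (G H : graph) (fV : vertex G -> vertex H) (fE : edge G -> edge H) :=
  [/\ bijective fV, bijective fE & forall e, joins (fE e) (fV (src e)) (fV (tgt e))].

Section IsometryIso.
Variables (R : realType) (Gam Gam' : metric_graph R).
Variable f : point_of Gam -> point_of Gam'.
Hypotheses (fbij : bijective f) (fdist : forall x y, dist (f x) (f y) = dist x y).
Hypothesis loopless : forall e : edge Gam, src e != tgt e.
Hypothesis valence3 : forall v : vertex Gam, (3 <= valence v)%N.
Hypothesis len_bounds : forall e : edge Gam, 9 < len e < 11.
Hypothesis cardV : (#|vertex Gam'| <= #|vertex Gam|)%N.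
Hypothesis cardE : (#|edge Gam'| <= #|edge Gam|)%N.

Lemma incident_edges (v : vertex Gam) : exists e1 e2 e3 : edge Gam,
  [/\ [/\ e1 != e2, e2 != e3 & e3 != e1] &
      forall e, e \in [:: e1; e2; e3] -> src e = v \/ tgt e = v].
Proof.
pose A := [pred e : edge Gam | src e == v]; pose B := [pred e : edge Gam | tgt e == v].
have : (2 < #|[predU A & B]|)%N.
  have AB : #|[predI A & B]| = 0%N.
    apply: eq_card0 => e; rewrite !inE; apply/negP => /andP[/eqP se /eqP te].
    by have := loopless e; rewrite se te eqxx.
  by have := cardUI A B; rewrite AB addn0 => ->; exact: valence3.
case/card_gt2P => e1 [e2 [e3 [[h1 h2 h3] ne]]]; exists e1, e2, e3; split=> // e.
by rewrite !inE => /or3P[] /eqP ->; [move: h1|move: h2|move: h3];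
  rewrite !inE => /orP[] /eqP ->; [left|right|left|right|left|right].
Qed.

Lemma len_lower_bound : exists2 r : R, 9 < r & forall e : edge Gam, r <= len e.
Proof.
exists (\big[Order.min/11]_(e : edge Gam) len e); last by move=> e; exact: bigmin_le.
apply: lt_bigmin; first by lra.
by move=> e _; case/andP: (len_bounds e).
Qed.

(* Small spheres around an interior point of an edge have only two points. *)
Lemma isometry_vertex v : exists v', f (inl v) = inl v'.
Proof.
have [r r9 rlen] := len_lower_bound.
case fv : (f (inl v)) => [v'|p]; first by exists v'.
have /andP[p0 pl] := valP p.
(* The bound 9 keeps [eps] below the length of every edge at [v], and the other two keep the sphere
   around [p] inside its edge. The points at distance [eps] from [v] on three edges are then mapped
   to a sphere of two points. *)
pose rho := Order.min 9 (Order.min (val p).2 (len (val p).1 - (val p).2)).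
have rho0 : 0 < rho by rewrite !lt_min p0 subr_gt0 pl !andbT; lra.
pose eps := rho / 2.
have eps0 : 0 < eps by rewrite divr_gt0.
have eps_rho : eps < rho by rewrite /eps; lra.
have := eps_rho; rewrite !lt_min => /and3P[eps9 epss epsl].
have [e1 [e2 [e3 [[n12 n23 n31] inc]]]] := incident_edges v.
pose q e : R := if src e == v then eps else len e - eps.
have qI e : 0 < q e < len e.
  have := rlen e; rewrite /q => h; case: ifP => _; apply/andP; split; lra.
pose qp e : {x : edge Gam * R | 0 < x.2 < len x.1} := exist _ (e, q e) (qI e).
have dq e : e \in [:: e1; e2; e3] -> dist (inl v) (inr (qp e)) = eps.
  move=> /inc einc; apply/eqP; rewrite eq_le; apply/andP.
  have le1 : dist (inl v) (inr (qp e)) <= eps.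
    rewrite -[inr _](edge_ptE (qp e)) /=; have := qI e; rewrite /q.
    have l0 : 0 <= len e by rewrite ltW ?len_gt0.
    case: (eqVneq (src e) v) => [<-|sv] /andP[h1 h2].
      rewrite -edge_pt0; apply: le_trans (dist_edge _ _) _; rewrite ?lexx ?(ltW h1) ?(ltW h2) //.
      by rewrite subr0 gtr0_norm.
    case: einc => [sv'|<-]; first by rewrite sv' eqxx in sv.
    rewrite -edge_pt_len; apply: le_trans (dist_edge _ _) _;
      rewrite ?lexx ?andbT ?(ltW h1) ?(ltW h2) //.
    by rewrite addrAC subrr sub0r normrN gtr0_norm.
  split=> //.
  have lr (e' : edge Gam) : src e' != tgt e' -> r <= len e' by move=> _; exact: rlen.
  have r0 : 0 < r by lra.
  have := @dist_vertex_interior _ _ v r r0 lr (qp e).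
  have -> : dist (inl v) (inr (qp e)) < r by apply: le_lt_trans le1 _; lra.
  move=> /(_ isT); rewrite /= /q; case: (eqVneq (src e) v) => [sv|sv] [] [] //.
  - move=> tv; have := loopless e; by rewrite sv tv eqxx.
  - by move=> sv'; rewrite sv' eqxx in sv.
  - by move=> _; rewrite opprB addrC subrK.
have fq e : e \in [:: e1; e2; e3] ->
    f (inr (qp e)) = edge_pt (val p).1 ((val p).2 + eps) \/
    f (inr (qp e)) = edge_pt (val p).1 ((val p).2 - eps).
  by move=> /dq ed; apply: sphere_interior => //; rewrite -fv fdist.
have fqI e e' : f (inr (qp e)) = f (inr (qp e')) -> e = e'.
  by move=> /(bij_inj fbij) [] ->.
have [h1 h2 h3] : [/\ e1 \in [:: e1; e2; e3], e2 \in [:: e1; e2; e3] & e3 \in [:: e1; e2; e3]].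
  by rewrite !inE !eqxx !orbT.
exfalso; case: (fq _ h1) => f1; case: (fq _ h2) => f2; case: (fq _ h3) => f3;
  first [ by case/eqP: n12; apply: fqI; rewrite f1 f2
        | by case/eqP: n23; apply: fqI; rewrite f2 f3
        | by case/eqP: n31; apply: fqI; rewrite f3 f1 ].
Qed.

(* All vertices are at distance more than 9 from each other, and the midpoint of an
   edge is at distance less than 9 from its two ends only: its image lies on an edge
   between the images of these ends. *)
Lemma isometry_graph_iso :
  (exists (fV : vertex Gam -> vertex Gam') (fE : edge Gam -> edge Gam'),
     graph_iso fV fE) /\
  forall e : edge Gam', 9 < len e < 11.
Proof.
have [r r9 rlen] := len_lower_bound; have r0 : 0 < r by lra.
have [fV fVE] := choice isometry_vertex.
have fV_inj : injective fV.
  by move=> u v uv; have := fVE u; rewrite uv -fVE => /(bij_inj fbij)[].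
have fV_bij : bijective fV by exact: inj_card_bij.
have dV u v : u != v -> r <= dist (inl u : point_of Gam') (inl v).
  case: fV_bij => gV gK gK'; rewrite -[u]gK' -[v]gK' -!fVE fdist => uv.
  by apply: dist_vertex => //; apply: contraNneq uv => ->.
(* The ends of a non-loop of [Gam'] are images of distinct vertices of [Gam], which gives a first
   bound on lengths in [Gam']. *)
have loopfree_len e : src e != tgt e -> r <= len (e : edge Gam').
  move=> /dV h; apply: le_trans h _; rewrite -edge_pt0 -edge_pt_len.
  have l0 := len_gt0 e; apply: le_trans (dist_edge _ _) _; rewrite ?lexx ?(ltW l0) //.
  by rewrite subr0 gtr0_norm.
have mI (e : edge Gam) : 0 < len e / 2 < len e.
  have h := len_gt0 e; apply/andP; split; lra.
pose m e : {x : edge Gam * R | 0 < x.2 < len x.1} := exist _ (e, len e / 2) (mI e).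
have fm (e : edge Gam) : exists p, f (inr (m e)) = inr p.
  case fme : (f (inr (m e))) => [v|p]; last by exists p.
  by case: fV_bij => gV gK gK'; move: fme; rewrite -[v]gK' -fVE => /(bij_inj fbij).
have [p pE] := choice fm.
have dm (e : edge Gam) v : src e = v \/ tgt e = v -> dist (inl v) (inr (m e)) <= len e / 2.
  rewrite -[inr _](edge_ptE (m e)) /= => h; have l0 := len_gt0 e.
  have /andP[h1 h2] := mI e.
  case: h => <-; rewrite -?edge_pt0 -?edge_pt_len.
    apply: le_trans (dist_edge _ _) _; rewrite ?lexx ?(ltW h1) ?(ltW h2) ?(ltW l0) //.
    by rewrite subr0 gtr0_norm.
  apply: le_trans (dist_edge _ _) _; rewrite ?lexx ?(ltW h1) ?(ltW h2) ?(ltW l0) //.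
  by rewrite distrC ger0_norm; lra.
have near (e : edge Gam) v : src e = v \/ tgt e = v ->
    (src (val (p e)).1 = fV v /\ (val (p e)).2 <= len e / 2) \/
    (tgt (val (p e)).1 = fV v /\ len (val (p e)).1 - (val (p e)).2 <= len e / 2).
  move=> /dm h; have := @dist_vertex_interior _ _ (fV v) r r0 loopfree_len (p e).
  rewrite -pE -fVE fdist; have := len_bounds e => /andP[_ l11] H.
  have /H : dist (inl v) (inr (m e)) < r by apply: le_lt_trans h _; lra.
  by move=> [[-> h1]|[-> h1]]; [left|right]; split=> //; apply: le_trans h1 h.
pose fE (e : edge Gam) := (val (p e)).1.
have fEP e : [/\ joins (fE e) (fV (src e)) (fV (tgt e)), (val (p e)).2 <= len e / 2 &
    len (fE e) - (val (p e)).2 <= len e / 2].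
  have fst_ne : fV (src e) <> fV (tgt e) by move=> /fV_inj/eqP; rewrite (negPf (loopless e)).
  rewrite /fE; have [[s1 t1]|[s1 t1]] := near e (src e) (or_introl erefl);
    have [[s2 t2]|[s2 t2]] := near e (tgt e) (or_intror erefl).
  - by case: fst_ne; rewrite -s1 -s2.
  - by split=> //; left.
  - by split=> //; right.
  - by case: fst_ne; rewrite -s1 -s2.
(* The image of the midpoint of [e] is within [len e / 2] of both ends of [fE e], so
   [len (fE e) <= len e]. *)
have flen e : 9 < len (fE e) < 11.
  have [js h1 h2] := fEP e; have /andP[_ l11] := len_bounds e.
  have ne : src (fE e) != tgt (fE e).
    by case: js => -[-> ->]; rewrite ?[fV (tgt e) == _]eq_sym (inj_eq fV_inj) loopless.
  have h := loopfree_len _ ne; apply/andP; split; lra.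
have fE_inj : injective fE.
  move=> e1 e2 e12; have [_ h1 h2] := fEP e1; have [_ h3 h4] := fEP e2.
  have /andP[l1 l1'] := flen e1; have /andP[l2 l2'] := len_bounds e1.
  have /andP[l3 l3'] := len_bounds e2.
  (* Two midpoints sent to the same edge have positions between 7/2 and 11/2 on it, whereas a point
     off [e1] is at distance at least [len e1 / 2 > 9 / 2] from the midpoint of [e1]. *)
  have dmm : dist (inr (m e1)) (inr (m e2)) <= 2.
    rewrite -fdist !pE -!edge_ptE -/(fE e1) -/(fE e2) -e12.
    have /andP[a1 b1] := valP (p e1); have /andP[a2 b2] := valP (p e2).
    rewrite -/(fE _) -e12 in b2.
    apply: le_trans (dist_edge _ _) _; rewrite ?(ltW a1) ?(ltW a2) ?(ltW b1) ?(ltW b2) //.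
    rewrite -e12 in h4; 
    by rewrite ler_norml; apply/andP; split; lra.
  have [d1 d2] : 0 < len e1 / 2 /\ 2 < len e1 / 2 by split; lra.
  have d3 : len e1 / 2 <= len (val (m e1)).1 - (val (m e1)).2 by rewrite /=; lra.
  have d4 : len e1 / 2 <= (val (m e1)).2 by [].
  have [p' mp [ee _]] := dist_interior d1 d4 d3 (le_lt_trans dmm d2).
  by case: mp ee => <- /= ->.
have fE_bij : bijective fE by exact: inj_card_bij.
split; first by exists fV, fE; split=> // e; have [] := fEP e.
by move=> e; case: fE_bij => gE gK gK'; rewrite -[e]gK'.
Qed.

End IsometryIso.

(** * The loop of loops *)

Definition mod6 (n : nat) : 'I_6 := Ordinal (ltn_pmod n (isT : (0 < 6)%N)).
Definition mod9 (n : nat) : 'I_9 := Ordinal (ltn_pmod n (isT : (0 < 9)%N)).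

(* With u_i = 2 i and v_i = 2 i + 1, the edges i and 3 + i go from u_i to v_i and
   the edge 6 + i goes from v_i to u_(i+1), where i is taken modulo 3. *)
Definition loops_src (e : 'I_9) : nat := (2 * (e %% 3) + (6 <= e))%N.
Definition loops_ends (e : 'I_9) : 'I_6 * 'I_6 :=
  (mod6 (loops_src e), mod6 (loops_src e).+1).

Definition loops_graph : graph :=
  @Graph 'I_6 'I_9 (fun e => (loops_ends e).1) (fun e => (loops_ends e).2).

Lemma sum_mod9 (M : nmodType) (F : 'I_9 -> M) :
  \sum_e F e = F (mod9 0) + F (mod9 1) + F (mod9 2) + F (mod9 3) + F (mod9 4) +
    F (mod9 5) + F (mod9 6) + F (mod9 7) + F (mod9 8).
Proof.
rewrite !big_ord_recl big_ord0 addr0 !addrA.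
by do !congr (_ + _); congr F; apply: val_inj.
Qed.

Lemma mod9E (P : 'I_9 -> Prop) : (forall n, (n < 9)%N -> P (mod9 n)) -> forall e, P e.
Proof.
move=> h e; have -> : e = mod9 e by apply: val_inj; rewrite /= modn_small ?ltn_ord.
by apply: h; exact: ltn_ord.
Qed.

Lemma mod6E (P : 'I_6 -> Prop) : (forall n, (n < 6)%N -> P (mod6 n)) -> forall v, P v.
Proof.
move=> h v; have -> : v = mod6 v by apply: val_inj; rewrite /= modn_small ?ltn_ord.
by apply: h; exact: ltn_ord.
Qed.

Ltac eval_ifs := repeat match goal with |- context [if ?b then _ else _] =>
  let v := eval vm_compute in b in change b with v; cbv iota end.

(** [(i + 2) %% 3] is [i - 1] modulo 3, so that [6 + (i + 2) %% 3] is the chord entering [u_i]. *)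
Lemma boundary_loops (M : zmodType) (z : {ffun 'I_9 -> M}) i : (i < 3)%N ->
  boundary (G := loops_graph) z (mod6 (2 * i)) =
    z (mod9 (6 + (i + 2) %% 3)) - (z (mod9 i) + z (mod9 (3 + i))) /\
  boundary (G := loops_graph) z (mod6 (2 * i).+1) =
    (z (mod9 i) + z (mod9 (3 + i))) - z (mod9 (6 + i)).
Proof.
by case: i => [|[|[|]]] // _; rewrite !ffunE !(big_mkcond (fun e => _ == _)) /=
  !sum_mod9; eval_ifs; rewrite ?addr0 ?add0r.
Qed.

Lemma harmonic_loops (M : zmodType) (z : {ffun 'I_9 -> M}) :
  boundary (G := loops_graph) z = 0 <->
  forall i, (i < 3)%N -> z (mod9 (6 + (i + 2) %% 3)) = z (mod9 i) + z (mod9 (3 + i)) /\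
                        z (mod9 i) + z (mod9 (3 + i)) = z (mod9 (6 + i)).
Proof.
split=> [/ffunP z0 i i3|h].
  have [h1 h2] := boundary_loops z i3.
  by split; apply/eqP; rewrite -subr_eq0 -?h1 -?h2 z0 ffunE.
apply/ffunP => v; rewrite [RHS]ffunE; move: v.
apply: (@mod6E (fun v => boundary (G := loops_graph) z v = 0)) => n n6.
have i3 : (n./2 < 3)%N by lia.
have [h1 h2] := boundary_loops z i3; have [h3 h4] := h _ i3.
have [/even_halfK nE|/negPn no] := boolP (~~ odd n).
  by rewrite -nE -mul2n h1 h3 subrr.
by rewrite -[n](odd_double_half) no -mul2n h2 h4 subrr.
Qed.

(** Boundaries have coefficient sum 0, so the boundary map has rank less than the number of
    vertices. *)
Lemma genus_bound (G : graph) : (0 < #|vertex G|)%N ->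
  (#|edge G| + 1 <= genus G + #|vertex G|)%N.
Proof.
move=> V0; pose d : 'Hom({ffun edge G -> rat^o}, {ffun vertex G -> rat^o}) :=
  linfun (@boundary G rat^o).
have := limg_ker_dim d fullv; rewrite capfv.
have -> : \dim {: {ffun edge G -> rat^o}} = #|edge G|.
  by rewrite dimvf; exact: muln1.
rewrite -/(cycle_space G rat) -/(genus G) => <-.
pose S (f : {ffun vertex G -> rat^o}) : rat^o := \sum_v f v.
have lS : linear S.
  move=> a x y; rewrite /S scaler_sumr -big_split; apply: eq_bigr => v _.
  by rewrite !ffunE.
pose S' : {linear {ffun vertex G -> rat^o} -> rat^o} :=
  HB.pack S (GRing.isLinear.Build _ _ _ _ S lS).
have : (\dim (d @: fullv) <= \dim (lker (linfun S')))%N.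
  apply: dimvS; apply/subvP => _ /memv_imgP[z _ ->].
  rewrite memv_ker !lfunE /= /S; apply/eqP.
  under eq_bigr do rewrite ffunE.
  rewrite sumrB; apply/eqP; rewrite subr_eq0; apply/eqP.
  transitivity (\sum_e z e); first by rewrite [RHS](partition_big (@tgt G) predT).
  by rewrite [LHS](partition_big (@src G) predT).
have := limg_ker_dim (linfun S') fullv; rewrite capfv.
have -> : \dim {: {ffun vertex G -> rat^o}} = #|vertex G|.
  by rewrite dimvf; exact: muln1.
have : (0 < \dim (linfun S' @: fullv))%N.
  case/card_gt0P: V0 => v0 _; rewrite lt0n dimv_eq0; apply/eqP => im0.
  pose f0 : {ffun vertex G -> rat^o} := [ffun v => (v == v0)%:R].
  have := memv_img (linfun S') (memvf f0).
  rewrite im0 memv0 lfunE /= /S (bigD1 v0) //= ffunE eqxx big1 ?addr0 ?oner_eq0 //.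
  by move=> v /negPf vv; rewrite ffunE vv.
lia.
Qed.

(** With V vertices and E edges, valences give [3 V <= 2 E] and the genus gives [E <= V + 3]. *)
Lemma stable_bounds (G : stable_graph 4) : (nb_vertex G <= 6)%N /\ (nb_edge G <= 9)%N.
Proof.
have /andP[V0 _] := stable_connected G.
have := genus_bound V0; rewrite stable_genus !card_ord.
have : (nb_vertex G * 3 <= nb_edge G * 2)%N.
  rewrite -{1}[nb_vertex G]card_ord -sum_nat_const.
  apply: (@leq_trans (\sum_(v : vertex G) valence v)).
    by apply: leq_sum => v _; exact: stable_valence.
  have card_ends (h : edge G -> vertex G) : \sum_v #|[pred e | h e == v]| = nb_edge G.
    rewrite -[RHS]card_ord -sum1_card [RHS](partition_big h predT) //=.
    by apply: eq_bigr => v _; rewrite sum1_card.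
  by rewrite /valence big_split /= !card_ends muln2 addnn.
lia.
Qed.

Lemma card_loops (P : pred 'I_9) : #|P| = (\sum_(e < 9) P e)%N.
Proof. by rewrite -sum1_card big_mkcond. Qed.

Lemma loops_valence (v : vertex loops_graph) : (3 <= valence v)%N.
Proof.
move: v; apply: mod6E => n; rewrite /valence !card_loops !sum_mod9.
by case: n => [|[|[|[|[|[|]]]]]].
Qed.

Lemma loops_connected : connected_graph loops_graph.
Proof.
apply/andP; split; first by rewrite card_ord.
have step n : connect (adj (G := loops_graph) predT) (mod6 n) (mod6 n.+1).
  have -> : mod6 n = mod6 (n %% 6) by apply: val_inj; rewrite /= modn_mod.
  have -> : mod6 n.+1 = mod6 (n %% 6).+1.
    by apply: val_inj; rewrite /= -[n.+1]addn1 -[(n %% 6).+1]addn1 modnDml.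
  have : (n %% 6 < 6)%N by rewrite ltn_mod.
  case: (n %% 6)%N => [|[|[|[|[|[|]]]]]] // _; apply: connect1; apply/existsP.
  - by exists (mod9 0).
  - by exists (mod9 6).
  - by exists (mod9 1).
  - by exists (mod9 7).
  - by exists (mod9 2).
  - by exists (mod9 8).
have steps m d : connect (adj (G := loops_graph) predT) (mod6 m) (mod6 (m + d)).
  elim: d => [|d IHd]; first by rewrite addn0.
  by rewrite addnS; apply: connect_trans IHd (step _).
apply/forallP => u; apply/forallP => v.
have -> : u = mod6 u by apply: val_inj; rewrite /= modn_small ?ltn_ord.
have -> : v = mod6 (u + (v + 6 - u)).
  by apply: val_inj; rewrite /= subnKC ?modnDr ?modn_small ?ltn_ord //; have := ltn_ord u; lia.
exact: steps.
Qed.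

Lemma loops_genus : genus loops_graph = 4.
Proof.
apply/eqP; rewrite eqn_leq; apply/andP; split; last first.
  have := @genus_bound loops_graph; rewrite !card_ord => /(_ isT).
  by rewrite -[(9 + 1)%N]/((4 + 6)%N) leq_add2r.
(* A cycle is determined by its values on one edge of each double edge (0, 1, 2) and on one chord
   (6). *)
pose g (z : {ffun 'I_9 -> rat^o}) : {ffun 'I_4 -> rat^o} :=
  [ffun i : 'I_4 => z (mod9 (if i == 3 :> nat then 6 else i)%N)].
have lg : linear g by move=> a x y; apply/ffunP => i; rewrite !ffunE.
pose g' : {linear {ffun 'I_9 -> rat^o} -> {ffun 'I_4 -> rat^o}} :=
  HB.pack g (GRing.isLinear.Build _ _ _ _ g lg).
rewrite /genus -(@limg_dim_eq _ _ _ (linfun g')).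
  apply: (leq_trans (dimvS (subvf _))); rewrite dimvf.
  by rewrite /dim /= card_ord.
apply/eqP; rewrite -subv0; apply/subvP => z; rewrite memv_cap !memv_ker !lfunE.
move=> /andP[/eqP zb /eqP gz]; rewrite memv0; apply/eqP/ffunP.
have gi (i : nat) : (i < 4)%N -> z (mod9 (if i == 3 then 6 else i)%N) = 0.
  by move=> i4; have /ffunP/(_ (Ordinal i4)) := gz; rewrite !ffunE.
have {}zb : boundary (G := loops_graph) (z : {ffun 'I_9 -> rat^o}) = 0.
  by rewrite -[RHS]zb; exact/esym/(lfunE (@boundary loops_graph rat^o)).
have h := (harmonic_loops (M := rat^o) z).1 zb.
have [h1 h2] := h 0%N isT; have [h3 h4] := h 1%N isT; have [h5 h6] := h 2%N isT.
have g0 := gi 0%N isT; have g1 := gi 1%N isT; have g2 := gi 2%N isT; have g3 := gi 3%N isT.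
have z3 : z (mod9 3) = 0 by rewrite -g3 -[RHS]h2 g0 add0r.
have z8 : z (mod9 8) = 0 by rewrite -[LHS]/(z (mod9 (6 + (0 + 2) %% 3))) h1 g0 add0r.
have z4 : z (mod9 4) = 0 by rewrite -g3 -[RHS]/(z (mod9 (6 + (1 + 2) %% 3))) h3 g1 add0r.
have z7 : z (mod9 7) = 0 by rewrite -[LHS]h4 g1 add0r.
have z5 : z (mod9 5) = 0 by rewrite -z7 -[RHS]/(z (mod9 (6 + (2 + 2) %% 3))) h5 g2 add0r.
apply: mod9E => n; rewrite ffunE.
by case: n => [|[|[|[|[|[|[|[|[|]]]]]]]]].
Qed.

(** * Transport along graph isomorphisms *)

Section GraphIso.
Variables (G H : graph) (fV : vertex G -> vertex H) (fE : edge G -> edge H).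
Hypothesis iso : graph_iso fV fE.

Definition pullback (M : zmodType) (z : {ffun edge H -> M}) : {ffun edge G -> M} :=
  [ffun e => if src (fE e) == fV (src e) then z (fE e) else - z (fE e)].

Lemma boundary_pullback (M : zmodType) (z : {ffun edge H -> M}) v :
  boundary (pullback z) v = boundary z (fV v).
Proof.
have [bV bE js] := iso; have fV_inj := bij_inj bV.
rewrite !ffunE [X in X - _]big_mkcond [X in _ - X]big_mkcond -sumrB.
rewrite [X in _ = X - _]big_mkcond [X in _ = _ - X]big_mkcond -sumrB.
rewrite [RHS](reindex fE (onW_bij _ bE)) /=; apply: eq_bigr => e _; rewrite ffunE.
case: (js e) => -[-> ->]; rewrite !(inj_eq fV_inj) ?eqxx //.
case: (eqVneq (tgt e) (src e)) => [->|_]; first by rewrite !subrr.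
by case: (tgt e == v); case: (src e == v);
  rewrite /= ?opprK ?subr0 ?sub0r ?opprK ?subrr ?addNr ?oppr0 ?addr0 ?add0r.
Qed.

Lemma valence_iso v : valence (fV v) = valence v.
Proof.
have [bV bE js] := iso; have fV_inj := bij_inj bV.
have cE (K : graph) (w : vertex K) :
    valence w = (\sum_(e : edge K) ((src e == w) + (tgt e == w)))%N.
  by rewrite big_split /valence -!sum1_card [X in (X + _)%N]big_mkcond [X in (_ + X)%N]big_mkcond.
rewrite !cE (reindex fE (onW_bij _ bE)) /=; apply: eq_bigr => e _.
by case: (js e) => -[-> ->]; rewrite !(inj_eq fV_inj) // addnC.
Qed.

Lemma loopless_iso : (forall e : edge G, src e != tgt e) -> forall e : edge H, src e != tgt e.
Proof.
move=> lG e; have [bV [gE gK gK'] js] := iso; rewrite -[e]gK'.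
by case: (js (gE e)) => -[-> ->]; rewrite (inj_eq (bij_inj bV)) // eq_sym.
Qed.

Lemma harmonic_lift (K : fieldType) (z : {ffun edge G -> K^o}) :
  boundary z = 0 -> (forall e, z e != 0) ->
  exists om : {ffun edge H -> K^o}, boundary om = 0 /\ forall e, om e != 0.
Proof.
move=> z0 zn; have [[gV gVK gVK'] [gE gK gK'] js] := iso.
pose om : {ffun edge H -> K^o} := [ffun e =>
  if src e == fV (src (gE e)) then z (gE e) else - z (gE e)].
exists om; split; last by move=> e; rewrite ffunE; case: ifP; rewrite ?oppr_eq0.
apply/ffunP => v; rewrite -[v]gVK' -boundary_pullback.
suff -> : pullback om = z by rewrite z0 !ffunE.
by apply/ffunP => e; rewrite !ffunE gK; case: (_ == _); rewrite ?opprK.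
Qed.

End GraphIso.

Definition isomorphic (G H : graph) := exists (fV : vertex G -> vertex H)
  (fE : edge G -> edge H), graph_iso fV fE.

Lemma joins_sym (G : graph) (e : edge G) u v : joins e u v -> joins e v u.
Proof. by case; [right|left]. Qed.

Lemma isomorphic_trans G H K : isomorphic G H -> isomorphic H K -> isomorphic G K.
Proof.
move=> [fV [fE [bV bE js]]] [gV [gE [bV' bE' js']]]; exists (gV \o fV), (gE \o fE).
split; [exact: bij_comp|exact: bij_comp|move=> e /=].
by case: (js e) (js' (fE e)) => -[-> ->] // /joins_sym.
Qed.

Lemma isomorphic_sym G H : isomorphic G H -> isomorphic H G.
Proof.
move=> [fV [fE [[gV gVK gVK'] [gE gK gK'] js]]]; exists gV, gE.
split; [by exists fV|by exists fE|move=> e].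
by case: (js (gE e)); rewrite !gK' => -[-> ->]; rewrite !gVK; [left|right].
Qed.

(** Conservation of flow: all edges other than [e] have both ends on the same side [S] or outside
    it, so the boundary of [om] summed over [S] is [om e] up to sign. *)
Lemma harmonic_not_separating (K : fieldType) (G : graph) (om : {ffun edge G -> K^o}) e :
  connected_graph G -> boundary om = 0 -> om e != 0 -> ~~ separating e.
Proof.
move=> /andP[_ /forallP Gj] /ffunP om0 ome; rewrite /separating negbK.
apply/forallP => u; apply/forallP => v; apply: contraT => uv.
pose S x := connect (adj (predC1 e)) u x.
have adj_sym : connect_sym (adj (G := G) (predC1 e)).
  by apply: sym_connect_sym => x y; apply: eq_existsb => e'; rewrite orbC.
have Sadj x y : adj (predC1 e) x y -> S x = S y.
  move=> xy; apply/idP/idP => h; apply: connect_trans h _; first exact: connect1.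
  by rewrite adj_sym connect1.
have Sends e' : e' != e -> S (src e') = S (tgt e').
  by move=> e'e; apply: Sadj; apply/existsP; exists e'; rewrite inE e'e !eqxx.
(* Otherwise [S] would be closed under adjacency in the connected graph [G] and would contain
   [v]. *)
have Se : S (src e) != S (tgt e).
  apply: contraNneq uv => Se.
  have Sall e' : S (src e') = S (tgt e').
    by have [->|/Sends] := eqVneq e' e.
  have cl x y : adj predT x y -> S x = S y.
    by move=> /existsP[e' /= /orP[]] /andP[/eqP <- /eqP <-]; rewrite Sall.
  have clp p x : path (adj predT) x p -> S x = S (last x p).
    by elim: p x => //= y p IHp x /andP[/cl -> /IHp].
  have /connectP[p pp ->] := forallP (Gj u) v.
  by rewrite -/(S _) -clp //; exact: connect0.
have := erefl (\sum_(x | S x) (\sum_(e' | tgt e' == x) om e' - \sum_(e' | src e' == x) om e')).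
rewrite {1}big1; last by move=> x _; have := om0 x; rewrite !ffunE.
have sumS (h : edge G -> vertex G) :
    \sum_(x | S x) \sum_(e' | h e' == x) om e' = \sum_e' (if S (h e') then om e' else 0).
  rewrite -big_mkcond [RHS](partition_big h S) //; apply: eq_bigr => x Sx.
  by apply: eq_bigl => e'; case: eqP => [->|]; rewrite ?Sx ?andbF.
rewrite sumrB !sumS -sumrB (bigD1 e) //= big1 ?addr0; last first.
  by move=> e' /Sends ->; rewrite subrr.
move: Se; case: (S (src e)); case: (S (tgt e)) => // _; rewrite ?sub0r ?subr0 => /eqP.
  by rewrite eq_sym oppr_eq0 (negPf ome).
by rewrite eq_sym (negPf ome).
Qed.

(** * Sliding chips on the loop of loops *)

Section LoopOfLoops.
Variables (R : realType) (Gam : metric_graph R).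
Variables (fV : vertex loops_graph -> vertex Gam) (fE : edge loops_graph -> edge Gam).
Hypothesis iso : graph_iso fV fE.
Hypothesis len_bounds : forall e : edge Gam, 9 < len e < 11.
Local Notation point := (point_of Gam).
Implicit Types (j k : edge loops_graph) (p q : R).

Local Notation L j := (len (fE j)).

(* The isomorphism need not preserve orientations: this is the coordinate on fE j
   of the point at distance p from the image of src j. *)
Definition position j p : R := if src (fE j) == fV (src j) then p else L j - p.

Definition loops_pt j p : point := edge_pt (fE j) (position j p).

Lemma positionK j p : position j (position j p) = p.
Proof. by rewrite /position; case: (_ == _) => //; rewrite opprB addrC subrK. Qed.

Lemma position_range j p : 0 <= p <= L j -> 0 <= position j p <= L j.
Proof.
by rewrite /position => /andP[h1 h2]; case: ifP => _; apply/andP; split; lra.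
Qed.

Lemma loops_src_neq_tgt j : src j != tgt j.
Proof.
move: j; apply: mod9E => n; rewrite -val_eqE /=.
by case: n => [|[|[|[|[|[|[|[|[|]]]]]]]]].
Qed.

Lemma orientation j : (src (fE j) = fV (src j) /\ tgt (fE j) = fV (tgt j)) \/
  [/\ src (fE j) = fV (tgt j), tgt (fE j) = fV (src j) &
      (src (fE j) == fV (src j)) = false].
Proof.
have [bV _ /(_ j)[[-> ->]|[-> ->]]] := iso; [by left|right; split=> //].
by rewrite (inj_eq (bij_inj bV)) eq_sym (negPf (loops_src_neq_tgt j)).
Qed.

Lemma loops_pt0 j : loops_pt j 0 = inl (fV (src j)).
Proof.
rewrite /loops_pt /position; case: (orientation j) => [[<- _]|[_ t ->]].
  by rewrite eqxx edge_pt0.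
by rewrite subr0 edge_pt_len t.
Qed.

Lemma loops_pt_len j : loops_pt j (L j) = inl (fV (tgt j)).
Proof.
rewrite /loops_pt /position; case: (orientation j) => [[s <-]|[s _ ->]].
  by rewrite s eqxx edge_pt_len.
by rewrite subrr edge_pt0 s.
Qed.

Lemma loops_pt_surj (x : point) : exists j p, 0 <= p <= L j /\ loops_pt j p = x.
Proof.
have [[gV gVK gVK'] [gE gK gK'] _] := iso.
case: x => [v|p].
  have [j jE] : exists j, src j = gV v.
    move: (gV v); apply: (@mod6E (fun u => exists j : edge loops_graph, src j = u)) => n.
    case: n => [|[|[|[|[|[|]]]]]] // _; [exists (mod9 0)|exists (mod9 6)|exists (mod9 1)|
      exists (mod9 7)|exists (mod9 2)|exists (mod9 8)]; exact: val_inj.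
  exists j, 0; rewrite loops_pt0 jE gVK'; split=> //.
  by rewrite lexx ltW ?len_gt0.
have /andP[p0 pl] := valP p.
exists (gE (val p).1), (position (gE (val p).1) (val p).2); split.
  by apply: position_range; rewrite gK' (ltW p0) (ltW pl).
by rewrite /loops_pt positionK gK' edge_ptE.
Qed.

(** An entry [(j, a, b)] moves a chip along [j] from position [a] to position [b]. The hypothesis
    says that the integral along all moves is 0, which is the condition in Abel's theorem. *)
Lemma loops_move (l : seq (edge loops_graph * R * R)) :
  all (fun m => (0 <= m.1.2 <= L m.1.1) && (0 <= m.2 <= L m.1.1)) l ->
  (forall om : {ffun edge Gam -> R^o}, boundary om = 0 ->
     \sum_(m <- l) pullback fV fE om m.1.1 * (m.2 - m.1.2) = 0) ->
  principal (\sum_(m <- l) ((<< loops_pt m.1.1 m.2 >> : divisor Gam) - << loops_pt m.1.1 m.1.2 >>)).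
Proof.
move=> lv l0; apply/principalP.
exists (path_kinks [seq (fE m.1.1, position m.1.1 m.1.2, position m.1.1 m.2) | m <- l]); split.
- apply/allP => k /flattenP[_ /mapP[_ /mapP[m ml ->] ->]].
  have /andP[/position_range h1 /position_range h2] := allP lv m ml.
  by rewrite !inE => /orP[] /eqP ->.
- rewrite /kinks_boundary big_flatten !big_map; apply: eq_bigr => m _.
  rewrite big_cons big_seq1 /= mulr1z mulrN1z opprB addrA subrK //.
- apply/lfunP => om; rewrite path_kinks_integral path_integralE big_map lfunE /=.
  have omH : boundary (vsval om) = 0.
    by have := subvsP om; rewrite memv_ker lfunE => /eqP.
  rewrite -[RHS](l0 _ omH); apply: eq_bigr => m _; rewrite ffunE /= /position.
  case: ifP => _ //; set a : R := vsval om _; set b := m.2; set c := m.1.2.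
  by rewrite -[LHS]/(a * (L m.1.1 - b - (L m.1.1 - c))) -[RHS]/(- a * (b - c)); ring.
Qed.

Definition chords_agree k0 k1 k2 := forall om : {ffun edge Gam -> R^o}, boundary om = 0 ->
  pullback fV fE om k0 = pullback fV fE om k1 /\ pullback fV fE om k0 = pullback fV fE om k2.

Definition chips k0 k1 k2 q0 q1 q2 : divisor Gam :=
  << loops_pt k0 q0 >> + << loops_pt k1 q1 >> + << loops_pt k2 q2 >>.

Section Slide.
Variables (k0 k1 k2 : edge loops_graph) (q0 q1 q2 : R).
Hypotheses (q0I : 0 <= q0 <= L k0) (q1I : 0 <= q1 <= L k1) (q2I : 0 <= q2 <= L k2).
Hypothesis sum_q : 13 <= q0 + q1 + q2 <= 15.
Hypothesis agree : chords_agree k0 k1 k2.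

(* The sum of the three positions stays constant, so that the two other chips can
   be placed at the same position q; the bounds on the sum keep them on the edges. *)
Lemma slide_to_chord p : 0 <= p <= L k0 -> exists2 D',
  equivalent D' (chips k0 k1 k2 q0 q1 q2) & effective (D' - << loops_pt k0 p >>).
Proof.
move=> pI; pose q := (q0 + q1 + q2 - p) / 2.
exists (chips k0 k1 k2 p q q); last first.
  rewrite /chips addrAC (addrAC << loops_pt k0 p >>) subrr add0r.
  by apply: effectiveD; exact: effectiveU.
rewrite /equivalent (_ : _ - _ = \sum_(m <- [:: (k0, q0, p); (k1, q1, q); (k2, q2, q)])
    ((<< loops_pt m.1.1 m.2 >> : divisor Gam) - << loops_pt m.1.1 m.1.2 >>)); last first.
  rewrite !big_cons big_nil /= addr0 /chips.
  by rewrite !opprD addrACA [X in X + _]addrACA; exact/esym/addrA.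
have bounds := (len_bounds (fE k1), len_bounds (fE k2), len_bounds (fE k0)).
have qI : 0 <= q <= 9.
  by case: bounds => [_ /andP[? ?]]; move/andP: sum_q => [? ?]; rewrite /q; apply/andP; split; lra.
apply: loops_move => [|om /agree[a1 a2]].
  rewrite /= q0I q1I q2I pI; case/andP: qI => -> q9 /=.
  by case: bounds => [[/andP[l1 _] /andP[l2 _]] _]; rewrite !(le_trans q9) // ltW.
rewrite !big_cons big_nil /= -a1 -a2 addr0 -!mulrDr.
by rewrite (_ : p - q0 + _ = 0) ?mulr0 // /q; field.
Qed.

(* Two chips move to the ends of j, then along j towards each other. *)
Lemma slide_to_loop j p : tgt k0 = src j -> src k1 = tgt j -> 0 <= p <= L j ->
  exists2 D', equivalent D' (chips k0 k1 k2 q0 q1 q2) & effective (D' - << loops_pt j p >>).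
Proof.
(* The first chip goes to the end of [k0], position [L k0], and the second to the start of [k1],
   position 0; the constant sum leaves [q] for the third. *)
move=> k0j k1j /andP[p0 pl]; pose q := q0 + q1 + q2 - L k0.
exists ((<< loops_pt j p >> : divisor Gam) + << loops_pt k2 q >> +
  << loops_pt j (L j - p) >>); last first.
  rewrite addrAC (addrAC << loops_pt j p >>) subrr add0r.
  by apply: effectiveD; exact: effectiveU.
rewrite /equivalent (_ : _ - _ = \sum_(m <- [:: (k0, q0, L k0); (k1, q1, 0); (k2, q2, q);
      (j, 0, p); (j, L j, L j - p)])
    ((<< loops_pt m.1.1 m.2 >> : divisor Gam) - << loops_pt m.1.1 m.1.2 >>)); last first.
  rewrite !big_cons big_nil /= addr0 /chips loops_pt0 !loops_pt_len k0j k1j loops_pt0.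
  apply/eqP/freeg_eqP => x; rewrite !(raddfD, raddfN) /=; ring.
have /andP[l0 l0'] := len_bounds (fE k0); have /andP[l2 _] := len_bounds (fE k2).
have /andP[s1 s2] := sum_q.
apply: loops_move => [|om /agree[a1 a2]].
  have h0 k : 0 <= 0 <= L k by rewrite lexx ltW ?len_gt0.
  have hL k : 0 <= L k <= L k by rewrite lexx ltW ?len_gt0.
  have hp : 0 <= L j - p <= L j by rewrite subr_ge0 pl lerBlDr lerDl p0.
  have hq : 0 <= q <= L k2 by rewrite /q; apply/andP; split; lra.
  by rewrite /= q0I q1I q2I !h0 !hL hp hq p0 pl.
rewrite !big_cons big_nil /= -a1 -a2; set a : R := pullback _ _ _ k0; set b : R := pullback _ _ _ j.
by rewrite -[LHS]/(a * (L k0 - q0) + (a * (0 - q1) + (a * (q - q2) + (b * (p - 0) +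
  (b * (L j - p - L j) + 0))))) /q; ring.
Qed.

End Slide.

Lemma chords_agree_loops om : boundary (om : {ffun edge Gam -> R^o}) = 0 ->
  forall i, (i < 3)%N -> pullback fV fE om (mod9 (6 + i)) = pullback fV fE om (mod9 6).
Proof.
move=> om0; have : boundary (pullback fV fE om) = 0.
  by apply/ffunP => v; rewrite (boundary_pullback iso) om0 !ffunE.
move=> /harmonic_loops h; have [h1 h2] := h 1%N isT; have [h3 h4] := h 2%N isT.
have h7 : pullback fV fE om (mod9 7) = pullback fV fE om (mod9 6) by rewrite -[LHS]h2 -h1.
have h8 : pullback fV fE om (mod9 8) = pullback fV fE om (mod9 7) by rewrite -[LHS]h4 -h3.
by case=> [|[|[|]]] // _; rewrite ?h8 h7.
Qed.

(** Sums between 11 and 18 suit all chords of length between 9 and 11. The positions [s], 5 and 4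
    keep the sum between 13 and 15 while [s] varies. *)
Lemma chips_rank s : 4 <= s <= 6 -> 1 <= rank (chips (mod9 6) (mod9 7) (mod9 8) s 5 4).
Proof.
move=> /andP[s4 s6].
have qI j q : 0 <= q <= 9 -> 0 <= q <= L j.
  move=> /andP[-> q9]; apply: le_trans q9 _; apply: ltW.
  by case/andP: (len_bounds (fE j)).
have sI j : 0 <= s <= L j by apply: qI; apply/andP; split; lra.
have I5 j : 0 <= (5 : R) <= L j by apply: qI; apply/andP; split; lra.
have I4 j : 0 <= (4 : R) <= L j by apply: qI; apply/andP; split; lra.
have agree i1 i2 i3 : (i1 < 3)%N -> (i2 < 3)%N -> (i3 < 3)%N ->
    chords_agree (mod9 (6 + i1)) (mod9 (6 + i2)) (mod9 (6 + i3)).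
  by move=> l1 l2 l3 om /chords_agree_loops h; rewrite !h.
have dD : deg (chips (mod9 6) (mod9 7) (mod9 8) s 5 4) = 3.
  by rewrite /chips (degD (_ : {freeg point})) (degD (_ : {freeg point})) !degU.
have [x0 _] : exists x0 : point, True by exists (loops_pt (mod9 0) 0).
apply/(rank_ge1P x0 dD) => x; have [j [p [pI <-]]] := loops_pt_surj x.
(* The sliding lemmas reach the chord [k0], or a loop edge from the end of [k0] to the start of
   [k1], so the chips are reordered according to the edge to be reached. *)
have D1 : chips (mod9 6) (mod9 7) (mod9 8) s 5 4 = chips (mod9 7) (mod9 6) (mod9 8) 5 s 4.
  by rewrite /chips (addrC << _ >>).
have D2 : chips (mod9 6) (mod9 7) (mod9 8) s 5 4 = chips (mod9 8) (mod9 6) (mod9 7) 4 s 5.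
  by rewrite /chips addrC addrA.
have D3 : chips (mod9 6) (mod9 7) (mod9 8) s 5 4 = chips (mod9 7) (mod9 8) (mod9 6) 5 4 s.
  by rewrite /chips addrC addrA addrC addrA.
move: j p pI; apply: mod9E => n n9 p pI.
have S1 : 13 <= s + 5 + 4 <= 15 by apply/andP; split; lra.
have S2 : 13 <= 5 + s + 4 <= 15 by apply/andP; split; lra.
have S3 : 13 <= 4 + s + 5 <= 15 by apply/andP; split; lra.
have S4 : 13 <= 5 + 4 + s <= 15 by apply/andP; split; lra.
case: n n9 pI => [|[|[|[|[|[|[|[|[|]]]]]]]]] // _ pI.
- rewrite D2; apply: (slide_to_loop (I4 _) (sI _) (I5 _) S3 (@agree 2 0 1 isT isT isT)) pI;
    exact: val_inj.
- apply: (slide_to_loop (sI _) (I5 _) (I4 _) S1 (@agree 0 1 2 isT isT isT)) pI;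
    exact: val_inj.
- rewrite D3; apply: (slide_to_loop (I5 _) (I4 _) (sI _) S4 (@agree 1 2 0 isT isT isT)) pI;
    exact: val_inj.
- rewrite D2; apply: (slide_to_loop (I4 _) (sI _) (I5 _) S3 (@agree 2 0 1 isT isT isT)) pI;
    exact: val_inj.
- apply: (slide_to_loop (sI _) (I5 _) (I4 _) S1 (@agree 0 1 2 isT isT isT)) pI;
    exact: val_inj.
- rewrite D3; apply: (slide_to_loop (I5 _) (I4 _) (sI _) S4 (@agree 1 2 0 isT isT isT)) pI;
    exact: val_inj.
- exact: (slide_to_chord (sI _) (I5 _) (I4 _) S1 (@agree 0 1 2 isT isT isT)) pI.
- rewrite D1; exact: (slide_to_chord (I5 _) (sI _) (I4 _) S2 (@agree 1 0 2 isT isT isT)) pI.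
- rewrite D2; exact: (slide_to_chord (I4 _) (sI _) (I5 _) S3 (@agree 2 0 1 isT isT isT)) pI.
Qed.

(** The values 2 and -1 on each double edge add up to 1 on the chords. This form rules out
    separating edges and shows that no [edge_form] is zero. *)
Lemma harmonic_nowhere_zero : exists om : {ffun edge Gam -> R^o},
  boundary om = 0 /\ forall e, om e != 0.
Proof.
pose z : {ffun 'I_9 -> R^o} := [ffun e : 'I_9 => nth 0 [:: 2; 2; 2; -1; -1; -1; 1; 1; 1] e].
apply: (harmonic_lift iso (z := z)).
  by apply/harmonic_loops => i i3; rewrite !ffunE; case: i i3 => [|[|[|]]] //= _; split; lra.
by apply: mod9E => n n9; rewrite ffunE /= modn_small //;
  case: n n9 => [|[|[|[|[|[|[|[|[|]]]]]]]]] //= _; rewrite ?oppr_eq0 ?oner_eq0 // pnatr_eq0.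
Qed.

Lemma loops_not_separating e : ~~ separating (e : edge Gam).
Proof.
have [om [om0 omn]] := harmonic_nowhere_zero.
exact: harmonic_not_separating (mgraph_connected Gam) om0 (omn e).
Qed.

Lemma loops_brill_noether (w : point) :
  exists2 n, polyhedral_of_dim w 3 (brill_noether Gam 1 3) n & (0 < n)%N.
Proof.
have surj (x : point) : exists e s, 0 <= s <= len e /\ edge_pt e s = x.
  have [j [p [pI <-]]] := loops_pt_surj x.
  by exists (fE j), (position j p); split=> //; exact: position_range.
have [om [om0 omn]] := harmonic_nowhere_zero.
have omH : om \in harmonic Gam by rewrite memv_ker lfunE /= om0.
have ef0 : edge_form (fE (mod9 6)) != 0 :> harmonic_dual Gam.
  apply: contraNneq (omn (fE (mod9 6))) => ef.
  by have := edge_formE (fE (mod9 6)) (Subvs omH); rewrite ef lfunE /= => <-.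
have /andP[l9 l11] := len_bounds (fE (mod9 6)).
have qI j q : 0 <= q <= 9 -> 0 <= q <= L j.
  move=> /andP[-> q9]; apply: le_trans q9 _; apply: ltW.
  by case/andP: (len_bounds (fE j)).
have fam (s : R) : 4 <= s <= 6 ->
    let c : cell Gam := (fE (mod9 6), fE (mod9 7), fE (mod9 8)) in
    let t := (position (mod9 6) s, position (mod9 7) 5, position (mod9 8) 4) in
    in_box c t /\ 1 <= rank (cell_divisor c t).
  move=> sI; split; last exact: chips_rank sI.
  by case/andP: sI => s4 s6; split; apply: position_range; apply: qI; apply/andP; split; lra.
(* When the isomorphism reverses the first chord, the interval from 4 to 6 is reflected. *)
have [a [b [ab abP]]] : exists a b : R, a < b /\ forall s, a <= s <= b ->
    exists2 s', 4 <= s' <= 6 & s = position (mod9 6) s'.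
  case oE : (src (fE (mod9 6)) == fV (src (mod9 6 : edge loops_graph))).
    exists 4, 6; split=> [|s sI]; first by lra.
    exists (position (mod9 6) s); last by rewrite positionK.
    by rewrite /position oE.
  exists (L (mod9 6) - 6), (L (mod9 6) - 4); split=> [|s /andP[s1 s2]]; first by lra.
  exists (position (mod9 6) s); last by rewrite positionK.
  by rewrite /position oE; apply/andP; split; lra.
pose c : cell Gam := (fE (mod9 6), fE (mod9 7), fE (mod9 8)).
apply: (brill_noether_polyhedral_pos w surj (c := c)
  (t2 := position (mod9 7) 5) (t3 := position (mod9 8) 4) ab) => // s /abP[s' sI ->].
exact: fam.
Qed.

End LoopOfLoops.

(** * The open set in the moduli space *)

Lemma contract_iso (R : realType) (G : graph) (l : edge G -> R)
    (l_ge0 : forall e, 0 <= l e) (Gconn : connected_graph G) :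
  (forall e, 0 < l e) ->
  exists2 fE : edge G -> edge (Defs.contract l_ge0 Gconn),
    graph_iso (G := G) (H := Defs.contract l_ge0 Gconn) (contract_proj l) fE &
    forall e, len (fE e) = l e.
Proof.
move=> lp; have rootE v : fingraph.root (zero_adj l) v = v.
  have /connectP[[|x p] /= + ->] := connect_root (zero_adj l) v; first by [].
  move=> /andP[/existsP[e /andP[]]]; rewrite inE => /eqP le0.
  by have := lp e; rewrite le0 ltxx.
have fV_bij : bijective (contract_proj l).
  exists val => [v|v]; first exact: rootE.
  by apply: val_inj => /=; rewrite rootE.
have fE_bij : bijective (fun e => Sub e (lp e) : contract_edge l).
  by exists val => [e|e]; [|exact: val_inj].
by exists (fun e => Sub e (lp e) : contract_edge l); [split=> // e; left|].
Qed.

Section Moduli.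
Variable R : realType.
Implicit Types x y : cone_sum R 4.

Definition edge_length x (e : edge (projT1 x)) : R :=
  (val (projT2 x) : 'rV[R]_(nb_edge (projT1 x))) 0 e.

(** An isomorphism rather than an equality, because every labelling and orientation of the loop of
    loops has a cone of its own. *)
Definition loops_region x := isomorphic loops_graph (projT1 x) /\
  forall e, 9 < edge_length (x := x) e < 11.

Lemma loops_region_metric x : loops_region x ->
  isomorphic loops_graph (metric_graph_of x) /\
  forall e : edge (metric_graph_of x), 9 < len e < 11.
Proof.
move=> [isoG lx]; split; last by move=> [e le]; exact: lx.
apply: isomorphic_trans isoG _.
have [|fE iso _] := @contract_iso _ _ _ (@cone_ge0 R 4 _ (projT2 x)) (stable_connected (projT1 x)).
  by move=> e; case/andP: (lx e) => l9 _; apply: lt_trans l9; lra.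
by exists (contract_proj _), fE.
Qed.

Lemma isomorphic_card G H : isomorphic G H ->
  #|vertex G| = #|vertex H| /\ #|edge G| = #|edge H|.
Proof.
by move=> [fV [fE [bV bE _]]]; split; [exact: bij_eq_card bV|exact: bij_eq_card bE].
Qed.

(** By [stable_bounds], the graph of [y] has no more vertices or edges than the loop of loops, so
    the isometry induces a graph isomorphism. *)
Lemma loops_region_isometric x y : loops_region x ->
  isometric (metric_graph_of x) (metric_graph_of y) -> loops_region y.
Proof.
move=> /loops_region_metric[isox lx] [f fbij fdist].
have [cV cE] := isomorphic_card isox; rewrite !card_ord in cV cE.
have [bV bE] := stable_bounds (projT1 y).
have cVy : (#|vertex (metric_graph_of y)| <= #|vertex (metric_graph_of x)|)%N.
  rewrite -cV; apply: leq_trans bV.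
  by rewrite -[leqRHS]card_ord /= card_sig; apply: max_card.
have cEy : (#|edge (metric_graph_of y)| <= #|edge (metric_graph_of x)|)%N.
  rewrite -cE; apply: leq_trans bE.
  by rewrite -[leqRHS]card_ord /= card_sig; apply: max_card.
have [fV [fE iso0]] := isox.
have ll := loopless_iso iso0 loops_src_neq_tgt.
have v3 (v : vertex (metric_graph_of x)) : (3 <= valence v)%N.
  have [[gV gVK gVK'] _ _] := iso0; rewrite -[v]gVK' (valence_iso iso0).
  exact: loops_valence.
have [isoxy ly] := isometry_graph_iso fbij fdist ll v3 lx cVy cEy.
have isoy : isomorphic loops_graph (metric_graph_of y) := isomorphic_trans isox isoxy.
(* The contracted graph still has 9 edges, so no edge of [y] has been contracted. *)
have all_pos e : 0 < edge_length (x := y) e.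
  have : #|contract_edge (edge_length (x := y))| = nb_edge (projT1 y).
    apply/eqP; rewrite eqn_leq -{1}[nb_edge _]card_ord card_sig max_card /=.
    by rewrite -card_sig; have [_ <-] := isomorphic_card isoy; rewrite card_ord.
  rewrite card_sig -[RHS]card_ord -[RHS](cardC [pred e | 0 < edge_length (x := y) e]).
  move=> /eqP; rewrite -[X in X == _]addn0 eqn_add2l eq_sym => /eqP/card0_eq/(_ e).
  by rewrite !inE => /negbFE.
split.
  apply: isomorphic_trans isoy _; apply: isomorphic_sym.
  have [fE' iso' _] := @contract_iso _ _ _ (@cone_ge0 R 4 _ (projT2 y))
    (stable_connected (projT1 y)) all_pos.
  by exists (contract_proj _), fE'.
move=> e; exact: (ly (Sub e (all_pos e) : contract_edge _)).
Qed.

Lemma open_loops_region : open [set x | loops_region x].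
Proof.
apply/sigT_openP => G.
have [isoG|nisoG] := pselect (isomorphic loops_graph G); last first.
  rewrite (_ : _ @^-1` _ = set0); first exact: open0.
  by apply/seteqP; split=> // l [].
rewrite openE => l [_ lb] /=.
have near_e (e : edge G) : \forall l' \near l, 9 < (val l' : 'rV[R]_(nb_edge G)) 0 e < 11.
  have ce : continuous (fun l' : @cone R 4 G => (val l' : 'rV[R]_(nb_edge G)) 0 e).
    move=> l'; have vc : {for l', continuous (set_val : @cone R 4 G -> 'rV[R]_(nb_edge G))}.
      exact: initial_continuous.
    exact: (continuous_comp vc (@coord_continuous R 1 _ 0 e _)).
  have oI : open [set r : R | 9 < r < 11].
    rewrite (_ : [set _ | _] = `]9, 11[%classic); first exact: itv_open.
    by apply/seteqP; split=> r /=; rewrite in_itv.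
  by apply: (ce l [set r : R | 9 < r < 11]); apply: open_nbhs_nbhs; split=> //; exact: lb.
have near_bounds := filter_forall (nbhs_filter l) near_e.
by apply: (@filterS _ _ (nbhs_filter l) _ _ _ near_bounds) => l' h; split.
Qed.

End Moduli.

Definition loops_stable : stable_graph 4 :=
  StableGraph (ends := loops_ends) loops_connected loops_genus loops_valence.

Lemma loops_point_in_cone (R : realType) :
  @cone R 4 loops_stable (const_mx 10).
Proof.
split=> [e|[s sc s0]]; first by rewrite mxE.
case: s sc s0 => [|a s] //= _ /(_ a); rewrite mem_head mxE => /(_ isT)/eqP.
by rewrite pnatr_eq0.
Qed.

Theorem theorem1p2 (R : realType) :
  exists U : set (moduli R 4),
    [/\ open U, U !=set0 &
        forall x : cone_sum R 4, U (isometry_class x) ->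
          (forall e : edge (metric_graph_of x), ~~ separating e) /\
          (forall w : point_of (metric_graph_of x),
             exists2 n : nat,
               polyhedral_of_dim w 3 (brill_noether (metric_graph_of x) 1 3) n
               & (0 < n)%N)].
Proof.
pose U : set (moduli R 4) := [set c | exists2 x, loops_region x & isometry_class x = c].
have UP x : U (isometry_class x) -> loops_region x.
  move=> [y yr yx]; apply: loops_region_isometric yr _.
  by apply/asboolP; move/eqmodP: yx.
exists U; split.
- have oU := @open_loops_region R.
  rewrite /open /= /quotient_open (_ : _ @^-1` _ = [set x | loops_region x]) //.
  by apply/seteqP; split=> [x|x xr]; [exact: UP|exists x].
- pose x : cone_sum R 4 := existT _ loops_stable
    (exist _ (const_mx 10) (mem_set (loops_point_in_cone R))).
  exists (isometry_class x); exists x => //; split.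
    by exists id, id; split; [exists id|exists id|left].
  by move=> e; rewrite /edge_length /= mxE; apply/andP; split; lra.
- move=> x /UP/loops_region_metric[[fV [fE iso]] lx]; split=> [e|w].
    exact: loops_not_separating iso e.
  exact: loops_brill_noether iso lx w.
Qed.
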